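(* Over $\mathsf{RCA}_0$, the following are equivalent: (1) $\mathsf{I}\Sigma^0_2$, the induction scheme for $\Sigma^0_2$ formulas with set parameters. (2) If $V$ is a countable vector space such that for some $n$ every subset of $n$ vectors of $V$ is linearly dependent, then $V$ has a basis. (3) Suppose $f\colon\mathbb{N}\to[\mathbb{N}]^{<\mathbb{N}}_{\ne\emptyset}$ and there is an $n$ such that every finite $X\subseteq\mathbb{N}$ with $|X|\ge n$ satisfies $\exists t\,(f(t)=X)$. Then there is $X\in[\mathbb{N}]^{<\mathbb{N}}$ such that $f(t)\ne X$ for all $t$, and for every $Y\in[\mathbb{N}]^{<\mathbb{N}}$ with $|X|<|Y|$ there is $t$ with $f(t)=Y$. (4) Suppose $f\colon\mathbb{N}\to[\mathbb{N}]^{<\mathbb{N}}_{\ne\emptyset}$ and there is an $n$ such that every finite $X\subseteq\mathbb{N}$ with $|X|\ge n$ satisfies $\exists t\,(f(t)=X)$. Then there is $X\in[\mathbb{N}]^{<\mathbb{N}}$ such that $f(t)\ne X$ for all $t$, and for every finite $Y\subseteq\mathbb{N}$ with $X\subsetneq Y$ there is $t$ with $f(t)=Y$.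
   Context: Work in second-order arithmetic. $[\mathbb{N}]^{<\mathbb{N}}$ denotes the (codes for) finite subsets of $\mathbb{N}$ and $[\mathbb{N}]^{<\mathbb{N}}_{\ne\emptyset}$ the nonempty ones. A countable vector space is over a countable field, in the standard sense of second-order arithmetic. *)

(* Defs.v *)
(* The axioms of RCA_0, pairing, codes of finite sets and countable algebra
   follow Simpson, "Subsystems of Second Order Arithmetic". *)
From mathcomp Require Import all_boot.
Set Implicit Arguments.
Unset Strict Implicit.
Unset Printing Implicit Defensive.

Declare Scope L2_scope.
Delimit Scope L2_scope with L2.

(* Henkin structures: set quantifiers range over [sets], an arbitrary nonempty
   sort.  Equality of numbers is true equality; equality of sets is not
   primitive. *)
Record L2structure := L2Structure {
  num : Type;
  sets : Type;
  n0 : num;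
  n1 : num;
  nadd : num -> num -> num;
  nmul : num -> num -> num;
  nlt : num -> num -> Prop;
  elt : num -> sets -> Prop;
  sets_inhabited : inhabited sets }.

Arguments n0 {l}.
Arguments n1 {l}.

Notation "0" := n0 : L2_scope.
Notation "1" := n1 : L2_scope.
Notation "x + y" := (nadd x y) : L2_scope.
Notation "x * y" := (nmul x y) : L2_scope.
Notation "x < y" := (nlt x y) : L2_scope.

Local Open Scope L2_scope.

(* De Bruijn indices for number variables; set variables are never bound, so
   they are exactly the set parameters. *)
Inductive term :=
  | TVar of nat
  | TZero
  | TOne
  | TAdd of term & term
  | TMul of term & term.

(* In [FBAll t p] and [FBEx t p], which stand for "forall x < t, p" and
   "exists x < t, p", the term [t] is outside the scope of the variable bound
   in [p], as required of bounded quantifiers. *)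
Inductive form :=
  | FEq of term & term
  | FLt of term & term
  | FElt of term & nat
  | FNot of form
  | FAnd of form & form
  | FOr of form & form
  | FImp of form & form
  | FBAll of term & form
  | FBEx of term & form
  | FAll of form
  | FEx of form.

Definition scons (T : Type) (a : T) (e : nat -> T) : nat -> T :=
  fun i => if i is j.+1 then e j else a.

Fixpoint eval (M : L2structure) (e : nat -> num M) (t : term) : num M :=
  match t with
  | TVar i => e i
  | TZero => 0
  | TOne => 1
  | TAdd t u => eval e t + eval e u
  | TMul t u => eval e t * eval e u
  end.

Fixpoint sat (M : L2structure) (E : nat -> sets M) (e : nat -> num M)
    (p : form) : Prop :=
  match p with
  | FEq t u => eval e t = eval e u
  | FLt t u => eval e t < eval e u
  | FElt t X => elt (eval e t) (E X)
  | FNot p => ~ sat E e p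
  | FAnd p q => sat E e p /\ sat E e q
  | FOr p q => sat E e p \/ sat E e q
  | FImp p q => sat E e p -> sat E e q
  | FBAll t p => forall a, a < eval e t -> sat E (scons a e) p
  | FBEx t p => exists a, a < eval e t /\ sat E (scons a e) p
  | FAll p => forall a, sat E (scons a e) p
  | FEx p => exists a, sat E (scons a e) p
  end.

Fixpoint bounded (p : form) : bool :=
  match p with
  | FEq _ _ | FLt _ _ | FElt _ _ => true
  | FNot p | FBAll _ p | FBEx _ p => bounded p
  | FAnd p q | FOr p q | FImp p q => bounded p && bounded q
  | FAll _ | FEx _ => false
  end.

Fixpoint is_Sigma (k : nat) (p : form) : bool :=
  match k, p with
  | 0%N, p => bounded p
  | k.+1, FEx p => is_Pi k p
  | _, _ => false
  end
with is_Pi (k : nat) (p : form) : bool :=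
  match k, p with
  | 0%N, p => bounded p
  | k.+1, FAll p => is_Sigma k p
  | _, _ => false
  end.

(* The number parameters are in [e] and the set parameters in [E]. *)
Definition ISigma (M : L2structure) (k : nat) : Prop :=
  forall p : form, is_Sigma k p ->
  forall (E : nat -> sets M) (e : nat -> num M),
    sat E (scons 0 e) p ->
    (forall n, sat E (scons n e) p -> sat E (scons (n + 1) e) p) ->
    forall n, sat E (scons n e) p.

(* The variable naming [X] does not occur in [p] or [q], since their set
   variables are interpreted by [E], which is fixed before [X]. *)
Definition Delta1_comprehension (M : L2structure) : Prop :=
  forall p q : form, is_Sigma 1 p -> is_Pi 1 q ->
  forall (E : nat -> sets M) (e : nat -> num M),
    (forall n, sat E (scons n e) p <-> sat E (scons n e) q) ->
    exists X : sets M, forall n, elt n X <-> sat E (scons n e) p.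

Record basic_axioms (M : L2structure) : Prop := BasicAxioms {
  succ_neq0 : forall n : num M, n + 1 <> 0;
  succ_inj : forall m n : num M, m + 1 = n + 1 -> m = n;
  nadd0 : forall m : num M, m + 0 = m;
  naddS : forall m n : num M, m + (n + 1) = (m + n) + 1;
  nmul0 : forall m : num M, m * 0 = 0;
  nmulS : forall m n : num M, m * (n + 1) = m * n + m;
  nlt0 : forall m : num M, ~ m < 0;
  nltS : forall m n : num M, m < n + 1 <-> m < n \/ m = n }.

Record RCA0 (M : L2structure) : Prop := RCA0_Axioms {
  RCA0_basic : basic_axioms M;
  RCA0_ISigma1 : ISigma M 1;
  RCA0_comprehension : Delta1_comprehension M }.

Definition pr (M : L2structure) (i j : num M) : num M :=
  (i + j) * (i + j) + i.

Definition ndvd (M : L2structure) (d n : num M) : Prop := exists q, n = d * q.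

Definition code_shape (M : L2structure) (c : num M) : Prop :=
  exists k m n, c = pr k (pr m n).

(* [felt i c] : i belongs to the finite set described by c. *)
Definition felt (M : L2structure) (i c : num M) : Prop :=
  exists k m n, [/\ c = pr k (pr m n), i < k & ndvd (m * (i + 1) + 1) n].

(* Only the least description of a finite set is its code, so that equality of
   codes is equality of finite sets. *)
Definition is_code (M : L2structure) (c : num M) : Prop :=
  code_shape c /\
  forall c' : num M, c' < c -> code_shape c' ->
    ~ (forall i, felt i c' <-> felt i c).

Definition fsub (M : L2structure) (X Y : num M) : Prop :=
  forall i, felt i X -> felt i Y.

Definition fproper (M : L2structure) (X Y : num M) : Prop :=
  fsub X Y /\ ~ fsub Y X.

Definition fnonempty (M : L2structure) (X : num M) : Prop := exists i, felt i X.

(* [F] is (the graph of) a function from A to B. *)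
Definition is_fun (M : L2structure) (F A B : num M -> Prop) : Prop :=
  (forall p, F p -> exists a b, [/\ A a, B b & p = pr a b]) /\
  (forall a, A a -> exists! b, F (pr a b)).

Definition cartesian (M : L2structure) (A B : num M -> Prop) : num M -> Prop :=
  fun p => exists a b, [/\ A a, B b & p = pr a b].

(* [s] is the code of a finite sequence of length k with entries in A;
   [at_ s i x] says that its i-th entry is x. *)
Definition fin_seq (M : L2structure) (s k : num M) (A : num M -> Prop) : Prop :=
  is_code s /\ is_fun (fun p => felt p s) (fun i => i < k) A.

Definition at_ (M : L2structure) (s i x : num M) : Prop := felt (pr i x) s.

Definition inj_seq (M : L2structure) (s : num M) : Prop :=
  forall i j x, at_ s i x -> at_ s j x -> i = j.

Definition fin_card (M : L2structure) (X k : num M) : Prop :=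
  exists s, [/\ fin_seq s k (fun x => felt x X), inj_seq s
              & forall x, felt x X -> exists i, at_ s i x].

Definition fin_card_ge (M : L2structure) (X n : num M) : Prop :=
  exists k, fin_card X k /\ (n < k \/ n = k).

Definition fin_card_lt (M : L2structure) (X Y : num M) : Prop :=
  exists k l, [/\ fin_card X k, fin_card Y l & k < l].

(* f is a function from N to the set of codes of nonempty finite sets. *)
Definition finset_fun (M : L2structure) (f : sets M) : Prop :=
  is_fun (fun p => elt p f) (fun _ => True)
         (fun X => is_code X /\ fnonempty X).

(* f(t) = X *)
Definition fapp (M : L2structure) (f : sets M) (t X : num M) : Prop :=
  elt (pr t X) f.

Definition in_set (M : L2structure) (X : sets M) : num M -> Prop :=
  fun n => elt n X.

(* F(a, b) = c *)
Definition fapp2 (M : L2structure) (F : sets M) (a b c : num M) : Prop :=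
  elt (pr (pr a b) c) F.

Record field (M : L2structure) := Field {
  K_ : sets M;
  addK : sets M;
  mulK : sets M;
  oppK : sets M;
  zeroK : num M;
  oneK : num M;
  zeroK_in : elt zeroK K_;
  oneK_in : elt oneK K_;
  addK_fun :
    is_fun (in_set addK) (cartesian (in_set K_) (in_set K_)) (in_set K_);
  mulK_fun :
    is_fun (in_set mulK) (cartesian (in_set K_) (in_set K_)) (in_set K_);
  oppK_fun : is_fun (in_set oppK) (in_set K_) (in_set K_);
  addKA : forall a b c ab bc abc,
    fapp2 addK a b ab -> fapp2 addK b c bc -> fapp2 addK ab c abc ->
    fapp2 addK a bc abc;
  addKC : forall a b c, fapp2 addK a b c -> fapp2 addK b a c;
  add0K : forall a, elt a K_ -> fapp2 addK zeroK a a;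
  addNK : forall a b, fapp oppK a b -> fapp2 addK b a zeroK;
  mulKA : forall a b c ab bc abc,
    fapp2 mulK a b ab -> fapp2 mulK b c bc -> fapp2 mulK ab c abc ->
    fapp2 mulK a bc abc;
  mulKC : forall a b c, fapp2 mulK a b c -> fapp2 mulK b a c;
  mul1K : forall a, elt a K_ -> fapp2 mulK oneK a a;
  mulVK : forall a, elt a K_ -> a <> zeroK ->
    exists b, fapp2 mulK b a oneK;
  mulKDr : forall a b c b_c ab ac s,
    fapp2 addK b c b_c -> fapp2 mulK a b ab -> fapp2 mulK a c ac ->
    fapp2 addK ab ac s -> fapp2 mulK a b_c s;
  oneK_neq0 : oneK <> zeroK }.

Record vspace (M : L2structure) (K : field M) := VSpace {
  V_ : sets M;
  addV : sets M;
  scaleV : sets M;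
  zeroV : num M;
  zeroV_in : elt zeroV V_;
  addV_fun :
    is_fun (in_set addV) (cartesian (in_set V_) (in_set V_)) (in_set V_);
  scaleV_fun :
    is_fun (in_set scaleV) (cartesian (in_set (K_ K)) (in_set V_)) (in_set V_);
  addVA : forall u v w uv vw uvw,
    fapp2 addV u v uv -> fapp2 addV v w vw -> fapp2 addV uv w uvw ->
    fapp2 addV u vw uvw;
  addVC : forall u v w, fapp2 addV u v w -> fapp2 addV v u w;
  add0V : forall v, elt v V_ -> fapp2 addV zeroV v v;
  addNV : forall v, elt v V_ -> exists w, fapp2 addV w v zeroV;
  scaleVA : forall a b v ab bv abv,
    fapp2 (mulK K) a b ab -> fapp2 scaleV b v bv -> fapp2 scaleV ab v abv ->
    fapp2 scaleV a bv abv;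
  scale1V : forall v, elt v V_ -> fapp2 scaleV (oneK K) v v;
  scaleVDr : forall a u v uv au av s,
    fapp2 addV u v uv -> fapp2 scaleV a u au -> fapp2 scaleV a v av ->
    fapp2 addV au av s -> fapp2 scaleV a uv s;
  scaleVDl : forall a b v ab av bv s,
    fapp2 (addK K) a b ab -> fapp2 scaleV a v av -> fapp2 scaleV b v bv ->
    fapp2 addV av bv s -> fapp2 scaleV ab v s }.

(* [a] and [v] are sequences of k scalars and of k vectors, and w is the sum
   a(0)v(0) + ... + a(k-1)v(k-1), computed through the sequence s of its
   partial sums. *)
Definition lin_comb (M : L2structure) (K : field M) (V : vspace K)
    (k a v w : num M) : Prop :=
  [/\ fin_seq a k (in_set (K_ K)), fin_seq v k (in_set (V_ V))
    & exists s, [/\ fin_seq s (k + 1) (in_set (V_ V)), at_ s 0 (zeroV V),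
        at_ s k w
      & forall i, i < k -> exists c u y x z,
          [/\ at_ a i c, at_ v i u & fapp2 (scaleV V) c u y] /\
          [/\ at_ s i x, fapp2 (addV V) x y z & at_ s (i + 1) z]]].

Definition lin_dep (M : L2structure) (K : field M) (V : vspace K)
    (P : num M -> Prop) : Prop :=
  exists k a v, [/\ lin_comb V k a v (zeroV V), fin_seq v k P, inj_seq v
    & exists i c, at_ a i c /\ c <> zeroK K].

Definition spans (M : L2structure) (K : field M) (V : vspace K)
    (P : num M -> Prop) : Prop :=
  forall w, elt w (V_ V) ->
    exists k a v, lin_comb V k a v w /\ fin_seq v k P.

Definition is_basis (M : L2structure) (K : field M) (V : vspace K)
    (B : sets M) : Prop :=
  [/\ forall x, elt x B -> elt x (V_ V), ~ lin_dep V (in_set B)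
    & spans V (in_set B)].

(* Main.v *)
Require Import Defs.
From HB Require Import structures.
From mathcomp Require Import all_boot all_order all_algebra.
From mathcomp Require Import boolp.
From Stdlib Require Import Ring.

(* 1 -> 2: if a space V of bounded dimension had no basis, every independent
   sequence of length n would extend to one of length n + 1; "there is an
   independent sequence of length n" is Sigma-2, so there would be independent
   sequences of every length.  2 -> 3 goes through 1: by Sigma-2 induction there
   is a set of largest cardinality that f does not enumerate.  3 -> 4 only
   compares cardinalities.

   That 2 and 4 imply 1 rests on a principle about a function g with
   values below N: the numbers s that are the last hit of their block, i.e. such that
   g t <> g s for all t > s, are bounded.  It yields Sigma-2 induction: for a
   formula "exists a forall c, theta x a c" let g hit x whenever a further
   initial segment of candidates a for x has been refuted.  Then the formula
   holds of x < N iff x is hit finitely often, hence iff it is not hit after the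
   bound, which is a Pi-1 condition.

   For 4, enumerate the finite sets containing an s that is hit again: a maximal
   set not enumerated consists of all the last hits.  For 2, take vectors e_s
   over the rationals of the model and, as soon as g s is hit again at time t,
   identify e_s with C(t) e_0, where C grows so fast that equality of vectors
   is decidable.  At most N + 1 coordinates survive, so the dimension is
   bounded; and the e_s for last hits s are independent of all the other
   generators, so any basis must mention all of them. *)

Set Implicit Arguments.
Unset Strict Implicit.
Unset Printing Implicit Defensive.
Import Order.TTheory GRing.Theory Num.Theory.
Local Open Scope L2_scope.

(** * Definability by bounded and Sigma-1 formulas *)

(* External objects (classes of rationals, vectors as functions, chosen witnesses) are used freely;
   but a function is available to induction and comprehension in the model only once its graph is
   known to be Sigma-1 with parameters, so recursiveness of codes is the recurring obligation.

   Killing [e_s] cannot mean setting it to 0: testing [e_s = 0] would then decide whether [s] is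
   ever hit again. Identified with [C(t) e_0], the vector reveals the time [t] through its size, so
   a relation between vectors of bounded size involves early kills only. Suppose a relation has
   support below [b] and coefficients of size and denominator at most [h]. The term killed last, at
   time [m + 1], has size at least [C(m + 1) / h], and all the others together at most
   [b * h * C(m)]; when [b + h <= m], the growth factor [(m + 2)^3] forbids cancellation. This
   argument needs an ordered field of scalars, hence the rationals.

   A basis bounds the last hits because bounded dimension forces the basis itself to be bounded,
   while the code of a vector exceeds every index in its support. *)
Existing Class RCA0.

Section Definability.
Context {M : L2structure}.
Local Notation num := (num M).
Local Notation env := (nat -> num).

Inductive tmfun : (env -> num) -> Prop :=
| tm_var i : tmfun (fun e => e i)
| tm_cst c : tmfun (fun _ => c)
| tm_add F G : tmfun F -> tmfun G -> tmfun (fun e => F e + G e)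
| tm_mul F G : tmfun F -> tmfun G -> tmfun (fun e => F e * G e).

(* [Delta0 P] says that [P] is definable by a bounded formula with arbitrary
   number and set parameters; no syntax is needed to work with it. *)
Inductive Delta0 : (env -> Prop) -> Prop :=
| d0_eq F G : tmfun F -> tmfun G -> Delta0 (fun e => F e = G e)
| d0_lt F G : tmfun F -> tmfun G -> Delta0 (fun e => F e < G e)
| d0_elt F X : tmfun F -> Delta0 (fun e => elt (F e) X)
| d0_not P : Delta0 P -> Delta0 (fun e => ~ P e)
| d0_and P Q : Delta0 P -> Delta0 Q -> Delta0 (fun e => P e /\ Q e)
| d0_ball F P : tmfun F -> Delta0 P ->
    Delta0 (fun e => forall a, a < F e -> P (scons a e))
| d0_ext P Q : Delta0 P -> (forall e, P e <-> Q e) -> Delta0 Q.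

Lemma d0_or P Q : Delta0 P -> Delta0 Q -> Delta0 (fun e => P e \/ Q e).
Proof.
move=> hP hQ; apply: (d0_ext (d0_not (d0_and (d0_not hP) (d0_not hQ)))) => e.
by have := EM (P e); have := EM (Q e); tauto.
Qed.

Lemma d0_imp P Q : Delta0 P -> Delta0 Q -> Delta0 (fun e => P e -> Q e).
Proof.
move=> hP hQ; apply: (d0_ext (d0_or (d0_not hP) hQ)) => e.
by have := EM (P e); tauto.
Qed.

Lemma d0_bex F P : tmfun F -> Delta0 P ->
  Delta0 (fun e => exists a, a < F e /\ P (scons a e)).
Proof.
move=> hF hP; apply: (d0_ext (d0_not (d0_ball hF (d0_not hP)))) => e; split.
  move=> h; apply: contrapT => h'; apply: h => a ha hPa; apply: h'.
  by exists a.
by move=> [a [ha hPa]] h; apply: (h a).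
Qed.

Lemma tmfun_subst F : tmfun F -> forall s : env -> env,
  (forall i, tmfun (fun e => s e i)) -> tmfun (fun e => F (s e)).
Proof.
elim=> [i|c|{}F G _ hF _ hG|{}F G _ hF _ hG] s hs //; first exact: tm_cst.
- by apply: tm_add; [apply: hF|apply: hG].
- by apply: tm_mul; [apply: hF|apply: hG].
Qed.

Lemma tmfun_scons s : (forall i, tmfun (fun e => s e i)) ->
  forall i, tmfun (fun e => scons (e 0%N) (s (fun j => e j.+1)) i).
Proof.
move=> hs [|i] /=; first exact: tm_var.
apply: (tmfun_subst (hs i) (s := fun e j => e j.+1)) => j; exact: tm_var.
Qed.

Lemma d0_subst P : Delta0 P -> forall s : env -> env,
  (forall i, tmfun (fun e => s e i)) -> Delta0 (fun e => P (s e)).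
Proof.
elim=> [F G hF hG|F G hF hG|F X hF|{}P _ hP|{}P Q _ hP _ hQ|F {}P hF _ hP
       |{}P Q _ hP hPQ] s hs.
- by apply: d0_eq; apply: tmfun_subst.
- by apply: d0_lt; apply: tmfun_subst.
- by apply: d0_elt; apply: tmfun_subst.
- by apply: d0_not; apply: hP.
- by apply: d0_and; [apply: hP|apply: hQ].
- exact: (d0_ball (tmfun_subst hF hs) (hP _ (tmfun_scons hs))).
- by apply: (d0_ext (hP _ hs)) => e; apply: hPQ.
Qed.

(** The places below [k] are variables; those from [k] on hold the number parameters of a [Delta0]
    predicate, which a formula can mention only through its environment. *)
Definition vars_then (k : nat) (e c : env) : env :=
  fun i => if (i < k)%N then e i else c (i - k)%N.

Lemma scons_vars_then k a e c :
  scons a (vars_then k e c) = vars_then k.+1 (scons a e) c.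
Proof. by apply: funext => -[|i]. Qed.

Lemma in_catl (T : Type) (l1 l2 : seq T) (P : T -> Prop) :
  (forall x, List.In x (l1 ++ l2) -> P x) -> forall x, List.In x l1 -> P x.
Proof. by move=> h x hx; apply/h/List.in_or_app; left. Qed.

Lemma in_catr (T : Type) (l1 l2 : seq T) (P : T -> Prop) :
  (forall x, List.In x (l1 ++ l2) -> P x) -> forall x, List.In x l2 -> P x.
Proof. by move=> h x hx; apply/h/List.in_or_app; right. Qed.

Lemma tmfun_term F : tmfun F -> exists (lc : seq num) K,
  forall c : env, (forall x, List.In x lc -> exists i, c i = x) ->
  forall k, (K <= k)%N -> exists t, forall e, F e = eval (vars_then k e c) t.
Proof.
elim=> [i|x|{}F G _ [l1 [K1 h1]] _ [l2 [K2 h2]]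
       |{}F G _ [l1 [K1 h1]] _ [l2 [K2 h2]]].
- exists [::], i.+1 => c _ k hk; exists (TVar i) => e /=.
  by rewrite /vars_then hk.
- exists [:: x], 0%N => c hc k _; have [i <-] := hc x (or_introl erefl).
  by exists (TVar (k + i)%N) => e /=; rewrite /vars_then ltnNge leq_addr addKn.
- exists (l1 ++ l2), (maxn K1 K2) => c hc k; rewrite geq_max => /andP[k1 k2].
  have [t ht] := h1 c (in_catl hc) k k1.
  have [u hu] := h2 c (in_catr hc) k k2.
  by exists (TAdd t u) => e /=; rewrite ht hu.
- exists (l1 ++ l2), (maxn K1 K2) => c hc k; rewrite geq_max => /andP[k1 k2].
  have [t ht] := h1 c (in_catl hc) k k1.
  have [u hu] := h2 c (in_catr hc) k k2.
  by exists (TMul t u) => e /=; rewrite ht hu.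
Qed.

(** A predicate uses finitely many parameters. Any [E] and [c] that list them will do, so that the
    formulas of several predicates can share one environment. *)
Lemma d0_form P : Delta0 P -> exists (lE : seq (sets M)) (lc : seq num) K,
  forall E : nat -> sets M, (forall X, List.In X lE -> exists i, E i = X) ->
  forall c : env, (forall x, List.In x lc -> exists i, c i = x) ->
  forall k, (K <= k)%N -> exists p, bounded p /\
    forall e, P e <-> sat E (vars_then k e c) p.
Proof.
elim=> [F G /tmfun_term[l1 [K1 h1]] /tmfun_term[l2 [K2 h2]]
       |F G /tmfun_term[l1 [K1 h1]] /tmfun_term[l2 [K2 h2]]
       |F X /tmfun_term[l1 [K1 h1]]|{}P _ [lE [lc [K h]]]
       |{}P Q _ [lE1 [l1 [K1 h1]]] _ [lE2 [l2 [K2 h2]]]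
       |F {}P /tmfun_term[l1 [K1 h1]] _ [lE [l2 [K2 h2]]]
       |{}P Q _ [lE [lc [K h]]] hPQ].
- exists [::], (l1 ++ l2), (maxn K1 K2) => E _ c hc k.
  rewrite geq_max => /andP[k1 k2].
  have [t ht] := h1 c (in_catl hc) k k1.
  have [u hu] := h2 c (in_catr hc) k k2.
  by exists (FEq t u); split=> // e /=; rewrite ht hu.
- exists [::], (l1 ++ l2), (maxn K1 K2) => E _ c hc k.
  rewrite geq_max => /andP[k1 k2].
  have [t ht] := h1 c (in_catl hc) k k1.
  have [u hu] := h2 c (in_catr hc) k k2.
  by exists (FLt t u); split=> // e /=; rewrite ht hu.
- exists [:: X], l1, K1 => E hE c hc k k1.
  have [t ht] := h1 c hc k k1; have [i hi] := hE X (or_introl erefl).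
  by exists (FElt t i); split=> // e /=; rewrite hi ht.
- exists lE, lc, K => E hE c hc k hk; have [p [bp hp]] := h E hE c hc k hk.
  by exists (FNot p); split=> // e /=; rewrite hp.
- exists (lE1 ++ lE2), (l1 ++ l2), (maxn K1 K2) => E hE c hc k.
  rewrite geq_max => /andP[k1 k2].
  have [p [bp hp]] := h1 E (in_catl hE) c (in_catl hc) k k1.
  have [q [bq hq]] := h2 E (in_catr hE) c (in_catr hc) k k2.
  by exists (FAnd p q); split=> [|e] /=; rewrite ?bp ?bq // hp hq.
- exists lE, (l1 ++ l2), (maxn K1 K2) => E hE c hc k.
  rewrite geq_max => /andP[k1 k2].
  have [t ht] := h1 c (in_catl hc) k k1.
  (* The bound variable takes one more place in front of the parameters. *)
  have [p [bp hp]] := h2 E hE c (in_catr hc) k.+1 (leqW k2).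
  exists (FBAll t p); split=> // e /=; rewrite -ht.
  by split=> h a /h; rewrite hp scons_vars_then.
- exists lE, lc, K => E hE c hc k hk; have [p [bp hp]] := h E hE c hc k hk.
  by exists p; split=> // e; rewrite -hPQ.
Qed.

Lemma d0_of_form E p : bounded p -> forall s : env -> env,
  (forall i, tmfun (fun e => s e i)) -> Delta0 (fun e => sat E (s e) p).
Proof.
have tmt t s : (forall i, tmfun (fun e : env => s e i)) ->
    tmfun (fun e => eval (s e) t).
  move=> hs; elim: t => [i|||t ht u hu|t ht u hu] //=; try exact: tm_cst.
    exact: tm_add.
  exact: tm_mul.
elim: p => [t u|t u|t X|p hp|p hp q hq|p hp q hq|p hp q hq|t p hp|t p hp|//|//]
  /= hb s hs.
- by apply: d0_eq; apply: tmt.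
- by apply: d0_lt; apply: tmt.
- by apply: d0_elt; apply: tmt.
- by apply: d0_not; apply: hp.
- by case/andP: hb => bp bq; apply: d0_and; [apply: hp|apply: hq].
- by case/andP: hb => bp bq; apply: d0_or; [apply: hp|apply: hq].
- by case/andP: hb => bp bq; apply: d0_imp; [apply: hp|apply: hq].
- exact: d0_ball (tmt t s hs) (hp hb _ (tmfun_scons hs)).
- exact: d0_bex (tmt t s hs) (hp hb _ (tmfun_scons hs)).
Qed.

Definition Sigma1 (P : env -> Prop) : Prop :=
  exists Q, Delta0 Q /\ forall e, P e <-> exists a, Q (scons a e).

Definition Sigma2 (P : env -> Prop) : Prop :=
  exists Q, Sigma1 Q /\ forall e, P e <-> exists a, ~ Q (scons a e).

Lemma s1_ext P Q : Sigma1 P -> (forall e, P e <-> Q e) -> Sigma1 Q.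
Proof. by move=> [R [hR h]] hPQ; exists R; split=> // e; rewrite -hPQ h. Qed.

Lemma s1_subst P (s : env -> env) : Sigma1 P ->
  (forall i, tmfun (fun e => s e i)) -> Sigma1 (fun e => P (s e)).
Proof.
move=> [R [hR h]] hs; exists (fun e => R (scons (e 0%N) (s (fun j => e j.+1)))).
by split=> [|e]; [apply: (d0_subst hR); apply: tmfun_scons|rewrite h].
Qed.

Lemma s1_d0 P : Delta0 P -> Sigma1 P.
Proof.
move=> hP; exists (fun e => P (fun j => e j.+1)); split.
  by apply: (d0_subst hP) => i; apply: tm_var.
by move=> e; split=> [h|[]//]; exists 0.
Qed.

Lemma subset_nth (T : Type) (x0 : T) (l : seq T) x :
  List.In x l -> exists i, nth x0 l i = x.
Proof.
elim: l => //= y l IHl [->|/IHl[i <-]]; first by exists 0%N.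
by exists i.+1.
Qed.

(** Delta-1 comprehension reads both formulas in the same environment. The three places beyond [k]
    leave room for the free variable and the two quantified variables of a Sigma-2 formula. *)
Lemma d0_form2 P Q : Delta0 P -> Delta0 Q -> exists E c k p q,
  [/\ bounded p, bounded q,
      forall e, P e <-> sat E (vars_then k.+3 e c) p
    & forall e, Q e <-> sat E (vars_then k.+3 e c) q].
Proof.
move=> /d0_form[lE1 [l1 [K1 h1]]] /d0_form[lE2 [l2 [K2 h2]]].
have [X0] := sets_inhabited M.
pose E := nth X0 (lE1 ++ lE2); pose c := nth (0 : num) (l1 ++ l2).
pose k := maxn K1 K2.
have [p [bp hp]] : exists p, bounded p /\
    forall e, P e <-> sat E (vars_then k.+3 e c) p.
  apply: h1 => [X hX|x hx|]; [apply: subset_nth|apply: subset_nth|].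
  - by apply: List.in_or_app; left.
  - by apply: List.in_or_app; left.
  - by rewrite (leq_trans (leq_maxl K1 K2)) // -addn3 leq_addr.
have [q [bq hq]] : exists q, bounded q /\
    forall e, Q e <-> sat E (vars_then k.+3 e c) q.
  apply: h2 => [X hX|x hx|]; [apply: subset_nth|apply: subset_nth|].
  - by apply: List.in_or_app; right.
  - by apply: List.in_or_app; right.
  - by rewrite (leq_trans (leq_maxr K1 K2)) // -addn3 leq_addr.
by exists E, c, k, p, q.
Qed.

Context {hM : RCA0 M}.

Lemma s1_induct (P : num -> Prop) : Sigma1 (fun e => P (e 0%N)) ->
  P 0 -> (forall n, P n -> P (n + 1)) -> forall n, P n.
Proof.
move=> [Q [hQ hP]] h0 hS n.
have [E [c [k [p [_ [bp _ hp _]]]]]] := d0_form2 hQ hQ.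
have key m : P m <-> sat E (scons m (vars_then k.+1 (fun=> 0) c)) (FEx p).
  rewrite (hP (scons m (fun=> 0))) /=.
  split=> -[a ha]; exists a; move: ha; by rewrite hp -!scons_vars_then.
apply/key; apply: (RCA0_ISigma1 hM) => //; first exact/key.
by move=> m /key hm; apply/key; apply: hS.
Qed.

Lemma s2_induct (hM2 : ISigma M 2) (P : num -> Prop) :
  Sigma2 (fun e => P (e 0%N)) ->
  P 0 -> (forall n, P n -> P (n + 1)) -> forall n, P n.
Proof.
move=> [Q [[R [hR hQ]] hP]] h0 hS n.
have [E [c [k [p [_ [bp _ hp _]]]]]] := d0_form2 hR hR.
have key m : P m <->
    sat E (scons m (vars_then k (fun=> 0) c)) (FEx (FAll (FNot p))).
  rewrite (hP (scons m (fun=> 0))) /=.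
  split=> -[a ha]; exists a.
    move=> b hb; apply: ha; apply/hQ; exists b.
    by rewrite hp -!scons_vars_then.
  by move=> /hQ[b]; rewrite hp -!scons_vars_then; apply: ha.
apply/key; apply: hM2 => //; first exact/key.
by move=> m /key hm; apply/key; apply: hS.
Qed.

Lemma d1_comprehension (P : num -> Prop) : Sigma1 (fun e => P (e 0%N)) ->
  Sigma1 (fun e => ~ P (e 0%N)) -> exists X, forall n, elt n X <-> P n.
Proof.
move=> [Q [hQ hP]] [R [hR hnP]].
have [E [c [k [p [q [bp bq hp hq]]]]]] := d0_form2 hQ hR.
have keyp m : P m <-> sat E (scons m (vars_then k.+1 (fun=> 0) c)) (FEx p).
  rewrite (hP (scons m (fun=> 0))) /=.
  split=> -[a ha]; exists a; move: ha; by rewrite hp -!scons_vars_then.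
have keyq m :
    P m <-> sat E (scons m (vars_then k.+1 (fun=> 0) c)) (FAll (FNot q)).
  rewrite /=; have := hnP (scons m (fun=> 0)) => /= {}hnP.
  split=> [hPm a ha|h].
    by case: hnP => _; apply=> //; exists a; rewrite hq -!scons_vars_then.
  apply: contrapT => /hnP[a]; rewrite hq -!scons_vars_then; exact: h.
have [|X hX] := RCA0_comprehension hM (p := FEx p) (q := FAll (FNot q))
  bp bq (E := E) (e := vars_then k.+1 (fun=> 0) c).
  by move=> m; rewrite -keyp -keyq.
by exists X => m; rewrite hX -keyp.
Qed.

End Definability.

Ltac tmfun_tac := lazymatch goal with
  | |- tmfun (fun _ => ?c) => exact: tm_cst
  | |- tmfun (fun e => @?F e + @?G e) =>
      apply: (@tm_add _ F G); cbn beta; tmfun_tac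
  | |- tmfun (fun e => @?F e * @?G e) =>
      apply: (@tm_mul _ F G); cbn beta; tmfun_tac
  | |- tmfun (fun e => e ?i) => exact: tm_var
  end.

Ltac d0_tac := cbn beta; lazymatch goal with
  | |- Delta0 (fun e => ~ @?P e) => apply: (@d0_not _ P); d0_tac
  | |- Delta0 (fun e => @?P e /\ @?Q e) => apply: (@d0_and _ P Q); d0_tac
  | |- Delta0 (fun e => @?P e \/ @?Q e) => apply: (@d0_or _ P Q); d0_tac
  | |- Delta0 (fun e => @?F e = @?G e) => apply: (@d0_eq _ F G); tmfun_tac
  | |- Delta0 (fun e => nlt (@?F e) (@?G e)) =>
      apply: (@d0_lt _ F G); tmfun_tac
  | |- Delta0 (fun e => @?P e -> @?Q e) => apply: (@d0_imp _ P Q); d0_tac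
  end.

(** * The ordered semiring of the numbers of the model *)

Section Arithmetic.
Context {M : L2structure} {hM : RCA0 M}.
Local Notation num := (num M).
Implicit Types x y z n m : num.

Let bM : basic_axioms M := RCA0_basic hM.

Lemma d0_induct (P : num -> Prop) : Delta0 (fun e => P (e 0%N)) ->
  P 0 -> (forall n, P n -> P (n + 1)) -> forall n, P n.
Proof. by move=> /s1_d0; apply: s1_induct. Qed.

Lemma num0 x : x + 0 = x. Proof. exact: nadd0. Qed.
Lemma numS x y : x + (y + 1) = x + y + 1. Proof. exact: naddS. Qed.

Lemma nadd0n x : 0 + x = x.
Proof.
apply: (@d0_induct (fun x => 0 + x = x)); first by d0_tac.
  exact: num0.
by move=> n hn; rewrite numS hn.
Qed.

Lemma naddSn x y : x + 1 + y = x + y + 1.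
Proof.
apply: (@d0_induct (fun y => x + 1 + y = x + y + 1)); first by d0_tac.
  by rewrite !num0.
by move=> n hn; rewrite !numS hn.
Qed.

Lemma naddC x y : x + y = y + x.
Proof.
apply: (@d0_induct (fun y => x + y = y + x)); first by d0_tac.
  by rewrite num0 nadd0n.
by move=> n hn; rewrite numS hn naddSn.
Qed.

Lemma naddA x y z : x + (y + z) = x + y + z.
Proof.
apply: (@d0_induct (fun z => x + (y + z) = x + y + z)); first by d0_tac.
  by rewrite !num0.
by move=> n hn; rewrite !numS hn.
Qed.

Lemma nmul0n x : 0 * x = 0.
Proof.
apply: (@d0_induct (fun x => 0 * x = 0)); first by d0_tac.
  exact: (nmul0 bM).
by move=> n hn; rewrite (nmulS bM) hn num0.
Qed.

Lemma nmulSn x y : (x + 1) * y = x * y + y.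
Proof.
apply: (@d0_induct (fun y => (x + 1) * y = x * y + y)); first by d0_tac.
  by rewrite !(nmul0 bM) num0.
move=> n hn; rewrite !(nmulS bM) hn -!naddA; congr (_ + _).
by rewrite naddC -naddA (naddC 1).
Qed.

Lemma nmulC x y : x * y = y * x.
Proof.
apply: (@d0_induct (fun y => x * y = y * x)); first by d0_tac.
  by rewrite (nmul0 bM) nmul0n.
by move=> n hn; rewrite (nmulS bM) hn nmulSn.
Qed.

Lemma nmulDl x y z : (x + y) * z = x * z + y * z.
Proof.
apply: (@d0_induct (fun z => (x + y) * z = x * z + y * z)); first by d0_tac.
  by rewrite !(nmul0 bM) num0.
move=> n hn; rewrite !(nmulS bM) hn -!naddA; congr (_ + _).
by rewrite !naddA (naddC x).
Qed.

Lemma nmulA x y z : x * (y * z) = x * y * z.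
Proof.
apply: (@d0_induct (fun z => x * (y * z) = x * y * z)); first by d0_tac.
  by rewrite !(nmul0 bM).
move=> n hn; rewrite !(nmulS bM) -hn.
by rewrite nmulC nmulDl (nmulC _ x) (nmulC y x).
Qed.

Lemma nmul1n x : 1 * x = x.
Proof. by rewrite -(nadd0n 1) nmulSn nmul0n nadd0n. Qed.

Lemma num_semi_ring : semi_ring_theory (0 : num) 1 (@nadd M) (@nmul M) eq.
Proof.
split; [exact: nadd0n|exact: naddC|exact: naddA|exact: nmul1n|exact: nmul0n
  |exact: nmulC|exact: nmulA|exact: nmulDl].
Qed.

Lemma naddIr x y z : x + z = y + z -> x = y.
Proof.
apply: (@d0_induct (fun z => x + z = y + z -> x = y)); first by d0_tac.
  by rewrite !num0.
by move=> n hn; rewrite !numS => /(succ_inj bM).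
Qed.

Lemma naddIl x y z : z + x = z + y -> x = y.
Proof. by rewrite !(naddC z); apply: naddIr. Qed.

Lemma num_case x : x = 0 \/ exists y, x = y + 1.
Proof.
(* The quantifier is moved in front of the disjunction to make the induction formula Sigma-1. *)
have h : Sigma1 (fun e => exists y : num, e 0%N = 0 \/ e 0%N = y + 1).
  exists (fun e => e 1%N = 0 \/ e 1%N = e 0%N + 1).
  by split=> //; d0_tac.
have := (@s1_induct M hM (fun x => exists y, x = 0 \/ x = y + 1) h).
case/(_ _ _ x)=> [|n _|y [->|->]]; [by exists 0; left| |by left|].
  by exists n; right.
by right; exists y.
Qed.

Lemma nltE x y : x < y <-> exists z, y = x + z + 1.
Proof.
split=> [|[z ->]].
  have h : Sigma1 (fun e => exists z : num, x < e 0%N -> e 0%N = x + z + 1).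
    exists (fun e => x < e 1%N -> e 1%N = x + e 0%N + 1).
    by split=> //; d0_tac.
  have := (@s1_induct M hM (fun y => exists z, x < y -> y = x + z + 1) h).
  case/(_ _ _ y)=> [|n [z hz]|z hz /hz ->]; [|  |by exists z].
    by exists 0 => /(nlt0 bM).
  have [lt_xn|nlt_xn] := EM (x < n).
    by exists (z + 1) => _; rewrite numS -hz.
  by exists 0 => /(nltS bM)[/nlt_xn//|->]; rewrite num0.
apply: (@d0_induct (fun z => x < x + z + 1)); first by d0_tac.
  by rewrite num0; apply/(nltS bM); right.
by move=> n hn; rewrite numS; apply/(nltS bM); left.
Qed.

Lemma nlt_total x y : [\/ x < y, x = y | y < x].
Proof.
apply: (@d0_induct (fun x => [\/ x < y, x = y | y < x])).
- apply: (@d0_ext _ (fun e => e 0%N < y \/ e 0%N = y \/ y < e 0%N)).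
    by d0_tac.
  move=> e; split=> [[h|[h|h]]|[h|h|h]];
  by [constructor 1|constructor 2|constructor 3|left|right; left|right; right].
- have [->|[z ->]] := num_case y; first by constructor 2.
  by constructor 1; rewrite nltE; exists z; rewrite nadd0n.
move=> n [/nltE[z ->]|->|/nltE[z ->]].
- have [->|[w ->]] := num_case z; first by constructor 2; rewrite num0.
  by constructor 1; rewrite nltE; exists w; rewrite naddSn numS.
- by constructor 3; rewrite nltE; exists 0; rewrite num0.
by constructor 3; rewrite nltE; exists (z + 1); rewrite numS.
Qed.

Lemma nle_ex x y : ~ y < x -> exists z, y = x + z.
Proof.
have [/nltE[z ->] _|-> _|//] := nlt_total x y.
  by exists (z + 1); rewrite numS.
by exists 0; rewrite num0.
Qed.

Lemma nadd_eq0 x y : x + y = 0 -> x = 0.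
Proof.
have [->//|[z ->]] := num_case x.
by rewrite naddSn => /(succ_neq0 bM).
Qed.

Lemma nlt_irr x : ~ x < x.
Proof.
move=> /nltE[z]; rewrite -naddA -{1}(num0 x) => /naddIl/esym.
exact: (succ_neq0 bM).
Qed.

Lemma nmul_eq0 x y : x * y = 0 -> x = 0 \/ y = 0.
Proof.
have [->|[z ->]] := num_case x; first by left.
by rewrite nmulSn naddC => /nadd_eq0; right.
Qed.

End Arithmetic.

(** * The rational numbers of the model *)

Section Rationals.
Context {M : L2structure} {hM : RCA0 M}.
Local Notation num := (num M).

Add Ring num_ring : (@num_semi_ring M hM).

Lemma nmulIl (x y z : num) : z <> 0 -> z * x = z * y -> x = y.
Proof.
move=> z0; wlog: x y / exists w, y = x + w => [h|[w ->]] eq_zxy.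
  have [|/nle_ex hw] := EM (y < x); last exact: h.
  move=> /nltE[w xE]; apply/esym/h => //.
  by exists (w + 1); rewrite xE; ring.
have : z * w = 0.
  by apply: (@naddIl M hM _ _ (z * x)); rewrite num0 {2}eq_zxy; ring.
by case/nmul_eq0 => // ->; rewrite num0.
Qed.

(* The triple [(a, b, d)] stands for [(a - b) / (d + 1)]. *)
Definition frac : Type := (num * num * num)%type.
Implicit Types t u v : frac.
Definition eqf t u : Prop :=
  t.1.1 * (u.2 + 1) + u.1.2 * (t.2 + 1) = u.1.1 * (t.2 + 1) + t.1.2 * (u.2 + 1).

Lemma eqf_refl t : eqf t t. Proof. by []. Qed.

Lemma eqf_sym t u : eqf t u -> eqf u t.
Proof. by rewrite /eqf => h; rewrite h. Qed.

Lemma eqf_trans t u v : eqf t u -> eqf u v -> eqf t v.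
Proof.
case: t u v => [[a b] d] [[a1 b1] d1] [[a2 b2] d2]; rewrite /eqf /= => h1 h2.
apply: (@nmulIl _ _ (d1 + 1)); first exact: (succ_neq0 (RCA0_basic hM)).
apply: (@naddIr M hM _ _ (b1 * (d + 1) * (d2 + 1) + a1 * (d + 1) * (d2 + 1))).
transitivity ((a * (d1 + 1) + b1 * (d + 1)) * (d2 + 1)
  + (a1 * (d2 + 1) + b2 * (d1 + 1)) * (d + 1)); first by ring.
by rewrite h1 h2; ring.
Qed.

(** The quotient is formed outside the model; inside, a rational will be represented by the least
    code of a triple in its class. *)
Definition MRat : Type := {P : frac -> Prop | exists t, P = eqf t}.

Definition mkQ t : MRat := exist _ (eqf t) (ex_intro _ t erefl).

Definition reprQ (x : MRat) : frac := projT1 (cid (proj2_sig x)).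

Lemma reprQK x : mkQ (reprQ x) = x.
Proof.
case: x => P hP; rewrite /reprQ /=; case: cid => t /= eP.
by rewrite /mkQ; subst P; congr exist; apply: Prop_irrelevance.
Qed.

Lemma mkQ_eq t u : mkQ t = mkQ u <-> eqf t u.
Proof.
split=> [[h]|h]; first by rewrite h; apply: eqf_refl.
suff e : eqf t = eqf u.
  by rewrite /mkQ; move: (ex_intro _ t _); rewrite e => p; congr exist;
    apply: Prop_irrelevance.
apply: funext => v; apply: propext; split; last exact: eqf_trans.
exact/eqf_trans/eqf_sym.
Qed.

Lemma eqf_repr t : eqf (reprQ (mkQ t)) t.
Proof. by apply/mkQ_eq; rewrite reprQK. Qed.

Definition addf t u : frac :=
  (t.1.1 * (u.2 + 1) + u.1.1 * (t.2 + 1),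
   t.1.2 * (u.2 + 1) + u.1.2 * (t.2 + 1), t.2 * u.2 + t.2 + u.2).
Definition oppf t : frac := (t.1.2, t.1.1, t.2).
Definition mulf t u : frac :=
  (t.1.1 * u.1.1 + t.1.2 * u.1.2, t.1.1 * u.1.2 + t.1.2 * u.1.1,
   t.2 * u.2 + t.2 + u.2).
Definition posf t : Prop := exists z, t.1.1 = t.1.2 + z.

Definition addQ x y := mkQ (addf (reprQ x) (reprQ y)).
Definition oppQ x := mkQ (oppf (reprQ x)).
Definition mulQ x y := mkQ (mulf (reprQ x) (reprQ y)).
Definition zeroQ := mkQ (0, 0, 0).
Definition oneQ := mkQ (1, 0, 0).
Definition posQ x := posf (reprQ x).

Lemma mkQ_add t u : addQ (mkQ t) (mkQ u) = mkQ (addf t u).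
Proof.
apply/mkQ_eq; move: (eqf_repr t) (eqf_repr u).
move: (reprQ (mkQ t)) (reprQ (mkQ u)) => t' u'.
case: t u t' u' => [[a b] d] [[a1 b1] d1] [[a' b'] d'] [[a1' b1'] d1'].
rewrite /eqf /= => h1 h2.
transitivity ((a' * (d + 1) + b * (d' + 1)) * ((d1' + 1) * (d1 + 1)) +
  (a1' * (d1 + 1) + b1 * (d1' + 1)) * ((d' + 1) * (d + 1))); first by ring.
by rewrite h1 h2; ring.
Qed.

Lemma mkQ_opp t : oppQ (mkQ t) = mkQ (oppf t).
Proof.
apply/mkQ_eq; move: (eqf_repr t); move: (reprQ (mkQ t)) => t'.
case: t t' => [[a b] d] [[a' b'] d']; rewrite /eqf /= => h.
by rewrite naddC -h naddC.
Qed.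

Lemma mkQ_mul t u : mulQ (mkQ t) (mkQ u) = mkQ (mulf t u).
Proof.
apply/mkQ_eq; move: (eqf_repr t) (eqf_repr u).
move: (reprQ (mkQ t)) (reprQ (mkQ u)) => t' u'.
case: t u t' u' => [[a b] d] [[a1 b1] d1] [[a' b'] d'] [[a1' b1'] d1'].
rewrite /eqf /= => h1 h2.
(* There is no subtraction: the two equivalences are multiplied crosswise by exchanging equal terms,
   and a common summand is cancelled afterwards. *)
have swap (p q r s L R L' R' : num) : L = R -> L' = R' ->
    p * L + q * R + r * L' + s * R' = p * R + q * L + r * R' + s * L'.
  by move=> -> ->.
have := swap (a1' * (d1 + 1)) (b1' * (d1 + 1)) (a * (d' + 1)) (b * (d' + 1))
  _ _ _ _ h1 h2.
move=> e; apply: (@naddIr M hM _ _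
  ((a1' * b + b1' * a + a * a1' + b * b1') * ((d' + 1) * (d1 + 1)))).
by apply: etrans (etrans _ e) _; ring.
Qed.

Lemma posf_eq t u : eqf t u -> posf t -> posf u.
Proof.
case: t u => [[a b] d] [[a1 b1] d1]; rewrite /eqf /posf /= => h [z az].
have [/nltE[w bE]|/nle_ex//] := EM (a1 < b1); exfalso.
move: h; rewrite az bE => h.
suff: (w * d + w + d + z * d1 + z) + 1 = 0 by exact: (succ_neq0 (RCA0_basic hM)).
apply: (@naddIl M hM _ _ (b * (d1 + 1) + a1 * (d + 1))).
by apply: etrans (etrans _ h) _; ring.
Qed.

Lemma posQE t : posQ (mkQ t) <-> posf t.
Proof.
by split; apply: posf_eq; [|apply: eqf_sym]; apply: eqf_repr.
Qed.

HB.instance Definition _ := gen_eqMixin MRat.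
HB.instance Definition _ := gen_choiceMixin MRat.

Ltac quot := repeat match goal with x : MRat |- _ =>
    rewrite -(reprQK x); move: (reprQ x) => {x} [[? ?] ?] end;
  rewrite /zeroQ /oneQ ?(mkQ_add, mkQ_opp, mkQ_mul).

Lemma addQA : associative addQ.
Proof. by move=> x y z; quot; apply/mkQ_eq; rewrite /eqf /=; ring. Qed.
Lemma addQC : commutative addQ.
Proof. by move=> x y; quot; apply/mkQ_eq; rewrite /eqf /=; ring. Qed.
Lemma add0Q : left_id zeroQ addQ.
Proof. by move=> x; quot; apply/mkQ_eq; rewrite /eqf /=; ring. Qed.
Lemma addNQ : left_inverse zeroQ oppQ addQ.
Proof. by move=> x; quot; apply/mkQ_eq; rewrite /eqf /=; ring. Qed.

HB.instance Definition _ := GRing.isZmodule.Build MRat addQA addQC add0Q addNQ.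

Lemma mulQA : associative mulQ.
Proof. by move=> x y z; quot; apply/mkQ_eq; rewrite /eqf /=; ring. Qed.
Lemma mulQC : commutative mulQ.
Proof. by move=> x y; quot; apply/mkQ_eq; rewrite /eqf /=; ring. Qed.
Lemma mul1Q : left_id oneQ mulQ.
Proof. by move=> x; quot; apply/mkQ_eq; rewrite /eqf /=; ring. Qed.
Lemma mulQDl : left_distributive mulQ addQ.
Proof. by move=> x y z; quot; apply/mkQ_eq; rewrite /eqf /=; ring. Qed.
Lemma oneQ_neq0 : oneQ != zeroQ.
Proof.
apply/eqP => /mkQ_eq; rewrite /eqf /= => h.
suff: 0 + 1 = 0 :> num by exact: (succ_neq0 (RCA0_basic hM)).
by apply: etrans (etrans _ h) _; ring.
Qed.

HB.instance Definition _ := GRing.Zmodule_isComNzRing.Build MRat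
  mulQA mulQC mul1Q mulQDl oneQ_neq0.

Lemma invQ_ex (x : MRat) : exists y, (x != 0%R -> y * x = 1)%R /\ (x = 0%R -> y = 0%R).
Proof.
have h (z w : num) : z <> 0 -> eqf (mulf (z, 0, 0) (w, 0, 0)) (z * w, 0, 0).
  by move=> _; rewrite /eqf /=; ring.
case: (eqVneq x 0%R) => [->|]; first by exists 0%R; split.
rewrite -(reprQK x); case: (reprQ x) => [[a b] d] nz.
have [/nltE[w aE]|/nle_ex[z bE]] := EM (b < a).
  exists (mkQ (d + 1, 0, w)); split=> [_|e]; last by rewrite e eqxx in nz.
  apply: etrans (mkQ_mul _ _) _; apply/mkQ_eq.
  by rewrite aE /eqf /=; ring.
have [z0|[w zE]] := num_case z.
  case/eqP: nz; apply/mkQ_eq; rewrite bE z0 /eqf /=; ring.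
exists (mkQ (0, d + 1, w)); split=> [_|e]; last by rewrite e eqxx in nz.
apply: etrans (mkQ_mul _ _) _; apply/mkQ_eq.
by rewrite bE zE /eqf /=; ring.
Qed.

Definition invQ (x : MRat) : MRat := projT1 (cid (invQ_ex x)).

Lemma mulVQ x : x != 0%R -> (invQ x * x = 1)%R.
Proof. by rewrite /invQ; case: cid => y [/= h _]. Qed.
Lemma invQ0 : (invQ 0 = 0)%R.
Proof. by rewrite /invQ; case: cid => y [/= _ ->]. Qed.

HB.instance Definition _ := GRing.ComNzRing_isField.Build MRat mulVQ invQ0.

Definition leQ (x y : MRat) : bool := `[< posQ (y - x)%R >].
Definition ltQ (x y : MRat) : bool := (y != x) && leQ x y.
Definition normQ (x : MRat) : MRat := if leQ 0%R x then x else (- x)%R.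

Lemma leQ0 x : leQ 0%R x <-> posQ x.
Proof. by rewrite /leQ subr0; split=> /asboolP. Qed.

Lemma le0Q_add x y : leQ 0%R x -> leQ 0%R y -> leQ 0%R (x + y)%R.
Proof.
rewrite !leQ0 -(reprQK x) -(reprQK y) [(_ + _)%R]mkQ_add !posQE.
case: (reprQ x) (reprQ y) => [[a b] d] [[a1 b1] d1] /= [z /= ->] [w /= ->].
by exists (z * (d1 + 1) + w * (d + 1)) => /=; ring.
Qed.

Lemma le0Q_mul x y : leQ 0%R x -> leQ 0%R y -> leQ 0%R (x * y)%R.
Proof.
rewrite !leQ0 -(reprQK x) -(reprQK y) [(_ * _)%R]mkQ_mul !posQE.
case: (reprQ x) (reprQ y) => [[a b] d] [[a1 b1] d1] /= [z /= ->] [w /= ->].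
by exists (z * w) => /=; ring.
Qed.

Lemma le0Q_anti x : leQ 0%R x -> leQ x 0%R -> x = 0%R.
Proof.
rewrite leQ0 /leQ sub0r => + /asboolP; rewrite -(reprQK x) [(- _)%R]mkQ_opp !posQE.
case: (reprQ x) => [[a b] d] /= [z /= ->] [w /= bE]; apply/mkQ_eq.
have /nadd_eq0 -> : z + w = 0.
  by apply: (@naddIl M hM _ _ b); rewrite num0 {2}bE; ring.
by rewrite /eqf /=; ring.
Qed.

Lemma subQ_ge0 x y : leQ 0%R (y - x)%R = leQ x y.
Proof. by rewrite /leQ subr0. Qed.

Lemma leQ0_total x : leQ 0%R x || leQ x 0%R.
Proof.
rewrite /leQ subr0 sub0r -(reprQK x) [(- _)%R]mkQ_opp.
case: (reprQ x) => [[a b] d]; have [/nltE[w aE]|/nle_ex[z bE]] := EM (b < a).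
  by apply/orP; left; apply/asboolP/posQE; exists (w + 1); rewrite /= aE; ring.
by apply/orP; right; apply/asboolP/posQE; exists z.
Qed.

Lemma normQN x : normQ (- x)%R = normQ x.
Proof.
rewrite /normQ opprK.
have e : leQ 0%R (- x)%R = leQ x 0%R by rewrite -sub0r subQ_ge0.
rewrite e; case: ifP => h1; case: ifP => h2 //.
  by rewrite (le0Q_anti h2 h1) oppr0.
by have := leQ0_total x; rewrite h1 h2.
Qed.

Lemma ge0_normQ x : leQ 0%R x -> normQ x = x.
Proof. by rewrite /normQ => ->. Qed.

Lemma ltQ_def x y : ltQ x y = (y != x) && leQ x y.
Proof. by []. Qed.

HB.instance Definition _ := Num.IntegralDomain_isLeReal.Build MRat
  le0Q_add le0Q_mul le0Q_anti subQ_ge0 leQ0_total normQN ge0_normQ ltQ_def.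

(** Embedding the numbers into an ordered field gives access to [lra], [nra] and [ring] for
    arithmetic in the model. *)
Definition inQ (n : num) : MRat := mkQ (n, 0, 0).

Lemma inQD x y : inQ (x + y) = (inQ x + inQ y)%R.
Proof. by rewrite [RHS]mkQ_add; apply/mkQ_eq; rewrite /eqf /=; ring. Qed.
Lemma inQM x y : inQ (x * y) = (inQ x * inQ y)%R.
Proof. by rewrite [RHS]mkQ_mul; apply/mkQ_eq; rewrite /eqf /=; ring. Qed.
Lemma inQ0 : inQ 0 = 0%R. Proof. by []. Qed.
Lemma inQ1 : inQ 1 = 1%R. Proof. by []. Qed.
Lemma inQ_ge0 x : (0 <= inQ x)%R.
Proof. by apply/leQ0/posQE; exists x; rewrite /= nadd0n. Qed.
Lemma inQ_inj : injective inQ.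
Proof. by move=> x y /mkQ_eq; rewrite /eqf /= !nmul0n !num0 !nadd0n !(nmulC _ 1) !nmul1n. Qed.

Lemma lt_inQ x y : x < y <-> (inQ x < inQ y)%R.
Proof.
rewrite nltE; split=> [[z ->]|].
  rewrite !inQD inQ1 -addrA ltrDl.
  by apply: ltr_wpDl; rewrite ?ltr01 ?inQ_ge0.
have [/nltE//|->|] := nlt_total x y; first by rewrite ltxx.
move=> /nltE[z ->]; rewrite !inQD inQ1 -addrA gtrDl => h; exfalso.
by have := ltr_wpDl (inQ_ge0 z) (@ltr01 MRat); rewrite ltNge (ltW h).
Qed.

(** Discreteness is built into the translation of strict inequalities, so that linear reasoning over
    the rationals proves facts such as [x < y + 1] from [~ y < x]. *)
Lemma lt_inQ1 x y : x < y <-> (inQ x + 1 <= inQ y)%R.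
Proof.
split; last by move=> h; apply/lt_inQ; rewrite (lt_le_trans _ h) // ltrDl ltr01.
by move=> /nltE[z ->]; rewrite !inQD inQ1 addrAC lerDl inQ_ge0.
Qed.

Lemma nlt_inQ x y : ~ x < y <-> (inQ y <= inQ x)%R.
Proof. by rewrite lt_inQ leNgt; split=> [h|/negP//]; apply/negP. Qed.

Lemma eq_inQ x y : x = y <-> inQ x = inQ y.
Proof. by split=> [->//|/inQ_inj]. Qed.

Lemma mkQE a b d : mkQ (a, b, d) = ((inQ a - inQ b) / (inQ d + 1))%R.
Proof.
have nz : (inQ d + 1 != 0)%R by rewrite gt_eqF // ltr_wpDl ?inQ_ge0 ?ltr01.
apply: (canRL (mulfK nz)); rewrite -inQ1 -inQD [LHS]mkQ_mul [(- _)%R]mkQ_opp [RHS]mkQ_add.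
by apply/mkQ_eq; rewrite /eqf /=; ring.
Qed.

End Rationals.

(** * Closure properties of definable relations *)

From mathcomp Require Import ring lra.
Local Open Scope L2_scope.

Ltac push_inQ H := rewrite ?(inQD, inQM, inQ0, inQ1) in H.

Ltac to_rat := repeat match goal with
  | H : nlt ?x ?y |- _ => apply (proj1 (lt_inQ1 x y)) in H; push_inQ H
  | H : ~ nlt ?x ?y |- _ => apply (proj1 (nlt_inQ x y)) in H; push_inQ H
  | H : @eq (num _) ?x ?y |- _ => apply (proj1 (eq_inQ x y)) in H; push_inQ H
  end;
  lazymatch goal with
  | |- nlt ?x ?y => apply (proj2 (lt_inQ1 x y))
  | |- ~ nlt ?x ?y => apply (proj2 (nlt_inQ x y))
  | |- @eq (num _) ?x ?y => apply (proj2 (eq_inQ x y))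
  | |- _ => idtac
  end;
  rewrite ?(inQD, inQM, inQ0, inQ1).

Ltac inQ_nonneg := repeat match goal with
  | _ : context [inQ ?x] |- _ => lazymatch goal with
      | _ : is_true (Order.le 0%R (inQ x)) |- _ => fail
      | |- _ => pose proof (inQ_ge0 x) end
  | |- context [inQ ?x] => lazymatch goal with
      | _ : is_true (Order.le 0%R (inQ x)) |- _ => fail
      | |- _ => pose proof (inQ_ge0 x) end
  end.

Ltac num_lra := to_rat; inQ_nonneg; lra.
Ltac num_nra := to_rat; inQ_nonneg; nra.
Ltac num_ring := to_rat; ring.

Definition ifp (T : Type) (P : Prop) (x y : T) : T := if `[< P >] then x else y.

Lemma ifpT (T : Type) P (x y : T) : P -> ifp P x y = x.
Proof. by rewrite /ifp => h; rewrite asboolT. Qed.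

Lemma ifpF (T : Type) P (x y : T) : ~ P -> ifp P x y = y.
Proof. by rewrite /ifp => h; rewrite asboolF. Qed.

Section Closure.
Context {M : L2structure} {hM : RCA0 M}.
Local Notation num := (num M).
Local Notation env := (nat -> num).
Implicit Types (P Q : env -> Prop) (F G H : env -> num).

(** A single number bounds both witnesses, so two unbounded quantifiers contract to one without
    pairing. *)
Lemma s1_ex (P : num -> env -> Prop) :
  Sigma1 (fun e => P (e 0%N) (fun i => e i.+1)) ->
  Sigma1 (fun e => exists a, P a e).
Proof.
move=> [Q [hQ hP]].
exists (fun e => exists a, a < e 0%N /\ exists b, b < e 0%N /\
  Q (scons b (scons a (fun i => e i.+1)))); split.
  apply: (@d0_bex _ (fun e => e 0%N) (fun e => exists b, b < e 1%N /\
    Q (scons b (scons (e 0%N) (fun i => e i.+2))))); first exact: tm_var.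
  apply: (@d0_bex _ (fun e => e 1%N)
    (fun e => Q (scons (e 0%N) (scons (e 1%N) (fun i => e i.+3)))));
    first exact: tm_var.
  by apply: (d0_subst hQ) => -[|[|i]]; apply: tm_var.
move=> e; split=> [[a /(hP (scons a e))[b hb]]|[z [a [_ [b [_ hb]]]]]].
  by exists (a + b + 1), a; split; [|exists b; split]; [num_lra|num_lra|].
by exists a; apply/(hP (scons a e)); exists b.
Qed.

Lemma s1_and P Q : Sigma1 P -> Sigma1 Q -> Sigma1 (fun e => P e /\ Q e).
Proof.
move=> [P' [hP' hP]] [Q' [hQ' hQ]].
apply: (@s1_ext _ (fun e => exists a b, P' (scons a e) /\ Q' (scons b e))).
  apply: s1_ex; apply: s1_ex; apply/s1_d0/d0_and.
    apply: (d0_subst hP' (s := fun e => scons (e 1%N) (fun i => e i.+2))).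
    by case=> [|i]; apply: tm_var.
  apply: (d0_subst hQ' (s := fun e => scons (e 0%N) (fun i => e i.+2))).
  by case=> [|i]; apply: tm_var.
by move=> e; rewrite hP hQ; split=> [[a [b []]]|[[a ha] [b hb]]];
  [split; [exists a|exists b]|exists a, b].
Qed.

Lemma s1_or P Q : Sigma1 P -> Sigma1 Q -> Sigma1 (fun e => P e \/ Q e).
Proof.
move=> [P' [hP' hP]] [Q' [hQ' hQ]].
exists (fun e => P' e \/ Q' e); split; first exact: d0_or.
by move=> e; rewrite hP hQ; split=> [[[a ha]|[a ha]]|[a [ha|ha]]];
  [exists a; left|exists a; right|left; exists a|right; exists a].
Qed.

(** The bounding principle, from Sigma-1 induction on an initial segment; it closes Sigma-1
    predicates under bounded universal quantification. *)
Lemma collection (Q : env -> Prop) (e : env) N : Delta0 Q ->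
  (forall a, a < N -> exists b, Q (scons b (scons a e))) ->
  exists z, forall a, a < N -> exists b, b < z /\ Q (scons b (scons a e)).
Proof.
move=> hQ hN.
(* The induction runs over all [n]; the guard [a < N] makes the requirement empty beyond [N]. *)
pose P (n : num) := exists z, forall a, a < n ->
  exists b, b < z /\ (a < N -> Q (scons b (scons a e))).
have hP : Sigma1 (fun e => P (e 0%N)).
  apply: s1_ex; apply: s1_d0; apply: (@d0_ball _ (fun e => e 1%N)
    (fun e' => exists b, b < e' 1%N /\
      (e' 0%N < N -> Q (scons b (scons (e' 0%N) e))))); first exact: tm_var.
  apply: (@d0_bex _ (fun e => e 1%N) (fun e' =>
      (e' 1%N < N -> Q (scons (e' 0%N) (scons (e' 1%N) e)))));
    first exact: tm_var.
  apply: d0_imp; first by apply: d0_lt; [apply: tm_var|apply: tm_cst].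
  by apply: (d0_subst hQ) => -[|[|i]]; [apply: tm_var..|apply: tm_cst].
have [] := @s1_induct M hM P hP _ _ N.
- by exists 0 => a /(nlt0 (RCA0_basic hM)).
- move=> n [z hz].
  have [b hb] : exists b, n < N -> Q (scons b (scons n e)).
    have [/hN[b hb]|] := EM (n < N); first by exists b.
    by exists 0.
  exists (z + b + 1) => a /(nltS (RCA0_basic hM))[/hz[c [ltc hc]]|->].
    by exists c; split=> //; num_lra.
  by exists b; split=> //; num_lra.
by move=> z hz; exists z => a ha; have [b [hb /(_ ha)]] := hz a ha; exists b.
Qed.

Lemma s1_ball_var (P : num -> env -> Prop) :
  Sigma1 (fun e => P (e 0%N) (fun i => e i.+1)) ->
  Sigma1 (fun e => forall a, a < e 0%N -> P a (fun i => e i.+1)).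
Proof.
move=> [Q [hQ hP]].
apply: (@s1_ext _ (fun e => exists z, forall a, a < e 0%N -> exists b, b < z /\
  Q (scons b (scons a (fun i => e i.+1))))).
  apply: s1_ex; apply: s1_d0; apply: (@d0_ball _ (fun e => e 1%N)
    (fun e => exists b, b < e 1%N /\
      Q (scons b (scons (e 0%N) (fun i => e i.+3))))); first exact: tm_var.
  apply: (@d0_bex _ (fun e => e 1%N)
    (fun e => Q (scons (e 0%N) (scons (e 1%N) (fun i => e i.+4)))));
    first exact: tm_var.
  by apply: (d0_subst hQ) => -[|[|i]]; apply: tm_var.
move=> e; split=> [[z hz] a /hz[b [_ hb]]|h].
  by apply/(hP (scons a (fun i => e i.+1))); exists b.
apply: collection => // a /h; rewrite (hP (scons a (fun i => e i.+1))); exact.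
Qed.

(** Since [F] is total, a Sigma-1 graph is already Delta-1; this is why substituting such functions
    preserves both [Sigma1] and [Delta1]. *)
Definition recfun F := Sigma1 (fun e => e 0%N = F (fun i => e i.+1)).

Definition recfun1 (h : num -> num) := recfun (fun e => h (e 0%N)).
Definition recfun2 (h : num -> num -> num) :=
  recfun (fun e => h (e 0%N) (e 1%N)).
Definition recfun3 (h : num -> num -> num -> num) :=
  recfun (fun e => h (e 0%N) (e 1%N) (e 2%N)).

Definition Delta1 P := Sigma1 P /\ Sigma1 (fun e => ~ P e).

Definition drel1 (R : num -> Prop) := Delta1 (fun e => R (e 0%N)).
Definition drel2 (R : num -> num -> Prop) := Delta1 (fun e => R (e 0%N) (e 1%N)).
Definition drel3 (R : num -> num -> num -> Prop) :=
  Delta1 (fun e => R (e 0%N) (e 1%N) (e 2%N)).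

Lemma s1_comp P F : Sigma1 P -> recfun F -> Sigma1 (fun e => P (scons (F e) e)).
Proof.
move=> hP hF; apply: (@s1_ext _ (fun e => exists y, y = F e /\ P (scons y e))).
  apply: s1_ex; apply: s1_and => //.
  by apply: (s1_subst hP) => -[|i]; apply: tm_var.
by move=> e; split=> [[y [->]]//|h]; exists (F e).
Qed.

Lemma recfun_subst F (s : env -> env) : recfun F ->
  (forall i, tmfun (fun e => s e i)) -> recfun (fun e => F (s e)).
Proof.
move=> hF hs.
apply: (s1_subst hF (s := fun e => scons (e 0%N) (s (fun i => e i.+1)))).
exact: tmfun_scons.
Qed.

Lemma recfun_tl F : recfun F -> recfun (fun e => F (fun i => e i.+1)).
Proof. by move=> hF; apply: recfun_subst => // i; apply: tm_var. Qed.

Lemma recfun_tm F : tmfun F -> recfun F.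
Proof.
move=> hF; apply/s1_d0/d0_eq; first exact: tm_var.
by apply: (tmfun_subst hF) => i; apply: tm_var.
Qed.

Lemma recfun_var i : recfun (fun e => e i).
Proof. exact/recfun_tm/tm_var. Qed.

Lemma recfun_cst c : recfun (fun _ => c).
Proof. exact/recfun_tm/tm_cst. Qed.

Lemma recfun_ext F G : recfun F -> F =1 G -> recfun G.
Proof. by move=> hF /funext <-. Qed.

Lemma s1_app1 (R : num -> Prop) F : Sigma1 (fun e => R (e 0%N)) -> recfun F ->
  Sigma1 (fun e => R (F e)).
Proof. exact: s1_comp. Qed.

Lemma s1_app2 (R : num -> num -> Prop) F G :
  Sigma1 (fun e => R (e 0%N) (e 1%N)) -> recfun F -> recfun G ->
  Sigma1 (fun e => R (F e) (G e)).
Proof.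
move=> hR hF hG.
have hR' : Sigma1 (fun e => R (e 1%N) (e 0%N)).
  by apply: (s1_subst hR (s := fun e => scons (e 1%N) (fun=> e 0%N)));
    case=> [|i]; apply: tm_var.
exact: (s1_comp (s1_comp hR' (recfun_tl hG)) hF).
Qed.

Lemma s1_app3 (R : num -> num -> num -> Prop) F G H :
  Sigma1 (fun e => R (e 0%N) (e 1%N) (e 2%N)) ->
  recfun F -> recfun G -> recfun H -> Sigma1 (fun e => R (F e) (G e) (H e)).
Proof.
move=> hR hF hG hH.
have hR' : Sigma1 (fun e => R (e 2%N) (e 1%N) (e 0%N)).
  by apply: (s1_subst hR (s := fun e => scons (e 2%N) (scons (e 1%N)
    (fun=> e 0%N)))); case=> [|[|i]]; apply: tm_var.
exact: (s1_comp (s1_comp (s1_comp hR' (recfun_tl (recfun_tl hH)))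
  (recfun_tl hG)) hF).
Qed.

Lemma s1_app4 (R : num -> num -> num -> num -> Prop) F G H K :
  Sigma1 (fun e => R (e 0%N) (e 1%N) (e 2%N) (e 3%N)) ->
  recfun F -> recfun G -> recfun H -> recfun K ->
  Sigma1 (fun e => R (F e) (G e) (H e) (K e)).
Proof.
move=> hR hF hG hH hK.
have hR' : Sigma1 (fun e => R (e 3%N) (e 2%N) (e 1%N) (e 0%N)).
  by apply: (s1_subst hR (s := fun e => scons (e 3%N) (scons (e 2%N)
    (scons (e 1%N) (fun=> e 0%N))))); case=> [|[|[|i]]]; apply: tm_var.
exact: (s1_comp (s1_comp (s1_comp (s1_comp hR'
  (recfun_tl (recfun_tl (recfun_tl hK)))) (recfun_tl (recfun_tl hH)))
  (recfun_tl hG)) hF).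
Qed.

Definition drel4 (R : num -> num -> num -> num -> Prop) :=
  Delta1 (fun e => R (e 0%N) (e 1%N) (e 2%N) (e 3%N)).

Lemma d1_app4 (R : num -> num -> num -> num -> Prop) F G H K : drel4 R ->
  recfun F -> recfun G -> recfun H -> recfun K ->
  Delta1 (fun e => R (F e) (G e) (H e) (K e)).
Proof.
move=> [h1 h2] hF hG hH hK; split; first exact: s1_app4.
exact: (s1_app4 (R := fun x y z t => ~ R x y z t)).
Qed.

Lemma d1_app1 (R : num -> Prop) F : drel1 R -> recfun F ->
  Delta1 (fun e => R (F e)).
Proof.
move=> [h1 h2] hF; split; first exact: s1_app1.
exact: (s1_app1 (R := fun x => ~ R x)).
Qed.

Lemma d1_app2 (R : num -> num -> Prop) F G :
  drel2 R -> recfun F -> recfun G ->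
  Delta1 (fun e => R (F e) (G e)).
Proof.
move=> [h1 h2] hF hG; split; first exact: s1_app2.
exact: (s1_app2 (R := fun x y => ~ R x y)).
Qed.

Lemma d1_app3 (R : num -> num -> num -> Prop) F G H :
  drel3 R ->
  recfun F -> recfun G -> recfun H -> Delta1 (fun e => R (F e) (G e) (H e)).
Proof.
move=> [h1 h2] hF hG hH; split; first exact: s1_app3.
exact: (s1_app3 (R := fun x y z => ~ R x y z)).
Qed.

Lemma recfun_app1 h F : recfun1 h -> recfun F -> recfun (fun e => h (F e)).
Proof.
move=> hh hF; apply: (s1_app2 (R := fun x y => x = h y)) hh _ _.
  exact: recfun_var.
exact: recfun_tl.
Qed.

Lemma recfun_app2 h F G : recfun2 h -> recfun F -> recfun G ->
  recfun (fun e => h (F e) (G e)).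
Proof.
move=> hh hF hG; apply: (s1_app3 (R := fun x y z => x = h y z)) hh _ _ _.
- exact: recfun_var.
- exact: recfun_tl.
exact: recfun_tl.
Qed.

Lemma recfun_app3 h F G H : recfun3 h -> recfun F -> recfun G -> recfun H ->
  recfun (fun e => h (F e) (G e) (H e)).
Proof.
move=> hh hF hG hH.
apply: (s1_app4 (R := fun x y z t => x = h y z t)) hh _ _ _ _.
- exact: recfun_var.
- exact: recfun_tl.
- exact: recfun_tl.
exact: recfun_tl.
Qed.

Lemma d1_s1 P : Delta1 P -> Sigma1 P. Proof. by case. Qed.

Lemma d1_ext P Q : Delta1 P -> (forall e, P e <-> Q e) -> Delta1 Q.
Proof.
by move=> [h1 h2] hPQ; split; [apply: s1_ext h1 _|apply: s1_ext h2 _] => e;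
  rewrite hPQ.
Qed.

Lemma d1_d0 P : Delta0 P -> Delta1 P.
Proof. by move=> hP; split; apply: s1_d0 => //; apply: d0_not. Qed.

Lemma d1_not P : Delta1 P -> Delta1 (fun e => ~ P e).
Proof. by move=> [h1 h2]; split=> //; apply: (s1_ext h1) => e; rewrite notK. Qed.

Lemma d1_and P Q : Delta1 P -> Delta1 Q -> Delta1 (fun e => P e /\ Q e).
Proof.
move=> [p1 p2] [q1 q2]; split; first exact: s1_and.
apply: (s1_ext (s1_or p2 q2)) => e.
by have := EM (P e); have := EM (Q e); tauto.
Qed.

Lemma d1_or P Q : Delta1 P -> Delta1 Q -> Delta1 (fun e => P e \/ Q e).
Proof.
move=> [p1 p2] [q1 q2]; split; first exact: s1_or.
by apply: (s1_ext (s1_and p2 q2)) => e; tauto.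
Qed.

Lemma s1_imp P Q : Delta1 P -> Sigma1 Q -> Sigma1 (fun e => P e -> Q e).
Proof.
move=> [p1 p2] q1; apply: (s1_ext (s1_or p2 q1)) => e.
by have := EM (P e); tauto.
Qed.

Lemma d1_imp P Q : Delta1 P -> Delta1 Q -> Delta1 (fun e => P e -> Q e).
Proof.
move=> hP hQ; apply: (d1_ext (d1_or (d1_not hP) hQ)) => e.
by have := EM (P e); tauto.
Qed.

Lemma d1_iff P Q : Delta1 P -> Delta1 Q -> Delta1 (fun e => P e <-> Q e).
Proof. by move=> hP hQ; apply: d1_and; apply: d1_imp. Qed.

Lemma s1_ball F (P : num -> env -> Prop) : recfun F ->
  Sigma1 (fun e => P (e 0%N) (fun i => e i.+1)) ->
  Sigma1 (fun e => forall a, a < F e -> P a e).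
Proof. by move=> hF hP; apply: (s1_comp (s1_ball_var hP) hF). Qed.

Lemma s1_bex F (P : num -> env -> Prop) : recfun F ->
  Sigma1 (fun e => P (e 0%N) (fun i => e i.+1)) ->
  Sigma1 (fun e => exists a, a < F e /\ P a e).
Proof.
move=> hF hP; apply: s1_ex; apply: s1_and => //.
apply: (s1_app2 (R := fun x y => x < y)).
- by apply: s1_d0; apply: d0_lt; apply: tm_var.
- exact: recfun_var.
exact: recfun_tl.
Qed.

Lemma d1_ball F (P : num -> env -> Prop) : recfun F ->
  Delta1 (fun e => P (e 0%N) (fun i => e i.+1)) ->
  Delta1 (fun e => forall a, a < F e -> P a e).
Proof.
move=> hF [h1 h2]; split; first exact: s1_ball.
apply: (s1_ext (@s1_bex F (fun a e => ~ P a e) hF h2)) => e; split.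
  by move=> [a [ha hPa]] h; apply/hPa/h.
by move=> /existsNP[a /not_implyP ha]; exists a.
Qed.

Lemma d1_bex F (P : num -> env -> Prop) : recfun F ->
  Delta1 (fun e => P (e 0%N) (fun i => e i.+1)) ->
  Delta1 (fun e => exists a, a < F e /\ P a e).
Proof.
move=> hF [h1 h2]; split; first exact: s1_bex.
apply: (s1_ext (@s1_ball F (fun a e => ~ P a e) hF h2)) => e; split.
  by move=> h [a [ha hPa]]; apply: (h a).
by move=> h a ha hPa; apply: h; exists a.
Qed.

Lemma d1_eq F G : recfun F -> recfun G -> Delta1 (fun e => F e = G e).
Proof.
apply: d1_app2 (fun x y => x = y) _ _ _.
by apply: d1_d0; apply: d0_eq; apply: tm_var.
Qed.

Lemma d1_lt F G : recfun F -> recfun G -> Delta1 (fun e => F e < G e).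
Proof.
apply: d1_app2 (fun x y => x < y) _ _ _.
by apply: d1_d0; apply: d0_lt; apply: tm_var.
Qed.

Lemma d1_elt F X : recfun F -> Delta1 (fun e => elt (F e) X).
Proof.
apply: d1_app1 (fun x => elt x X) _ _.
by apply: d1_d0; apply: d0_elt; apply: tm_var.
Qed.

(** Excluded middle makes every proposition independent of the environment definable, however
    complex it is: it is equivalent to [0 = 0] or to its negation. *)
Lemma d1_cst (A : Prop) : Delta1 (fun _ => A).
Proof.
have [h|h] := EM A.
  by apply: (@d1_ext (fun _ => 0 = 0 :> num)); first by
    apply: d1_eq; apply: recfun_cst.
apply: (@d1_ext (fun _ => ~ 0 = 0 :> num)) => [|e]; last by split.
by apply: d1_not; apply: d1_eq; apply: recfun_cst.
Qed.

Lemma recfun_add F G : recfun F -> recfun G -> recfun (fun e => F e + G e).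
Proof.
by apply: recfun_app2; apply: recfun_tm; apply: tm_add; apply: tm_var.
Qed.

Lemma recfun_mul F G : recfun F -> recfun G -> recfun (fun e => F e * G e).
Proof.
by apply: recfun_app2; apply: recfun_tm; apply: tm_mul; apply: tm_var.
Qed.

Lemma recfun_pr F G : recfun F -> recfun G -> recfun (fun e => pr (F e) (G e)).
Proof.
by move=> hF hG; apply/recfun_add => //; apply/recfun_mul; apply: recfun_add.
Qed.

Lemma recfun_if P F G : Delta1 P -> recfun F -> recfun G ->
  recfun (fun e => ifp (P e) (F e) (G e)).
Proof.
rewrite /ifp /=.
move=> [p1 p2] hF hG.
apply: (@s1_ext _ (fun e => (P (fun i => e i.+1) /\ e 0%N = F (fun i => e i.+1))
  \/ (~ P (fun i => e i.+1) /\ e 0%N = G (fun i => e i.+1)))).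
  apply: s1_or; apply: s1_and => //.
    by apply: (s1_subst p1) => i; apply: tm_var.
  by apply: (s1_subst p2) => i; apply: tm_var.
move=> e; case: asboolP => h; first by split=> [[[]|[]]//|]; left.
by split=> [[[]|[]]//|]; right.
Qed.

Lemma recfun_comp F G : recfun F -> recfun G ->
  recfun (fun e => F (scons (G e) e)).
Proof.
move=> hF hG.
have := s1_comp (P := fun e => e 1%N = F (scons (e 0%N) (fun i => e i.+2)))
  _ (recfun_tl hG); apply.
apply: (s1_subst hF (s := fun e => scons (e 1%N) (scons (e 0%N)
  (fun i => e i.+2)))).
by case=> [|[|i]]; apply: tm_var.
Qed.

Lemma recfun_graph (R : num -> env -> Prop) F :
  Sigma1 (fun e => R (e 0%N) (fun i => e i.+1)) ->
  (forall e y, R y e <-> y = F e) -> recfun F.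
Proof. by move=> hR hF; apply: (s1_ext hR) => e; rewrite hF. Qed.

End Closure.

(* Automated proofs of definability *)
Create HintDb definable.

Ltac definable_hook := fail.

Ltac definable_known_cod := fail.

Ltac known_definable := first
  [match goal with H : ?G |- ?G => exact H end | solve [eauto 2 with definable nocore]].

(** Syntax-directed: connectives and bounded quantifiers preserve Delta-1, an unbounded existential
    quantifier only Sigma-1, and a Sigma-1 goal without a rule of its own is reduced to a Delta-1
    goal. The hooks are filled in once codings and sums are available. *)
Ltac definable_step :=
  lazymatch goal with
  | |- Sigma1 ?P => let P' := eval cbv beta in P in change (Sigma1 P')
  | |- Delta1 ?P => let P' := eval cbv beta in P in change (Delta1 P')
  | |- recfun ?P => let P' := eval cbv beta in P in change (recfun P')
  | |- recfun1 _ => unfold recfun1; cbv beta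
  | |- recfun2 _ => unfold recfun2; cbv beta
  | |- recfun3 _ => unfold recfun3; cbv beta
  | |- drel1 _ => unfold drel1; cbv beta
  | |- drel2 _ => unfold drel2; cbv beta
  | |- drel3 _ => unfold drel3; cbv beta
  | |- drel4 _ => unfold drel4; cbv beta
  | |- _ => idtac
  end;
  first
  [ match goal with H : ?G |- ?G => exact H end
  | lazymatch goal with
    | |- recfun (fun e => e ?i) => exact: recfun_var
    | |- recfun (fun _ => ?c) => exact: recfun_cst
    | |- Delta1 (fun _ => ?A) => exact: d1_cst
    | |- recfun (fun e => @?F e + @?G e) => apply (recfun_add (F := F) (G := G))
    | |- recfun (fun e => @?F e * @?G e) => apply (recfun_mul (F := F) (G := G))
    | |- recfun (fun e => pr (@?F e) (@?G e)) => apply (recfun_pr (F := F) (G := G))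
    | |- recfun (fun e => ifp (@?P e) (@?F e) (@?G e)) =>
        apply (recfun_if (P := P) (F := F) (G := G))
    | |- Sigma1 (fun e => forall a, nlt a (@?F e) -> @?P a e) =>
        apply (s1_ball (F := F) (P := P))
    | |- Delta1 (fun e => forall a, nlt a (@?F e) -> @?P a e) =>
        apply (d1_ball (F := F) (P := P))
    | |- Delta1 (fun e => exists a, nlt a (@?F e) /\ @?P a e) =>
        apply (d1_bex (F := F) (P := P))
    | |- Sigma1 (fun e => exists a, @?P a e) =>
        apply (s1_ex (P := P))
    | |- Sigma1 (fun e => @?P e /\ @?Q e) => apply (s1_and (P := P) (Q := Q))
    | |- Delta1 (fun e => @?P e /\ @?Q e) => apply (d1_and (P := P) (Q := Q))
    | |- Sigma1 (fun e => @?P e \/ @?Q e) => apply (s1_or (P := P) (Q := Q))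
    | |- Delta1 (fun e => @?P e \/ @?Q e) => apply (d1_or (P := P) (Q := Q))
    | |- Delta1 (fun e => ~ @?P e) => apply (d1_not (P := P))
    | |- Delta1 (fun e => @?P e <-> @?Q e) => apply (d1_iff (P := P) (Q := Q))
    | |- Sigma1 (fun e => @?P e -> @?Q e) => apply (s1_imp (P := P) (Q := Q))
    | |- Delta1 (fun e => @?P e -> @?Q e) => apply (d1_imp (P := P) (Q := Q))
    | |- Delta1 (fun e => nlt (@?F e) (@?G e)) => apply (d1_lt (F := F) (G := G))
    | |- Delta1 (fun e => elt (@?F e) ?X) => apply (d1_elt (F := F))
    | |- Delta1 (fun e => @eq (num _) (@?F e) (@?G e)) =>
        apply (d1_eq (F := F) (G := G))
    end
  | definable_known_cod
  | progress definable_hook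
  | lazymatch goal with
    | |- recfun (fun e => ?h (@?F e) (@?G e) (@?K e)) =>
        apply (recfun_app3 (h := h)); [known_definable|..]
    | |- Delta1 (fun e => ?R (@?F e) (@?G e) (@?K e)) =>
        apply (d1_app3 (R := R)); [known_definable|..]
    end
  | lazymatch goal with
    | |- recfun (fun e => ?h (@?F e) (@?G e)) =>
        apply (recfun_app2 (h := h)); [known_definable|..]
    | |- Delta1 (fun e => ?R (@?F e) (@?G e)) =>
        apply (d1_app2 (R := R)); [known_definable|..]
    end
  | lazymatch goal with
    | |- recfun (fun e => ?h (@?F e)) =>
        apply (recfun_app1 (h := h)); [known_definable|..]
    | |- Delta1 (fun e => ?R (@?F e)) =>
        apply (d1_app1 (R := R)); [known_definable|..]
    end
  | match goal with
    | H : recfun1 ?h |- recfun _ => simple apply (recfun_app1 H)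
    | H : recfun2 ?h |- recfun _ => simple apply (recfun_app2 H)
    | H : recfun3 ?h |- recfun _ => simple apply (recfun_app3 H)
    | H : drel1 ?R |- Delta1 _ => apply (d1_app1 H)
    | H : drel2 ?R |- Delta1 _ => apply (d1_app2 H)
    | H : drel3 ?R |- Delta1 _ => apply (d1_app3 H)
    | H : drel4 ?R |- Delta1 _ => apply (d1_app4 H)
    end
  | lazymatch goal with |- Sigma1 _ => apply d1_s1 end
  ].

Ltac definable := repeat definable_step.

(** * Pairs and codes of finite sets *)

Section Codes.
Context {M : L2structure} {hM : RCA0 M}.
Local Notation num := (num M).
Local Notation env := (nat -> num).
Implicit Types (i j k m n c d x y z a b : num).

Lemma nlt0F x : ~ x < 0. Proof. exact: (nlt0 (RCA0_basic hM)). Qed.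

Lemma ltS_cases x y : x < y + 1 -> x < y \/ x = y.
Proof. by case: (nltS (RCA0_basic hM) x y). Qed.

Lemma num_gt0 x : x <> 0 -> 0 < x.
Proof. by have [-> //|[y ->]] := num_case x => _; num_lra. Qed.

Lemma d1_induct (P : num -> Prop) : drel1 P ->
  P 0 -> (forall n, P n -> P (n + 1)) -> forall n, P n.
Proof. by move=> [h _]; apply: s1_induct. Qed.

Lemma least (P : num -> Prop) n : drel1 P -> P n ->
  exists m, P m /\ forall k, k < m -> ~ P k.
Proof.
move=> hP hn; apply: contrapT => h.
have : forall n k, k < n -> ~ P k.
  apply: (@d1_induct (fun n => forall k, k < n -> ~ P k)).
  - by definable.
  - by move=> k /nlt0F.
  move=> m hm k /ltS_cases[/hm//|->] hPm; apply: h; exists m; split=> //.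
by move=> /(_ (n + 1) n); apply=> //; num_lra.
Qed.

(** The induction formula says that [P] fails everywhere below [n], which is Sigma-1 by
    collection. *)
Lemma least_pi1 (P : num -> Prop) n : Sigma1 (fun e => ~ P (e 0%N)) -> P n ->
  exists m, P m /\ forall k, k < m -> ~ P k.
Proof.
move=> hP hn; apply: contrapT => h.
have : forall n k, k < n -> ~ P k.
  apply: (@s1_induct _ _ (fun n => forall k, k < n -> ~ P k)).
  - apply: (@s1_ball _ _ (fun e => e 0%N) (fun k e => ~ P k)).
      exact: recfun_var.
    exact: hP.
  - by move=> k /nlt0F.
  move=> m hm k /ltS_cases[/hm//|->] hPm; apply: h; exists m; split=> //.
by move=> /(_ (n + 1) n); apply=> //; num_lra.
Qed.

Lemma greatest (P : num -> Prop) n b : drel1 P -> P n ->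
  (forall k, P k -> k < b) -> exists m, P m /\ forall k, P k -> k < m + 1.
Proof.
move=> hP hn hb.
have [||m [hm mmin]] := @least (fun m => forall k, k < b -> P k -> k < m) b.
- by definable.
- by move=> k.
have [m0|[m' mE]] := num_case m.
  by have := hm n (hb n hn) hn; rewrite m0 => /nlt0F.
exists m'; subst m; split; last by move=> k hk; apply: hm => //; apply: hb.
apply: contrapT => nPm; apply: (mmin m'); first by num_lra.
by move=> k ltk Pk; case: (ltS_cases (hm k ltk Pk)) => // e; rewrite e in Pk.
Qed.

(** Count down from a counterexample [n]: failure at [n - k] is Sigma-1 in [k] and passes from [k]
    to [k + 1], so it would reach 0. The guard makes the claim empty for [k > n]. *)
Lemma pi1_induct (P : num -> Prop) : Sigma1 (fun e => ~ P (e 0%N)) ->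
  P 0 -> (forall n, P n -> P (n + 1)) -> forall n, P n.
Proof.
move=> hP h0 hS n; apply: contrapT => hn.
suff : forall k, exists y, ~ (n < k) -> y + k = n /\ ~ P y.
  move=> /(_ n)[y hy]; case: hy => [|e]; first exact: nlt_irr.
  have -> : y = 0 by num_lra.
  by apply.
apply: s1_induct.
- apply: s1_ex; apply: s1_imp; first by definable.
  apply: s1_and; first by definable.
  exact: (s1_app1 (R := fun x => ~ P x) hP (recfun_var 0)).
- by exists n => _; rewrite num0.
move=> k [y hy].
have [y0|[z yE]] := num_case y.
  exists 0 => h; have hk : ~ n < k by num_lra.
  by have [_] := hy hk; rewrite y0.
exists z => h; have hk : ~ n < k by num_lra.
have [yk nPy] := hy hk; split; first by num_lra.
by move=> /hS; rewrite -yE.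
Qed.

Lemma bounded_range (h : num -> num) n : recfun1 h ->
  exists b, forall i, i < n -> h i < b.
Proof.
move=> hh; move: n; apply: s1_induct; first by definable.
  by exists 0 => i /nlt0F.
move=> n [b hb]; exists (b + h n + 1) => i /ltS_cases[/hb|->] *; num_lra.
Qed.

Lemma pr_gel i j : i < pr i j + 1.
Proof. by rewrite /pr; num_nra. Qed.

Lemma pr_ger i j : j < pr i j + 1.
Proof.
rewrite /pr; have [e|[z e]] := num_case (i + j); first by rewrite e; num_lra.
by rewrite e; num_nra.
Qed.

(** The code lies between the square of [i + j] and the next square, so it determines the sum and
    then [i]. *)
Lemma pr_inj i j i' j' : pr i j = pr i' j' -> i = i' /\ j = j'.
Proof.
wlog h : i j i' j' / ~ (i' + j' < i + j).
  have [h|h] := EM (i' + j' < i + j); last by apply.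
  have h' : ~ i + j < i' + j' by num_lra.
  move=> hw e; by have [-> ->] := hw i' j' i j h' (esym e).
rewrite /pr => e.
have [/nltE[z zE]|sE|//] := nlt_total (i + j) (i' + j'); last first.
  by split; move: e; rewrite sE => *; num_lra.
exfalso; move: e; rewrite zE => e.
suff : (i + j) * (i + j) + i < (i + j + z + 1) * (i + j + z + 1) + i'.
  by rewrite e; apply: nlt_irr.
by num_nra.
Qed.

Lemma pr_mono i j i' j' : ~ i' < i -> ~ j' < j -> ~ pr i' j' < pr i j.
Proof. by rewrite /pr => h1 h2; num_nra. Qed.

Lemma nmul_cancel_le x y : y <> 0 -> x < x * y + 1.
Proof. by have [->//|[z ->] _] := num_case y; num_nra. Qed.

Lemma d1_ndvd : drel2 (@ndvd M).
Proof.
apply: (@d1_ext M (fun e => exists q, q < e 1%N + 1 /\ e 1%N = e 0%N * q)).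
  by definable.
move=> e; split=> [[q [_ ->]]|[q hq]]; first by exists q.
(* A quotient is bounded by the dividend unless the divisor is 0; then any quotient can be replaced
   by 0. *)
have [d0|dn0] := EM (e 0%N = 0).
  by exists 0; rewrite hq d0; split; [num_lra|num_lra].
exists q; split=> //; rewrite hq nmulC; exact: nmul_cancel_le.
Qed.
#[local] Hint Resolve d1_ndvd : definable.

Lemma d1_code_shape : drel1 (@code_shape M).
Proof.
apply: (@d1_ext M (fun e => exists k, k < e 0%N + 1 /\ exists m,
  m < e 0%N + 1 /\ exists n, n < e 0%N + 1 /\ e 0%N = pr k (pr m n))).
  by definable.
move=> e; split=> [[k [_ [m [_ [n [_ ->]]]]]]|[k [m [n ->]]]].
  by exists k, m, n.
have h1 := pr_gel k (pr m n); have h2 := pr_ger k (pr m n).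
have h3 := pr_gel m n; have h4 := pr_ger m n.
exists k; split=> //; exists m; split; first by num_lra.
by exists n; split; first by num_lra.
Qed.
#[local] Hint Resolve d1_code_shape : definable.

Lemma d1_felt : drel2 (@felt M).
Proof.
apply: (@d1_ext M (fun e => exists k, k < e 1%N + 1 /\ exists m,
  m < e 1%N + 1 /\ exists n, n < e 1%N + 1 /\ (e 1%N = pr k (pr m n) /\
  (e 0%N < k /\ ndvd (m * (e 0%N + 1) + 1) n)))).
  by definable.
move=> e; split=> [[k [_ [m [_ [n [_ [h1 [h2 h3]]]]]]]]|[k [m [n [-> h1 h2]]]]].
  by exists k, m, n.
have l1 := pr_gel k (pr m n); have l2 := pr_ger k (pr m n).
have l3 := pr_gel m n; have l4 := pr_ger m n.
exists k; split=> //; exists m; split; first by num_lra.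
by exists n; split; first by num_lra.
Qed.
#[local] Hint Resolve d1_felt : definable.

Lemma felt_lt i c : felt i c -> i < c.
Proof. by move=> [k [m [n [-> h _]]]]; have := pr_gel k (pr m n) => *; num_lra. Qed.

Lemma ndvd_subr d a b : ndvd d a -> ndvd d (a + b) -> ndvd d b.
Proof.
move=> [x ->] [y e].
have [/nltE[z zE]|/nle_ex[z zE]] := EM (y < x).
  have /nadd_eq0 -> : b + (d * z + d) = 0 by move: e; rewrite zE => e; num_lra.
  by exists 0; num_lra.
exists z; move: e; rewrite zE => e; num_lra.
Qed.

Lemma ndvd_mull d a b : ndvd d a -> ndvd d (b * a).
Proof. by move=> [x ->]; exists (b * x); num_ring. Qed.

(* The moduli of the beta function are pairwise coprime. *)
Lemma ndvd_beta m i j n : i <> j ->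
  (exists e, ndvd e m /\ (i + e = j \/ j + e = i)) ->
  ndvd (m * (i + 1) + 1) (n * (m * (j + 1) + 1)) -> ndvd (m * (i + 1) + 1) n.
Proof.
move=> ij [d [[e mE] hd]] h; set p := m * (i + 1) + 1 in h *.
(* The two moduli differ by [m * d], where [d] is the distance of the indices. *)
have h1 : ndvd p (n * (m * d)).
  case: hd => hd.
    apply: (@ndvd_subr p (n * p)); first by exists n; num_ring.
    have -> : n * p + n * (m * d) = n * (m * (j + 1) + 1).
      by rewrite -hd /p; num_ring.
    exact: h.
  apply: (ndvd_subr h); exists n; rewrite /p -hd; num_ring.
(* One factor [m] absorbs [d], a divisor of [m]. Modulo [p] the number [m * (i + 1)] is -1, so its
   two occurrences can be removed one after the other. *)
have h2 : ndvd p (n * (m * (i + 1)) * (m * (i + 1))).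
  have -> : n * (m * (i + 1)) * (m * (i + 1))
      = ((i + 1) * (i + 1) * e) * (n * (m * d)) by rewrite {2}mE; num_ring.
  exact: ndvd_mull.
have h3 : ndvd p (n * (m * (i + 1))).
  apply: (ndvd_subr h2); exists (n * (m * (i + 1))); rewrite /p; num_ring.
by apply: (ndvd_subr h3); exists n; rewrite /p; num_ring.
Qed.

(** Supplies an [m] divisible by all distances of indices below [k], as [ndvd_beta] requires. *)
Lemma common_multiple k :
  exists m, 0 < m /\ forall i, i < k -> ndvd (i + 1) m.
Proof.
move: k; apply: s1_induct; first by definable.
  by exists 1; split=> [|i /nlt0F//]; num_lra.
move=> k [m [m0 hm]]; exists ((k + 1) * m); split; first by num_nra.
move=> i /ltS_cases[/hm|->]; first exact: ndvd_mull.
by exists m.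
Qed.

(** [n] is built as the product of the moduli of the members; coprimality prevents the other moduli
    from dividing it. The product is extended by Sigma-1 induction. *)
Lemma fcomp_shape (P : num -> Prop) k : drel1 P ->
  exists c, code_shape c /\ forall i, felt i c <-> i < k /\ P i.
Proof.
move=> hP; have [m [m0 hm]] := common_multiple k.
have [n hn] : exists n, forall j, j < k ->
    (ndvd (m * (j + 1) + 1) n <-> j < k /\ P j).
  suff : forall l, exists n, forall j, j < k ->
      (ndvd (m * (j + 1) + 1) n <-> j < l /\ P j) by exact.
  apply: s1_induct; first by definable.
    (* The empty product: every modulus is at least 2 because [m] is positive, so none divides 1. *)
    exists 1 => j jk; split=> [[q e]|[/nlt0F//]]; exfalso.
    have [q0|[z qE]] := num_case q; move: e; rewrite ?q0 ?qE => e.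
      by num_lra.
    have : 0 < m * (j + 1) by num_nra.
    have : m * (j + 1) < 1 by num_nra.
    by move=> *; num_lra.
  move=> l [n hn].
  have [[lk Pl]|nl] := EM (l < k /\ P l); last first.
    exists n => j jk; rewrite hn //; split=> [[jl Pj]|[/ltS_cases[//|e]]].
      by split=> //; num_lra.
    by subst j => Pl; case: nl.
  exists (n * (m * (l + 1) + 1)) => j jk.
  have [jl|jl] := EM (j = l).
    subst j; split=> [_|_]; first by split=> //; num_lra.
    by exists n; rewrite nmulC.
  split=> [h|[/ltS_cases[lt_jl|//] Pj]].
    have /(hn _ jk)[lt_jl Pj] : ndvd (m * (j + 1) + 1) n.
      apply: (ndvd_beta jl _ h).
      have [/nltE[z zE]|//|/nltE[z zE]] := nlt_total j l.
        exists (z + 1); split; last by left; rewrite zE; num_ring.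
        by apply: hm; num_lra.
      exists (z + 1); split; last by right; rewrite zE; num_ring.
      by apply: hm; num_lra.
    by split=> //; num_lra.
  by rewrite (nmulC n); apply/ndvd_mull/(hn j jk).
exists (pr k (pr m n)); split; first by exists k, m, n.
move=> i; split.
  move=> [k' [m' [n' [/pr_inj[<- /pr_inj[<- <-]] ik h]]]].
  by have [] := (hn i ik).1 h.
by move=> [ik Pi]; exists k, m, n; split=> //; apply/hn.
Qed.

(** Bounded comprehension yielding a true code, as the least description of the set. The bounds in
    [Q] make the minimised property Delta-1; they lose nothing since members are smaller than their
    code. *)
Lemma fcomp (P : num -> Prop) k : drel1 P ->
  exists c, is_code c /\ forall i, felt i c <-> i < k /\ P i.
Proof.
move=> hP; have [c0 [cs0 hc0]] := fcomp_shape k hP.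
pose Q c := code_shape c /\ ((forall i, i < k -> (felt i c <-> P i)) /\
  (forall i, i < c -> felt i c -> i < k)).
have QE c : Q c <-> code_shape c /\ forall i, felt i c <-> i < k /\ P i.
  split=> [[cs [h1 h2]]|[cs h]]; split=> //.
    move=> i; split=> [hi|[ik Pi]]; last exact/h1.
    by have ik := h2 i (felt_lt hi) hi; split=> //; apply/(h1 i ik).
  by split=> [i ik|i _ /h[]//]; rewrite h; split=> [[]|].
have [||c [/QE[cs hc] hmin]] := @least Q c0; first by rewrite /Q; definable.
  exact/QE.
exists c; split=> //; split=> // c' ltc cs' h; apply: (hmin c' ltc).
by apply/QE; split=> // i; rewrite h.
Qed.

Lemma code_ext c d : is_code c -> is_code d -> (forall i, felt i c <-> felt i d) ->
  c = d.
Proof.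
move=> [cs hc] [ds hd] h; have [lt|//|lt] := nlt_total c d.
  by case: (hd c lt cs).
by case: (hc d lt ds) => i; rewrite h.
Qed.

(* 0 if [i] is not in the domain of the finite function coded by [c]. *)
Definition fval c i : num :=
  if pselect (exists y, felt (pr i y) c /\ forall z, z < y -> ~ felt (pr i z) c)
  is left h then projT1 (cid h) else 0.

Lemma d1_is_code : drel1 (@is_code M).
Proof.
apply: (@d1_ext M (fun e => code_shape (e 0%N) /\ forall c, c < e 0%N ->
  code_shape c -> ~ forall i, i < e 0%N -> (felt i c <-> felt i (e 0%N)))).
  by definable.
move=> e; split=> -[cs h]; split=> // c ltc csc hc; apply: (h c ltc csc).
  by move=> i _; apply: hc.
move=> i; split=> hi; apply/(hc i) => //; have := felt_lt hi => *; num_lra.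
Qed.

Lemma fval_cases c i :
  (felt (pr i (fval c i)) c /\ forall z, z < fval c i -> ~ felt (pr i z) c)
  \/ (fval c i = 0 /\ forall z, ~ felt (pr i z) c).
Proof.
rewrite /fval; case: pselect => [h|h]; first by left; case: cid.
right; split=> // y hy; apply: h.
by apply: (@least (fun y => felt (pr i y) c) y _ hy); definable.
Qed.

Lemma recfun_fval : recfun2 fval.
Proof.
apply: (@recfun_graph _ (fun y e =>
  (felt (pr (e 1%N) y) (e 0%N) /\ forall z, z < y -> ~ felt (pr (e 1%N) z) (e 0%N))
  \/ (y = 0 /\ forall z, z < e 0%N -> ~ felt (pr (e 1%N) z) (e 0%N)))) => /=.
  by definable.
move=> e y; have hx := fval_cases (e 0%N) (e 1%N).
set x := fval _ _ in hx *; split=> [|->]; last first.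
  by case: hx => [|[-> h]]; [left|right; split=> // z _; apply: h].
have bd z c i : felt (pr i z) c -> z < c.
  by move=> /felt_lt; have := pr_ger i z => *; num_lra.
case: hx => [[h1 h2]|[-> h2]] [[h3 h4]|[-> h4]] //.
- have [lt|//|lt] := nlt_total x y; first by case: (h4 x lt).
  by case: (h2 y lt).
- by case: (h4 x (bd _ _ _ h1)).
by case: (h2 y).
Qed.

Lemma fvalP c i y : (forall z, felt (pr i z) c -> z = y) -> felt (pr i y) c ->
  fval c i = y.
Proof.
by move=> h hy; case: (fval_cases c i) => [[/h]|[_ /(_ y)]].
Qed.

Lemma fval_out c i : (forall z, ~ felt (pr i z) c) -> fval c i = 0.
Proof. by move=> h; case: (fval_cases c i) => [[/h]|[]]. Qed.

Lemma fval_lt c i : c <> 0 -> fval c i < c.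
Proof.
move=> c0; case: (fval_cases c i) => [[/felt_lt h _]|[-> _]].
  by have := pr_ger i (fval c i) => *; num_lra.
exact: num_gt0.
Qed.

Lemma fval_dom c i : fval c i <> 0 -> i < c.
Proof.
case: (fval_cases c i) => [[/felt_lt h _] _|[-> _]//].
by have := pr_gel i (fval c i) => *; num_lra.
Qed.

(** The passage from recursive functions to finite objects of the model: the pairs [pr i (h i)] for
    [i < n] are bounded, so bounded comprehension collects them. *)
Lemma seq_code (h : num -> num) n : recfun1 h -> exists c,
  [/\ is_code c, forall z, felt z c <-> exists i, i < n /\ z = pr i (h i)
    & forall i, i < n -> fval c i = h i].
Proof.
move=> hh; have [|b hb] := @bounded_range (fun i => pr i (h i)) n.
  by definable.
have [|c [cc hc]] := @fcomp (fun z => exists i, i < n /\ z = pr i (h i)) b.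
  by definable.
have hc' z : felt z c <-> exists i, i < n /\ z = pr i (h i).
  by rewrite hc; split=> [[]//|[i [ltin ->]]]; split; [exact: hb|exists i].
exists c; split=> // i ltin; apply: fvalP; last by apply/hc'; exists i.
by move=> z /hc'[j [_ /pr_inj[-> ->]]].
Qed.

End Codes.

Ltac d1_induction := match goal with
  |- forall m, @?P m => apply (d1_induct (P := P)); cbv beta end.
Ltac s1_induction := match goal with
  |- forall m, @?P m => apply (s1_induct (P := P)); cbv beta end.
Ltac pi1_induction := match goal with
  |- forall m, @?P m => apply (pi1_induct (P := P)); cbv beta end.

#[export] Hint Resolve d1_ndvd d1_code_shape d1_felt recfun_fval d1_is_code : definable.

(** * Recursion, finite sums and cardinality *)

Section Recursion.
Context {M : L2structure} {hM : RCA0 M}.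
Local Notation num := (num M).
Local Notation env := (nat -> num).
Implicit Types (i j k l m n c x y z : num).

(** The sequence [c] of intermediate values witnesses the computation, which makes the graph of
    primitive recursion Sigma-1. *)
Definition is_rec (f : num -> num -> num) a n y : Prop :=
  exists c, fval c 0 = a /\
    ((forall i, i < n -> fval c (i + 1) = f i (fval c i)) /\ fval c n = y).

Definition prec (f : num -> num -> num) a n : num :=
  if pselect (exists y, is_rec f a n y) is left h then projT1 (cid h) else 0.

Lemma is_rec_uniq f a n y z : is_rec f a n y -> is_rec f a n z -> y = z.
Proof.
move=> [c [c0 [cS <-]]] [d [d0 [dS <-]]].
suff h : forall m, m < n + 1 -> fval c m = fval d m by apply: h; num_lra.
d1_induction; first by definable.
  by rewrite c0 d0.
move=> m hm lt_mn; have lt_m : m < n by num_lra.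
by rewrite cS // dS // hm //; num_lra.
Qed.

Lemma is_rec_ex f a n : recfun2 f -> exists y, is_rec f a n y.
Proof.
move=> hf; suff : exists c, fval c 0 = a /\
    forall i, i < n -> fval c (i + 1) = f i (fval c i).
  by move=> [c [h1 h2]]; exists (fval c n), c.
move: n; s1_induction; first by definable.
  have [|c [_ _ hc]] := @seq_code _ _ (fun=> a) 1; first by definable.
  by exists c; split=> [|i /nlt0F//]; apply: hc; num_lra.
move=> n [c [c0 cS]].
pose h i := ifp (i < n + 1) (fval c i) (f n (fval c n)).
have [|d [_ _ hd]] := @seq_code _ _ h (n + 1 + 1).
  by rewrite /h; definable.
have dlt i : i < n + 1 -> fval d i = fval c i.
  by move=> lti; rewrite hd; [rewrite /h ifpT|num_lra].
have dn : fval d (n + 1) = f n (fval c n).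
  by rewrite hd; [rewrite /h ifpF //; num_lra|num_lra].
exists d; split; first by rewrite dlt //; num_lra.
move=> i /ltS_cases[lt_in|->]; last by rewrite dn dlt //; num_lra.
rewrite dlt; last by num_lra.
by rewrite dlt ?cS //; num_lra.
Qed.

Lemma precP f a n y : recfun2 f -> is_rec f a n y <-> y = prec f a n.
Proof.
move=> hf; rewrite /prec; case: pselect => [h|[]]; last exact: is_rec_ex.
by case: cid => x /= hx; split=> [|->//] hy; apply: is_rec_uniq hy hx.
Qed.

Lemma prec0 f a : recfun2 f -> prec f a 0 = a.
Proof.
move=> hf; apply/esym/precP => //; have [y [c [c0 [cS _]]]] := is_rec_ex a 0 hf.
by exists c; split.
Qed.

Lemma precS f a n : recfun2 f -> prec f a (n + 1) = f n (prec f a n).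
Proof.
move=> hf; have [y [c [c0 [cS cn]]]] := is_rec_ex a (n + 1) hf.
have -> : prec f a n = fval c n.
  apply/esym/precP => //; exists c; split=> //; split=> // i lt_in.
  by apply: cS; num_lra.
apply/esym/precP => //; exists c; split=> //; split=> //.
by apply: cS; num_lra.
Qed.

(** Step, start and length may all depend on the environment; searches and sums can therefore occur
    inside larger definable expressions. *)
Lemma recfun_prec (f : env -> num -> num -> num) (A N : env -> num) :
  recfun (fun e => f (fun i : nat => e i.+2) (e 0%N) (e 1%N)) ->
  recfun A -> recfun N -> recfun (fun e => prec (f e) (A e) (N e)).
Proof.
move=> hf hA hN; apply: (@recfun_graph _ (fun y e => is_rec (f e) (A e) (N e) y)).
  rewrite /is_rec.
  have hA2 : recfun (fun e => A (fun i : nat => e i.+2)).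
    exact: recfun_tl (recfun_tl hA).
  have hN2 : recfun (fun e => N (fun i : nat => e i.+2)).
    exact: recfun_tl (recfun_tl hN).
  pose F (e : env) := f (fun i : nat => e i.+4) (e 1%N) (e 0%N).
  have hF : recfun F.
    apply: (recfun_subst hf (s := fun e => scons (e 1%N) (scons (e 0%N)
      (fun i : nat => e i.+4)))).
    by case=> [|[|i]]; apply: tm_var.
  have hF' : recfun (fun e : env => fval (e 1%N) (e 0%N)) by definable.
  have hf3 : recfun (fun e : env => f (fun i : nat => e i.+3) (e 0%N)
    (fval (e 1%N) (e 0%N))) by exact: recfun_comp hF hF'.
  definable.
move=> e y; apply: precP.
apply: (recfun_subst hf (s := fun e' => scons (e' 0%N) (scons (e' 1%N) e))).
by case=> [|[|i]]; [apply: tm_var|apply: tm_var|apply: tm_cst].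
Qed.

Lemma recfun1_prec f a : recfun2 f -> recfun1 (prec f a).
Proof.
move=> hf; apply: (@recfun_prec (fun=> f)); by [|apply: recfun_cst|apply: recfun_var].
Qed.

(** The last [i < T] with [P i], or 0 if there is none. A bounded search by recursion, to be applied
    when the witness is unique. *)
Definition search (P : num -> Prop) (T : num) : num :=
  prec (fun i y => ifp (P i) i y) 0 T.

Lemma searchE (P : num -> Prop) t T : drel1 P -> P t -> t < T ->
  (forall t', P t' -> t' = t) -> search P T = t.
Proof.
move=> hP Pt ltT uP; have hr : recfun2 (fun i y => ifp (P i) i y) by definable.
have hs : recfun1 (search P) by apply: recfun1_prec.
move: T ltT; d1_induction; [by definable|by move=> /nlt0F|move=> T IH].
move=> /ltS_cases[ltT|<-]; rewrite /search precS // -/(search P _); last first.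
  by rewrite ifpT.
rewrite ifpF ?IH // => /uP e; rewrite e in ltT; exact: nlt_irr ltT.
Qed.

End Recursion.

(** * Codings of external types by numbers of the model *)

Section Coding.
Context {M : L2structure} {hM : RCA0 M}.
Local Notation num := (num M).
Local Notation env := (nat -> num).

(** Algebra is done in [T] with its ordinary instances, definability is proved for the codes. A
    decidable range makes decoding with a default total and recursive. *)
Record coding (T : Type) := Coding {
  cod :> T -> num;
  cod_dflt : T;
  cod_inj : injective cod;
  cod_rec : drel1 (fun x => exists a, x = cod a) }.

Definition dec (T : Type) (C : coding T) (x : num) : T :=
  if pselect (exists a, x = C a) is left h then projT1 (cid h) else cod_dflt C.

Lemma codK (T : Type) (C : coding T) : cancel C (dec C).
Proof.
move=> a; rewrite /dec; case: pselect => [h|[]]; last by exists a.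
by case: cid => b /= e; apply: (@cod_inj _ C).
Qed.

Lemma decK (T : Type) (C : coding T) x :
  C (dec C x) = ifp (exists a, x = C a) x (C (cod_dflt C)).
Proof.
rewrite /dec; case: pselect => [h|h]; last by rewrite ifpF.
by rewrite ifpT //; case: cid.
Qed.

Lemma recfun_dec (T : Type) (C : coding T) F :
  recfun F -> recfun (fun e => C (dec C (F e))).
Proof.
move=> hF; have hC := cod_rec C.
apply: (@recfun_ext _ (fun e => ifp (exists a, F e = C a) (F e) (C (cod_dflt C)))).
  apply: recfun_if => //; first exact: d1_app1 hC hF.
  exact: recfun_cst.
by move=> e; rewrite decK.
Qed.

Definition rec_op1 (T U : Type) (C : coding T) (D : coding U) (op : T -> U) :=
  recfun1 (fun x => D (op (dec C x))).
Definition rec_op2 (T U V : Type) (C : coding T) (D : coding U) (E : coding V)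
    (op : T -> U -> V) :=
  recfun2 (fun x y => E (op (dec C x) (dec D y))).

Lemma recfun_op1 T U (C : coding T) (D : coding U) op s : rec_op1 C D op ->
  recfun (fun e => C (s e)) -> recfun (fun e => D (op (s e))).
Proof.
move=> hop hs; apply: (recfun_ext (recfun_app1 (h := fun x => D (op (dec C x))) hop hs)) => e.
by rewrite codK.
Qed.

Lemma recfun_op2 T U V (C : coding T) (D : coding U) (E : coding V) op s t :
  rec_op2 C D E op -> recfun (fun e => C (s e)) -> recfun (fun e => D (t e)) ->
  recfun (fun e => E (op (s e) (t e))).
Proof.
move=> hop hs ht; apply: (recfun_ext (recfun_app2 (h := fun x y => E (op (dec C x) (dec D y)))
  hop hs ht)) => e.
by rewrite !codK.
Qed.

Lemma d1_cod_eq T (C : coding T) s t :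
  recfun (fun e => C (s e)) -> recfun (fun e => C (t e)) ->
  Delta1 (fun e => s e = t e).
Proof.
move=> hs ht; apply: (d1_ext (d1_eq hs ht)) => e.
by split=> [h|->]; [apply: (cod_inj h)|].
Qed.

Lemma recfun_ifp T (C : coding T) P s t : Delta1 P ->
  recfun (fun e => C (s e)) -> recfun (fun e => C (t e)) ->
  recfun (fun e => C (ifp (P e) (s e) (t e))).
Proof.
move=> hP hs ht; apply: (recfun_ext (recfun_if hP hs ht)) => e.
by rewrite /ifp; case: ifP.
Qed.

End Coding.

(* Syntactic matches, tried first: unification is slow on large sums. *)
Ltac definable_known_cod ::= match goal with
  | H : recfun1 (fun x => cod ?C (?u x)) |- recfun (fun e => cod ?C (?u (@?F e))) =>
      apply (recfun_app1 (h := fun x => cod C (u x)) (F := F) H)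
  | H : recfun2 (fun x y => cod ?C (?u x y)) |-
      recfun (fun e => cod ?C (?u (@?F e) (@?G e))) =>
      apply (recfun_app2 (h := fun x y => cod C (u x y)) (F := F) (G := G) H)
  end.

Ltac known_op1 D op := first
  [ match goal with H : rec_op1 _ D op |- _ => exact H end
  | solve [eauto 2 with definable nocore] ].

Ltac known_op2 D op := first
  [ match goal with H : rec_op2 _ _ D op |- _ => exact H end
  | solve [eauto 2 with definable nocore] ].

Ltac definable_sum_hook := fail.

Ltac definable_hook ::= first [definable_sum_hook | match goal with
  | |- recfun (fun e => cod ?C (dec ?C (@?F e))) => apply (recfun_dec C (F := F))
  | |- recfun (fun e => cod ?C (ifp (@?P e) (@?s e) (@?t e))) =>
      apply (recfun_ifp (C := C) (P := P) (s := s) (t := t))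
  | |- recfun (fun e => cod ?D (?op (@?s e) (@?t e))) =>
      eapply (recfun_op2 (E := D) (op := op) (s := s) (t := t)); [known_op2 D op|..]
  | |- recfun (fun e => cod ?D (?op (@?s e))) =>
      eapply (recfun_op1 (D := D) (op := op) (s := s)); [known_op1 D op|..]
  | |- recfun (fun e => cod ?C (?u (@?F e) (@?G e))) =>
      apply (recfun_app2 (h := fun x y => cod C (u x y)) (F := F) (G := G));
      [known_definable|..]
  | |- recfun (fun e => cod ?C (?u (@?F e))) =>
      apply (recfun_app1 (h := fun x => cod C (u x)) (F := F)); [known_definable|..]
  | |- recfun (fun e => prec (@?f e) (@?A e) (@?N e)) =>
      apply (recfun_prec (f := f) (A := A) (N := N))
  end].

(** * Sums over initial segments of the model *)

Section Sums.
Context {M : L2structure} {hM : RCA0 M}.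
Local Notation num := (num M).
Local Notation env := (nat -> num).
Variables (A : zmodType) (C : @coding M A).
Hypothesis addC : rec_op2 C C C (@GRing.add A).
Implicit Types (u v : num -> A).

Definition msum u (n : num) : A :=
  dec C (prec (fun i x => C (dec C x + u i)%R) (C 0%R) n).

Let step_rec u : recfun1 (fun i => C (u i)) ->
  recfun2 (fun i x => C (dec C x + u i)%R).
Proof. by move=> hu; definable. Qed.

Lemma msum0 u : recfun1 (fun i => C (u i)) -> msum u 0 = 0%R.
Proof. by move=> hu; rewrite /msum prec0 ?codK //; apply: step_rec. Qed.

Lemma msumS u n : recfun1 (fun i => C (u i)) ->
  msum u (n + 1) = (msum u n + u n)%R.
Proof. by move=> hu; rewrite /msum precS ?codK //; apply: step_rec. Qed.

Lemma recfun_msum (u : env -> num -> A) (N : env -> num) :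
  recfun (fun e => C (u (fun i => e i.+1) (e 0%N))) -> recfun N ->
  recfun (fun e => C (msum (u e) (N e))).
Proof.
move=> hu hN; apply: recfun_dec.
apply: (@recfun_prec _ _ (fun e i x => C (dec C x + u e i)%R) (fun=> C 0%R) N) => //.
  have hu2 : recfun (fun e => C (u (fun i => e i.+2) (e 0%N))).
    apply: (recfun_subst hu (s := fun e => scons (e 0%N) (fun i => e i.+2))).
    by case=> [|i]; apply: tm_var.
  by definable.
exact: recfun_cst.
Qed.

Lemma recfun1_msum u : recfun1 (fun i => C (u i)) -> recfun1 (fun n => C (msum u n)).
Proof. by move=> hu; apply: (@recfun_msum (fun=> u)) => //; apply: recfun_var. Qed.

(** Sums are the only recursive solutions of their recurrence; identities between sums then reduce
    to checking one step. *)
Lemma msum_unique u (S : num -> A) n : recfun1 (fun i => C (u i)) ->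
  recfun1 (fun i => C (S i)) -> S 0 = 0%R ->
  (forall i, i < n -> S (i + 1) = (S i + u i)%R) ->
  forall m, m < n + 1 -> S m = msum u m.
Proof.
move=> hu hS S0 SS; have hms := recfun1_msum hu.
d1_induction.
- apply: d1_imp; first by definable.
  by apply: (d1_cod_eq (C := C)); definable.
- by rewrite S0 msum0.
move=> m hm lt_mn; have lt_m : m < n by num_lra.
by rewrite SS // msumS // hm //; num_lra.
Qed.

Lemma eq_msum u v n : recfun1 (fun i => C (u i)) -> recfun1 (fun i => C (v i)) ->
  (forall i, i < n -> u i = v i) -> msum u n = msum v n.
Proof.
move=> hu hv uv; apply: (@msum_unique v (msum u) n) => //.
- exact: recfun1_msum.
- exact: msum0.
- by move=> i hi; rewrite msumS // uv.
by num_lra.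
Qed.

Lemma msumD u v n : recfun1 (fun i => C (u i)) -> recfun1 (fun i => C (v i)) ->
  msum (fun i => u i + v i)%R n = (msum u n + msum v n)%R.
Proof.
move=> hu hv; have hsu := recfun1_msum hu; have hsv := recfun1_msum hv.
apply/esym/(@msum_unique (fun i => u i + v i)%R
  (fun n => msum u n + msum v n)%R n); try by definable.
- by rewrite !msum0 // addr0.
- by move=> i _; rewrite !msumS // addrACA.
by num_lra.
Qed.

Lemma msum_eq0 u n : recfun1 (fun i => C (u i)) ->
  (forall i, i < n -> u i = 0%R) -> msum u n = 0%R.
Proof.
move=> hu u0; apply/esym/(@msum_unique u (fun=> 0%R) n) => //.
- by definable.
- by move=> i hi; rewrite u0 // addr0.
by num_lra.
Qed.

Lemma msum_ext0 u n m : recfun1 (fun i => C (u i)) ->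
  (forall i, ~ i < n -> u i = 0%R) -> ~ m < n -> msum u m = msum u n.
Proof.
move=> hu u0 /nle_ex[z ->]; have hs := recfun1_msum hu.
move: z; d1_induction.
- by apply: (d1_cod_eq (C := C)); definable.
- by rewrite num0.
by move=> z hz; rewrite numS msumS // hz u0 ?addr0 //; num_lra.
Qed.

End Sums.

Ltac definable_sum_hook ::= lazymatch goal with
  | |- recfun (fun e => cod ?C (msum ?C (@?u e) (@?N e))) =>
      refine (@recfun_msum _ _ _ C _ u N _ _); [known_definable|..]
  end.

Lemma msum_morph (M : L2structure) (hM : RCA0 M) (A B : zmodType) (C : @coding M A)
    (D : @coding M B) (f : A -> B) (u : num M -> A) n :
  rec_op2 C C C (@GRing.add A) -> rec_op2 D D D (@GRing.add B) ->
  recfun1 (fun i => C (u i)) -> recfun1 (fun i => D (f (u i))) ->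
  recfun1 (fun i => D (f (msum C u i))) ->
  f 0%R = 0%R -> {morph f : x y / (x + y)%R} ->
  f (msum C u n) = msum D (fun i => f (u i)) n.
Proof.
move=> aC aD hu hfu hfs f0 fD.
apply: (@msum_unique _ _ _ D aD (fun i => f (u i)) (fun n => f (msum C u n)) n) => //.
- by rewrite msum0.
- by move=> i _; rewrite msumS.
by num_lra.
Qed.

(** * Removing one term from a sum *)

Section Skip.
Context {M : L2structure} {hM : RCA0 M}.
Variables (A : zmodType) (C : @coding M A).
Hypothesis addC : rec_op2 C C C (@GRing.add A).

(** The increasing enumeration of the complement of [j]. *)
Definition skip (j i : num M) : num M := ifp (i < j) i (i + 1).

Lemma skip_lt j i k : i < k -> skip j i < k + 1.
Proof.
rewrite /skip => h.
by have [hj|hj] := EM (i < j); rewrite ?(ifpT _ _ hj) ?(ifpF _ _ hj); num_lra.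
Qed.

Lemma skip_neq j i : skip j i <> j.
Proof.
rewrite /skip; have [hj|hj] := EM (i < j);
  rewrite ?(ifpT _ _ hj) ?(ifpF _ _ hj) => e.
  by rewrite e in hj; case: (nlt_irr hj).
by apply: hj; num_lra.
Qed.

Lemma skip_inj j : injective (skip j).
Proof.
move=> x y; rewrite /skip; have [hx|hx] := EM (x < j); have [hy|hy] := EM (y < j);
  rewrite ?(ifpT _ _ hx) ?(ifpF _ _ hx) ?(ifpT _ _ hy) ?(ifpF _ _ hy) // => e.
- by exfalso; num_lra.
- by exfalso; num_lra.
exact: naddIr e.
Qed.

Lemma skip_surj j i k : j < k + 1 -> i < k + 1 -> i <> j ->
  exists i', i' < k /\ skip j i' = i.
Proof.
move=> ltj lti ne; have [lt|//|lt] := nlt_total i j.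
  by exists i; split; [num_lra|rewrite /skip ifpT].
have [i0|[i' iE]] := num_case i; first by rewrite i0 in lt; case: (nlt0F lt).
exists i'; split; first by num_lra.
by rewrite /skip ifpF //; num_lra.
Qed.

Lemma msum_skip (u : num M -> A) j k : recfun1 (fun i => C (u i)) -> j < k + 1 ->
  (msum C (fun i => u (skip j i)) k + u j)%R = msum C u (k + 1).
Proof.
move=> hu; have hsk : recfun1 (fun i => C (u (skip j i))).
  by rewrite /skip; apply: (recfun_app1 hu (F := fun e => ifp (e 0%N < j) _ _)); definable.
have last_case k' : j = k' ->
    (msum C (fun i => u (skip j i)) k' + u j)%R = msum C u (k' + 1).
  move=> <-; rewrite msumS //; congr (_ + _)%R.
  by apply: eq_msum => // i lti; rewrite /skip ifpT.
have h1 : recfun1 (fun k => C (msum C (fun i => u (skip j i)) k)) by exact: recfun1_msum.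
have h2 : recfun1 (fun k => C (msum C u k)) by exact: recfun1_msum.
move: k; d1_induction.
- apply: d1_imp; first by definable.
  by apply: (d1_cod_eq (C := C)); definable.
- by move=> ltj; apply: last_case; case: (ltS_cases ltj) => // /nlt0F.
move=> k IHk /ltS_cases[ltj|]; last exact: last_case.
rewrite msumS // addrAC IHk // [in RHS]msumS //; congr (_ + u _)%R.
by rewrite /skip ifpF //; num_lra.
Qed.

End Skip.

(** * Pigeonhole principle and cardinality of finite sets *)

Section Cardinality.
Context {M : L2structure} {hM : RCA0 M}.
Local Notation num := (num M).
Implicit Types (i j k l m n c x y z X Y s : num).

Lemma pigeonhole (h : num -> num) k : recfun1 h ->
  (forall i, i < k + 1 -> h i < k) ->
  exists i j, [/\ i < j, j < k + 1 & h i = h j].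
Proof.
move=> hh hk.
(* Quantifying over codes [c] of functions instead of fixing [h] gives a Pi-1 statement in [k],
   strong enough to be proved by induction. *)
suff php : forall k c, (forall i, i < k + 1 -> fval c i < k) ->
    exists i, i < k + 1 /\ exists j, j < k + 1 /\ (i < j /\ fval c i = fval c j).
  have [c [_ _ hc]] := seq_code (k + 1) hh.
  have [i hi|i [ltik [j [ltjk [ltij e]]]]] := php k c; first by rewrite hc //; apply: hk.
  by exists i, j; split=> //; rewrite -!hc.
move=> {h k hh hk}; pi1_induction.
- pose theta k c := (forall i, i < k + 1 -> fval c i < k) ->
    exists i, i < k + 1 /\ exists j, j < k + 1 /\ (i < j /\ fval c i = fval c j).
  apply: (@s1_ext _ (fun e => exists c, ~ theta (e 0%N) c)).
    by apply: s1_ex; apply: d1_s1; rewrite /theta; definable.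
  move=> e; split=> [[c hc] h|/existsNP[c hc]]; first exact/hc/h.
  by exists c.
- by move=> c /(_ 0) h; case: (@nlt0F _ _ (fval c 0)); apply: h; num_lra.
move=> k IHk c hc; pose v := fval c (k + 1).
have [[i [ltik e]]|inj] := EM (exists i, i < k + 1 /\ fval c i = v).
  exists i; split; first by num_lra.
  by exists (k + 1); split; [num_lra|split=> //; num_lra].
(* The value [v] of the last index is taken nowhere else, so [v] can replace [k] as a value. The
   remaining values fall below [k] and no new collision arises. *)
pose h i := ifp (fval c i = k) v (fval c i).
have [|d [_ _ hd]] := @seq_code _ _ h (k + 1); first by rewrite /h; definable.
have [i ltik|i [ltik [j [ltjk [ltij]]]]] := IHk d.
  rewrite hd // /h.
  have lt_v : v < k + 1 by apply: hc; num_lra.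
  have lt_i : fval c i < k + 1 by apply: hc; num_lra.
  have [e|e] := EM (fval c i = k); [rewrite ifpT //|rewrite ifpF //].
    case: (ltS_cases lt_v) => // e'; case: inj; exists i; split=> //.
    by rewrite e e'.
  by case: (ltS_cases lt_i).
rewrite !hd // /h => e.
exists i; split; first by num_lra.
exists j; split; first by num_lra.
split=> //; move: e.
have [ei|ei] := EM (fval c i = k); [rewrite (ifpT _ _ ei)|rewrite (ifpF _ _ ei)];
  (have [ej|ej] := EM (fval c j = k);
    [rewrite (ifpT _ _ ej)|rewrite (ifpF _ _ ej)]) => e //.
- by rewrite ei ej.
- by case: inj; exists j.
by case: inj; exists i.
Qed.

Lemma fin_seq_intro (A : num -> Prop) (h : num -> num) c n : is_code c ->
  (forall z, felt z c <-> exists i, i < n /\ z = pr i (h i)) ->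
  (forall i, i < n -> A (h i)) -> fin_seq c n A.
Proof.
move=> cc hc hA; split=> //; split=> [p /hc[i [ltin ->]]|i ltin].
  by exists i, (h i); split=> //; apply: hA.
exists (h i); split; first by apply/hc; exists i.
by move=> y /hc[j [_ /pr_inj[-> ->]]].
Qed.

Lemma fin_seq_at s k (A : num -> Prop) : fin_seq s k A ->
  forall i x, at_ s i x <-> i < k /\ x = fval s i.
Proof.
move=> [_ [h1 h2]] i x; split=> [hx|[ltik ->]].
  have [a [b [ltak _ /pr_inj[ia xb]]]] := h1 _ hx; subst a b.
  split=> //; apply/esym/fvalP => // z hz; have [y [_ hy]] := h2 i ltak.
  by rewrite -(hy _ hx) -(hy _ hz).
have [y [hy hu]] := h2 i ltik.
by rewrite (@fvalP _ _ s i y) // => z /hu.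
Qed.

Lemma fin_seq_in s k (A : num -> Prop) i : fin_seq s k A -> i < k -> A (fval s i).
Proof.
move=> hs ltik; have /(fin_seq_at hs) hx : i < k /\ fval s i = fval s i by [].
by have [_ [h1 _]] := hs; have [a [b [_ Ab /pr_inj[_ ->]]]] := h1 _ hx.
Qed.

Lemma image_code (h : num -> num) n : recfun1 h ->
  exists X, is_code X /\ forall x, felt x X <-> exists i, i < n /\ x = h i.
Proof.
move=> hh; have [b hb] := bounded_range n hh.
have [|X [cX hX]] := @fcomp _ _ (fun x => exists i, i < n /\ x = h i) b.
  by definable.
exists X; split=> // x; rewrite hX; split=> [[]//|[i [ltin ->]]].
by split; [exact: hb|exists i].
Qed.

Lemma fin_card_intro (h : num -> num) n X : recfun1 h ->
  (forall i j, i < n -> j < n -> h i = h j -> i = j) ->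
  (forall x, felt x X <-> exists i, i < n /\ x = h i) -> fin_card X n.
Proof.
move=> hh inj hX; have [s [cs hs sE]] := seq_code n hh.
have fs : fin_seq s n (fun x => felt x X).
  by apply: (fin_seq_intro cs hs) => i ltin; apply/hX; exists i.
exists s; split=> //.
  move=> i j x /(fin_seq_at fs)[lti ->] /(fin_seq_at fs)[ltj e].
  by apply: inj => //; rewrite -!sE.
move=> x /hX[i [ltin ->]]; exists i; apply/(fin_seq_at fs); split=> //.
by rewrite sE.
Qed.

Lemma fin_card_enum X k : fin_card X k -> exists s,
  (forall i j, i < k -> j < k -> fval s i = fval s j -> i = j) /\
  (forall x, felt x X <-> exists i, i < k /\ x = fval s i).
Proof.
move=> [s [fs inj surj]]; exists s; split.
  move=> i j lti ltj e; apply: (inj i j (fval s i)); apply/(fin_seq_at fs) => //.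
move=> x; split=> [/surj[i /(fin_seq_at fs)]|[i [lti ->]]]; first by exists i.
exact: (fin_seq_in fs).
Qed.

Lemma fin_card_ex X : exists k, fin_card X k.
Proof.
have [k [c [inj hc]]] : exists k c,
    (forall i, i < k -> forall j, j < k -> fval c i = fval c j -> i = j) /\
    ((forall x, x < X -> felt x X -> exists i, i < k /\ x = fval c i) /\
     (forall i, i < k -> felt (fval c i) X /\ fval c i < X)).
  (* Only the bounds on the elements are generalised: the part of the set below a variable bound is
     enumerated. Members are smaller than the code, so the bound [X] gives the whole set. *)
  move: {1 4}X; s1_induction; first by definable.
    exists 0, 0; split; first by move=> i /nlt0F.
    by split=> [x /nlt0F|i /nlt0F].
  move=> b [k [c [inj [h1 h2]]]].
  have [hb|hb] := EM (felt b X); last first.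
    exists k, c; split=> //; split=> [x /ltS_cases[/h1//|->//]|i /h2[]].
    by split=> //; num_lra.
  pose h i := ifp (i < k) (fval c i) b.
  have [|d [_ _ hd]] := @seq_code _ _ h (k + 1); first by rewrite /h; definable.
  have dlt i : i < k -> fval d i = fval c i.
    by move=> ltik; rewrite hd ?/h ?ifpT //; num_lra.
  have dk : fval d k = b by rewrite hd ?/h ?ifpF //; num_lra.
  exists (k + 1), d; split.
    move=> i /ltS_cases[lti|->] j /ltS_cases[ltj|->] //.
    - by rewrite !dlt //; apply: inj.
    - rewrite (dlt i lti) dk => e; have [_] := h2 i lti; rewrite e.
      by move=> /nlt_irr.
    rewrite dk (dlt j ltj) => e; have [_] := h2 j ltj; rewrite -e.
    by move=> /nlt_irr.
  split=> [x /ltS_cases[ltx /h1-/(_ ltx)[i [lti xE]]|-> _]|i /ltS_cases[lti|->]].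
  - by exists i; split; [num_lra|rewrite dlt].
  - by exists k; split=> //; num_lra.
  - by rewrite dlt //; have [? ?] := h2 i lti; split=> //; num_lra.
  by rewrite dk; split=> //; num_lra.
exists k; apply: (@fin_card_intro (fval c)); first by definable.
  by move=> i j lti ltj; apply: inj.
move=> x; split=> [hx|[i [lti ->]]]; last by have [] := hc.2 i lti.
by apply: hc.1 => //; apply: felt_lt.
Qed.

Lemma no_injection (h : num -> num) k l : recfun1 h -> l < k ->
  (forall i, i < k -> h i < l) ->
  (forall i j, i < k -> j < k -> h i = h j -> i = j) -> False.
Proof.
move=> hh ltlk hk inj; have [i lti|i [j [ltij ltj /inj e]]] := pigeonhole (k := l) hh.
  by apply: hk; num_lra.
have eij : i = j by apply: e; num_lra.
by apply: (@nlt_irr _ _ j); rewrite -{1}eij.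
Qed.

Definition index_in s l x : num :=
  prec (fun i y => ifp (fval s i = x) i y) 0 l.

Lemma index_inP s l x i : i < l -> x = fval s i ->
  index_in s l x < l /\ fval s (index_in s l x) = x.
Proof.
have hr y : recfun2 (fun i z => ifp (fval s i = y) i z) by definable.
suff h : forall l, (exists i, i < l /\ x = fval s i) ->
    index_in s l x < l /\ fval s (index_in s l x) = x.
  by move=> lti e; apply: h; exists i.
have hind : recfun1 (fun l => index_in s l x) by apply: recfun1_prec.
d1_induction; first by definable.
  by move=> [j [/nlt0F]].
move=> m hm; rewrite /index_in precS // -/(index_in s m x).
have [e _|e [j [/ltS_cases[ltj|->] xE]]] := EM (fval s m = x).
- by rewrite ifpT //; split=> //; num_lra.
- have [|lt1 e1] := hm; first by exists j.
  by rewrite ifpF //; split=> //; num_lra.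
by rewrite xE in e.
Qed.

Lemma recfun_index_in s l : recfun1 (index_in s l).
Proof. by rewrite /index_in; definable. Qed.

Lemma fin_card_sub X Y k l : fin_card X k -> fin_card Y l -> fsub X Y -> ~ l < k.
Proof.
move=> /fin_card_enum[s [sinj sX]] /fin_card_enum[t [tinj tY]] XY ltlk.
have hix := recfun_index_in t l.
have tP i : i < k -> index_in t l (fval s i) < l /\
    fval t (index_in t l (fval s i)) = fval s i.
  move=> lti; have /tY[j [ltj e]] : felt (fval s i) Y by apply: XY; apply/sX; exists i.
  exact: index_inP ltj e.
apply: (@no_injection (fun i => index_in t l (fval s i)) k l) => //.
- by definable.
- by move=> i /tP[].
move=> i j lti ltj e; apply: sinj => //.
by rewrite -(tP i lti).2 -(tP j ltj).2 e.
Qed.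

(** An enumeration of [X] prolonged by an element of [Y] outside [X] lists [k + 1] elements of
    [Y]. *)
Lemma fin_card_proper X Y k l : fin_card X k -> fin_card Y l -> fproper X Y ->
  k < l.
Proof.
move=> cX cY [XY nYX]; apply: contrapT => nltkl.
have [y [Yy nXy]] : exists y, felt y Y /\ ~ felt y X.
  apply: contrapT => h; apply: nYX => y Yy; apply: contrapT => nXy.
  by apply: h; exists y.
have [s [sinj sX]] := fin_card_enum cX.
pose h i := ifp (i < k) (fval s i) y.
have hh : recfun1 h by rewrite /h; definable.
have [X' [_ hX']] := image_code (k + 1) hh.
have hlt i : i < k -> h i = fval s i by move=> ?; rewrite /h ifpT.
have hk : h k = y by rewrite /h ifpF //; apply: nlt_irr.
have cX' : fin_card X' (k + 1).
  apply: (fin_card_intro hh _ hX') => i j /ltS_cases[lti|->] /ltS_cases[ltj|->] //.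
  - by rewrite !hlt //; apply: sinj.
  - rewrite (hlt i lti) hk => e; case: nXy; rewrite -e; apply/sX; by exists i.
  rewrite hk (hlt j ltj) => e; case: nXy; rewrite e; apply/sX; by exists j.
apply: (fin_card_sub cX' cY); last by num_lra.
move=> x /hX'[i [/ltS_cases[lti|->] ->]]; last by rewrite hk.
by rewrite hlt //; apply/XY/sX; exists i.
Qed.

Lemma fin_card_uniq X k l : fin_card X k -> fin_card X l -> k = l.
Proof.
move=> ck cl; have h1 := fin_card_sub ck cl (fun _ => id).
have h2 := fin_card_sub cl ck (fun _ => id).
by have [] := nlt_total k l.
Qed.

End Cardinality.

(** * Enumerations of finite sets *)

Section Reduction.
Context {M : L2structure} {hM : RCA0 M}.
Local Notation num := (num M).
Local Notation env := (nat -> num).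

Definition last_hits_bounded : Prop :=
  forall (N : num) (g : num -> num), recfun1 g -> (forall s, g s < N) ->
  exists b, forall s, (forall t, s < t -> g t <> g s) -> s < b.

Section Hits.
Variables (theta : num -> num -> num -> Prop) (N : num).
Hypothesis htheta : drel3 theta.

Let refuted x a c := forall a', a' < a + 1 -> exists c', c' < c + 1 /\ ~ theta x a' c'.
(** Minimality of [c] allows one hit for each [x] and [a]; hits of [x] thus occur arbitrarily late
    exactly when every candidate is refuted. *)
Let hit x a c := refuted x a c /\ forall c', c' < c -> ~ refuted x a c'.
Let hits x s := x < N /\ exists a, a < s + 1 /\ exists c, c < s + 1 /\
  (s = pr x (pr a c) /\ hit x a c).

(** A hit codes its own [x], so at most one [x] is hit at [s]. The extra value [N] collects the
    times without a hit. *)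
Let g s : num := if pselect (exists x, hits x s) is left h then projT1 (cid h) else N.

Let gP x s : x < N -> g s = x <-> hits x s.
Proof.
move=> ltx; rewrite /g; case: pselect => [h|h]; last first.
  by split=> [e|hx]; [move: ltx; rewrite e => /nlt_irr|case: h; exists x].
case: cid => y /= hy; split=> [<-//|hx].
case: hx hy => _ [a [_ [c [_ [-> _]]]]] [_ [a' [_ [c' [_ [e _]]]]]].
by have [] := pr_inj e.
Qed.

Let d1_hits : drel2 hits.
Proof. by rewrite /hits /hit /refuted; definable. Qed.

Let g_rec : recfun1 g.
Proof.
apply: (@recfun_graph _ (fun y e => hits y (e 0%N) \/
  (y = N /\ forall x, x < N -> ~ hits x (e 0%N)))); first by definable.
move=> e y; split=> [[hy|[-> h]]|->].
- by apply/esym/gP => //; case: hy.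
- rewrite /g; case: pselect => // -[x hx]; case: (h x) => //; by case: hx.
rewrite /g; case: pselect => [h|h]; first by left; case: cid.
by right; split=> // x _ hx; apply: h; exists x.
Qed.

Let g_lt s : g s < N + 1.
Proof.
rewrite /g; case: pselect => [h|_]; last by num_lra.
by case: cid => x /= [ltx _]; num_lra.
Qed.

Let refuted_bound x a : (forall a', a' < a -> exists c, ~ theta x a' c) ->
  exists C, forall a', a' < a -> exists c, c < C /\ ~ theta x a' c.
Proof.
move=> h; suff : forall n, exists C, n < a + 1 -> forall a', a' < n ->
    exists c, c < C /\ ~ theta x a' c.
  by move=> /(_ a)[C hC]; exists C => a' lta'; apply: hC => //; num_lra.
s1_induction; first by definable.
  by exists 0 => _ a' /nlt0F.
move=> n [C hC]; have [lta|nlta] := EM (n < a); last first.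
  by exists 0 => h'; case: nlta; num_lra.
have [c hc] := h n lta; exists (C + c + 1) => _ a' /ltS_cases[lta'|->].
  have ltn : n < a + 1 by num_lra.
  by have [c' [ltc' hc']] := hC ltn a' lta'; exists c'; split=> //; num_lra.
by exists c; split=> //; num_lra.
Qed.

Lemma sigma2_bounded : last_hits_bounded -> exists b (h : num -> num),
  recfun1 h /\ forall x, x < N ->
    ((exists a, forall c, theta x a c) <-> forall s, ~ s < b -> h s <> x).
Proof.
move=> /(_ _ _ g_rec g_lt)[b hb]; exists b, g; split=> // x ltx; split; last first.
  move=> hx; apply: contrapT => h.
  (* With [b] itself as the last refuted candidate, the hit is a triple whose code is not below
     [b]. *)
  have [C hC] : exists C, forall a', a' < b + 1 -> exists c, c < C /\ ~ theta x a' c.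
    by apply: refuted_bound => a' _; apply/existsNP => ha; apply: h; exists a'.
  have [||c hc] := @least _ _ (fun c => refuted x b c) C.
  - by rewrite /refuted; definable.
  - by move=> a' /hC[c [ltc hc]]; exists c; split=> //; num_lra.
  have l1 : b < pr b c + 1 by exact: pr_gel.
  have l2 : pr b c < pr x (pr b c) + 1 by exact: pr_ger.
  have l3 : c < pr b c + 1 by exact: pr_ger.
  apply: (hx (pr x (pr b c))); first by num_lra.
  apply/gP => //; split=> //; exists b; split; first by num_lra.
  by exists c; split; first by num_lra.
move=> [a ha] s nltsb gs.
(* Let [a0] be the least true candidate. A hit refutes only candidates below [a0], and by minimality
   within a common bound [C]. Hits of [x] are therefore bounded, and the last of them lies below
   [b]. *)
have [|a0 [ha0 a0min]] := @least_pi1 _ _ (fun a => forall c, theta x a c) a _ ha.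
  apply: (@s1_ext _ (fun e => exists c, ~ theta x (e 0%N) c)); first by definable.
  by move=> e; split=> [[c hc] h|/existsNP[c hc]]; [apply/hc/h|exists c].
have [C hC] : exists C, forall a', a' < a0 -> exists c, c < C /\ ~ theta x a' c.
  by apply: refuted_bound => a' /a0min/existsNP.
have bd t : g t = x -> t < pr x (pr a0 C) + 1.
  move=> /(gP _ ltx)[_ [a1 [_ [c1 [_ [-> [ref hmin]]]]]]].
  have lta : a1 < a0.
    apply: contrapT => nlt; have [|c' [_]] := ref a0; last by apply.
    by num_lra.
  have lec : ~ C < c1.
    move=> ltC; apply: (hmin C ltC) => a' lta'.
    have [|c' [ltc' hc']] := hC a'; first by num_lra.
    by exists c'; split=> //; num_lra.
  have h1 : ~ pr a0 C < pr a1 c1 by apply: pr_mono => //; num_lra.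
  have h2 : ~ pr x (pr a0 C) < pr x (pr a1 c1) by apply: pr_mono => //; apply: nlt_irr.
  by num_lra.
have [|m [gm hm]] := @greatest _ _ (fun t => g t = x) s _ _ gs bd.
  by have hg := g_rec; definable.
have ltmb : m < b.
  apply: hb => t ltt; rewrite gm => /hm h; apply: (@nlt_irr _ _ m); num_lra.
by have := hm s gs => ?; apply: nltsb; num_lra.
Qed.

End Hits.

Lemma ISigma2_of_last_hits : last_hits_bounded -> ISigma M 2.
Proof.
move=> hlast p; case: p => // -[] //= r br E e h0 hS N0.
pose theta x a c := sat E (scons c (scons a (scons x e))) r.
have htheta : drel3 theta.
  apply/d1_d0/(d0_of_form E br (s := fun e' => scons (e' 2%N) (scons (e' 1%N)
    (scons (e' 0%N) e)))).
  by case=> [|[|[|i]]]; [apply: tm_var..|apply: tm_cst].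
have [b [g [hg gP]]] := sigma2_bounded (N0 + 1) htheta hlast.
suff h : forall n, n < N0 + 1 -> forall s, ~ s < b -> g s <> n.
  by apply/(gP N0); [num_lra|apply: h; num_lra].
pi1_induction.
- apply: (@s1_ext _ (fun e => e 0%N < N0 + 1 /\ exists s, ~ s < b /\ g s = e 0%N)).
    by definable.
  move=> e'; split=> [[lt [s [h1 h2]]] h|]; first exact: h lt s h1 h2.
  move=> /not_implyP[lt /existsNP[s /not_implyP[h1 /contrapT h2]]].
  by split=> //; exists s.
- by move=> lt; apply/(gP 0).
by move=> n IHn lt; apply/(gP _ lt)/hS/gP; [num_lra|apply: IHn; num_lra].
Qed.

End Reduction.

(** * Maximal sets missed by an enumeration *)

Section Enumerations.
Context {M : L2structure} {hM : RCA0 M}.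
Local Notation num := (num M).
Local Notation env := (nat -> num).

(** One number bounds both witnesses; that [R] holds for all pairs below it is Sigma-1 by
    collection. *)
Lemma s2_ex2 (R : num -> num -> env -> Prop) :
  Sigma1 (fun e => R (e 0%N) (e 1%N) (fun i => e i.+2)) ->
  Sigma2 (fun e => exists x y, ~ R x y e).
Proof.
move=> hR; exists (fun e => forall x, x < e 0%N + 1 -> forall y, y < e 0%N + 1 ->
  R x y (fun i => e i.+1)); split.
  apply: (@s1_ball _ _ (fun e => e 0%N + 1) (fun x e => forall y, y < e 0%N + 1 ->
    R x y (fun i => e i.+1))); first by definable.
  apply: (@s1_ball _ _ (fun e => e 1%N + 1) (fun y e => R (e 0%N) y
    (fun i => e i.+2))); first by definable.
  apply: (s1_subst hR (s := fun e => scons (e 1%N) (scons (e 0%N)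
    (fun i => e i.+3)))).
  by case=> [|[|i]]; apply: tm_var.
move=> e; split=> [[x [y h]]|[a h]].
  by exists (x + y) => h'; apply/h/h'; num_lra.
apply: contrapT => h'; apply: h => x _ y _ /=; apply: contrapT => hR'.
by apply: h'; exists x, y.
Qed.

Lemma enumeration_of_ISigma2 : ISigma M 2 ->
  forall f : sets M, finset_fun f ->
  (exists n : num, forall X : num,
     is_code X -> fin_card_ge X n -> exists t, fapp f t X) ->
  exists X : num, [/\ is_code X, forall t, ~ fapp f t X
    & forall Y : num, is_code Y -> fin_card_lt X Y -> exists t, fapp f t Y].
Proof.
move=> hI f hf [n0 hn0]; apply: contrapT => hX.
have nempty t X : fapp f t X -> is_code X /\ exists x, felt x X.
  move=> h; have [_ h2] := hf; have [Y [hY uY]] := h2 t I.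
  have [h1 _] := hf; have [a [b [_ [cb [x hx]] /pr_inj[_ ->]]]] := h1 _ h.
  by split=> //; exists x.
pose inj (c l : num) := forall i, i < l -> forall j, j < l -> fval c i = fval c j -> i = j.
pose enum (c l X : num) := (forall j, j < l -> felt (fval c j) X) /\
  (forall x, x < X -> felt x X -> exists j, j < l /\ x = fval c j).
have enumP c l X : enum c l X <-> forall x, felt x X <-> exists j, j < l /\ x = fval c j.
  split=> [[h1 h2] x|h].
    split=> [hx|[j [ltj ->]]]; last exact: h1.
    by apply: h2 => //; apply: felt_lt.
  by split=> [j ltj|x _ /h//]; apply/h; exists j.
(* [~ R l c n] says that [c] lists without repetition [l >= n] elements of a set that [f] misses. As
   [R] is Sigma-1, the existence of such [l] and [c] is Sigma-2. *)
pose R (l c n : num) := l < n \/ (~ inj c l \/ exists t X, elt (pr t X) f /\ enum c l X).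
have hR : Sigma1 (fun e => R (e 0%N) (e 1%N) (e 2%N)).
  by rewrite /R /inj /enum; definable.
have : forall n, exists l c, ~ R l c n.
  apply: (s2_induct hI).
  - apply: (@s2_ex2 (fun l c e => R l c (e 0%N))); exact: hR.
  (* The induction starts from the empty set, which [f] misses because its values are nonempty. *)
  - exists 0, 0 => -[/nlt0F//|[[]|[t [X [/nempty[_ [x hx]] /enumP hX']]]]].
      by move=> i /nlt0F.
    by have [j [/nlt0F]] := (hX' x).1 hx.
  move=> n [l [c /not_orP[nltln /not_orP[/contrapT injc hc]]]].
  have [|X [cX hX']] := @image_code _ _ (fval c) l; first by definable.
  have cardX : fin_card X l.
    apply: (fin_card_intro _ _ hX'); first by definable.
    by move=> i j hi hj; apply: injc.
  apply: contrapT => hno; apply: hX; exists X; split=> //.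
    by move=> t ht; apply: hc; exists t, X; split=> //; apply/enumP.
  move=> Y cY [k [k' [ck ck' ltk]]]; apply: contrapT => hY; apply: hno.
  have [s [sinj sY]] := fin_card_enum ck'.
  exists k', s => -[h|[]].
  - by rewrite (fin_card_uniq ck cardX) in ltk; num_lra.
  - by apply=> i hi j hj; apply: sinj.
  move=> [t [Y' [ht /enumP hY']]]; apply: hY; exists t.
  have [cY' _] := nempty t Y' ht.
  rewrite (_ : Y = Y') //; apply: code_ext => // i.
  by rewrite sY hY'.
move=> /(_ n0)[l [c /not_orP[nltln /not_orP[/contrapT injc hc]]]].
have [|X [cX hX']] := @image_code _ _ (fval c) l; first by definable.
have [|t ht] := hn0 X cX.
  exists l; split.
    apply: (fin_card_intro _ _ hX'); first by definable.
    by move=> i j hi hj; apply: injc.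
  by have [|<-|//] := nlt_total n0 l; [left|right].
by apply: hc; exists t, X; split=> //; apply/enumP.
Qed.

Lemma last_hits_of_enumeration :
  (forall f : sets M, finset_fun f ->
   (exists n : num, forall X : num,
      is_code X -> fin_card_ge X n -> exists t, fapp f t X) ->
   exists X : num, [/\ is_code X, forall t, ~ fapp f t X
     & forall Y : num, is_code Y -> fproper X Y -> exists t, fapp f t Y]) ->
  @last_hits_bounded M.
Proof.
move=> H N g hg gN.
(* The number [u] bounds the later hit. This makes the relation decidable, and [f] can enumerate the
   sets along the pairs [pr X u]. *)
pose good (X u : num) := is_code X /\ exists s, s < X /\ (felt s X /\ exists r, r < u /\
  (s < r /\ g r = g s)).
pose overtaken (X : num) := exists s r, [/\ felt s X, s < r & g r = g s].
have goodP X : (exists u, good X u) <-> is_code X /\ overtaken X.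
  split=> [[u [cX [s [_ [hs [r [_ [ltr e]]]]]]]]|[cX [s [r [hs ltr e]]]]].
    by split=> //; exists s, r.
  exists (r + 1); split=> //; exists s; split; first exact: felt_lt.
  by split=> //; exists r; split; first by num_lra.
(* A default value for arguments of [f] that code no good pair: by the pigeonhole principle some
   number is hit again, and its singleton will do. *)
have [X0 [cX0 oX0]] : exists X, is_code X /\ overtaken X.
  have [i _|i [j [ltij _ e]]] := pigeonhole (k := N) hg; first exact: gN.
  have [|X [cX hX]] := @fcomp _ _ (fun x => x = i) (i + 1); first by definable.
  exists X; split=> //; exists i, j; split=> //; apply/hX; split=> //; num_lra.
pose coded (t : num) := exists X, X < t + 1 /\ exists u, u < t + 1 /\ (t = pr X u /\ good X u).
pose F (p : num) := exists t, t < p + 1 /\ exists x, x < p + 1 /\ (p = pr t x /\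
  ((exists u, u < t + 1 /\ (t = pr x u /\ good x u)) \/ (~ coded t /\ x = X0))).
have [hF1 hF2] : drel1 F by rewrite /F /coded /good; definable.
have [f hf] := d1_comprehension hF1 hF2.
have fE t x : fapp f t x <->
    (exists u, t = pr x u /\ good x u) \/ (~ coded t /\ x = X0).
  rewrite /fapp hf; split.
    move=> [t' [_ [x' [_ [/pr_inj[<- <-] h]]]]].
    by case: h => [[u [_ [e h]]]|h]; [left; exists u|right].
  have l1 : t < pr t x + 1 by exact: pr_gel.
  have l2 : x < pr t x + 1 by exact: pr_ger.
  move=> h; exists t; split=> //; exists x; split=> //; split=> //.
  case: h => [[u [e h]]|h]; [left|by right].
  by exists u; split=> //; rewrite e; apply: pr_ger.
have codedP t : coded t <-> exists X u, t = pr X u /\ good X u.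
  split=> [[X [_ [u [_ h]]]]|[X [u [e h]]]]; first by exists X, u.
  exists X; rewrite {1}e; split; first exact: pr_gel.
  by exists u; split=> //; rewrite e; apply: pr_ger.
have frange X : (exists t, fapp f t X) <-> is_code X /\ overtaken X.
  rewrite -goodP; split=> [[t /fE[[u [_ h]]|[_ ->]]]|[u h]].
  - by exists u.
  - by apply/goodP.
  by exists (pr X u); apply/fE; left; exists u.
have f_fun : finset_fun f.
  split=> [p hp|t _].
    have [t [_ [x [_ [pE _]]]]] := (hf p).1 hp; exists t, x; split=> //.
    have [] := (frange x).1 _; first by exists t; rewrite /fapp -pE.
    by move=> cx [s [r [hs _ _]]]; split=> //; exists s.
  have [/codedP[X [u [e h]]]|h] := EM (coded t).
    exists X; split; first by apply/fE; left; exists u.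
    move=> Y /fE[[u' [e' _]]|[nc _]]; last by case: nc; apply/codedP; exists X, u.
    by move: e'; rewrite e => /pr_inj[].
  exists X0; split; first by apply/fE; right.
  move=> Y /fE[[u' [e' h']]|[_ ->]//]; case: h; apply/codedP; by exists Y, u'.
have [|X [cX hX Xmax]] := H f f_fun.
  (* Among more than [N] numbers two lie in the same block, and the smaller one is hit again. *)
  exists (N + 1) => X cX [k [/fin_card_enum[s [sinj sX]] hk]].
  apply/frange; split=> //.
  have [|i _|i [j [ltij ltj e]]] := pigeonhole (h := fun i => g (fval s i)) (k := N).
  - by definable.
  - exact: gN.
  have ltjk : j < k by case: hk => [h|<-//]; num_lra.
  have ltik : i < k by num_lra.
  have ini : felt (fval s i) X by apply/sX; exists i.
  have inj : felt (fval s j) X by apply/sX; exists j.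
  have [lt|e'|lt] := nlt_total (fval s i) (fval s j).
  - by exists (fval s i), (fval s j).
  - have ij : i = j by apply: sinj.
    by case: (@nlt_irr _ _ j); rewrite -{1}ij.
  by exists (fval s j), (fval s i).
(* The code of [X] bounds its members. If a last hit [s] were not below it, adding [s] to [X] would
   bring in no member that is hit again, against maximality. *)
exists X => s alive; apply: contrapT => nlts.
have nX : ~ felt s X by move=> /felt_lt.
have [|Y [cY hY]] := @fcomp _ _ (fun x => felt x X \/ x = s) (X + s + 1).
  by definable.
have XY : fsub X Y.
  move=> x hx; apply/hY; split; last by left.
  by have ltx : x < X; [exact: felt_lt|num_lra].
have sY : felt s Y by apply/hY; split; [num_lra|right].
have [|t /(ex_intro (fapp f ^~ Y) t)/frange[_ [s' [r [hs' ltr e]]]]] := Xmax Y cY.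
  by split=> // YX; apply/nX/YX.
case/hY: hs' => _ [hs'|e']; last by apply: (alive r); rewrite -e'.
by have [t' /hX] : exists t, fapp f t X by apply/frange; split=> //; exists s', r.
Qed.

End Enumerations.

(** * Linear combinations *)

Section Bridge.
Context {M : L2structure} {hM : RCA0 M}.
Local Notation num := (num M).
Local Notation env := (nat -> num).
Variables (K : field M) (V : vspace K) (F : fieldType) (W : lmodType F).
Variables (cF : @coding M F) (cW : @coding M W).

(* [K] and [V] are the images of a genuine field and vector space. *)
Record represents : Prop := Represents {
  rep_K : forall x, elt x (K_ K) <-> exists a, x = cF a;
  rep_V : forall x, elt x (V_ V) <-> exists u, x = cW u;
  rep_add : forall u v z, fapp2 (addV V) (cW u) (cW v) z <-> z = cW (u + v)%R;
  rep_scale : forall a u z, fapp2 (scaleV V) (cF a) (cW u) z <-> z = cW (a *: u)%R;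
  rep_zeroK : zeroK K = cF 0%R;
  rep_zeroV : zeroV V = cW 0%R }.

Hypothesis rep : represents.

Lemma rep_add_rec : rec_op2 cW cW cW (@GRing.add W).
Proof.
apply: (@recfun_graph _ (fun z e =>
  elt (pr (pr (cW (dec cW (e 0%N))) (cW (dec cW (e 1%N)))) z) (addV V))).
  by definable.
by move=> e y; apply: (rep_add rep).
Qed.

Lemma rep_scale_rec : rec_op2 cF cW cW (@GRing.scale F W).
Proof.
apply: (@recfun_graph _ (fun z e =>
  elt (pr (pr (cF (dec cF (e 0%N))) (cW (dec cW (e 1%N)))) z) (scaleV V))).
  by definable.
by move=> e y; apply: (rep_scale rep).
Qed.
#[local] Hint Resolve rep_add_rec rep_scale_rec : definable.

Definition comb (alpha : num -> F) (upsilon : num -> W) (k : num) : W :=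
  msum cW (fun i => alpha i *: upsilon i)%R k.

Lemma fin_seq_cod (T : Type) (C : @coding M T) s k (A : num -> Prop) :
  (forall x, A x -> exists a, x = C a) -> fin_seq s k A ->
  forall i, i < k -> at_ s i (C (dec C (fval s i))).
Proof.
move=> hA hs i lti; apply/(fin_seq_at hs); split=> //.
by have [a ->] := hA _ (fin_seq_in hs lti); rewrite codK.
Qed.

(** The partial sums in [lin_comb] satisfy the recurrence of [msum], so uniqueness of its solution
    eliminates the auxiliary sequence. *)
Lemma lin_combE k a v w : lin_comb V k a v w <->
  [/\ fin_seq a k (Defs.in_set (K_ K)), fin_seq v k (Defs.in_set (V_ V)) &
    w = cW (comb (fun i => dec cF (fval a i)) (fun i => dec cW (fval v i)) k)].
Proof.
have hrec : recfun1 (fun i => cW (dec cF (fval a i) *: dec cW (fval v i))%R).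
  by definable.
have step c u x y z : fapp2 (scaleV V) (cF c) (cW u) y ->
    fapp2 (addV V) (cW x) y z -> z = cW (x + c *: u)%R.
  by move=> /(rep_scale rep) -> /(rep_add rep).
split=> -[fa fv].
  move=> [s [fs s0 sk hs]]; split=> //.
  have hK i : i < k -> fval a i = cF (dec cF (fval a i)).
    move=> lti; have [b ->] := (rep_K rep _).1 (fin_seq_in fa lti); by rewrite codK.
  have hV i : i < k -> fval v i = cW (dec cW (fval v i)).
    move=> lti; have [b ->] := (rep_V rep _).1 (fin_seq_in fv lti); by rewrite codK.
  have hS i : i < k + 1 -> fval s i = cW (dec cW (fval s i)).
    move=> lti; have [b ->] := (rep_V rep _).1 (fin_seq_in fs lti); by rewrite codK.
  have [_ ->] := (fin_seq_at fs k w).1 sk.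
  rewrite hS; last by num_lra.
  congr (cW _).
  apply: (@msum_unique _ _ _ cW rep_add_rec _ (fun i => dec cW (fval s i)) k) => //.
  - by definable.
  - by have [_ <-] := (fin_seq_at fs _ _).1 s0; rewrite (rep_zeroV rep) codK.
  - move=> i lti; have [c [u [y [x [z [[h1 h2 h3] [h4 h5 h6]]]]]]] := hs i lti.
    have [_ cE] := (fin_seq_at fa _ _).1 h1; have [_ uE] := (fin_seq_at fv _ _).1 h2.
    have [_ xE] := (fin_seq_at fs _ _).1 h4; have [_ zE] := (fin_seq_at fs _ _).1 h6.
    rewrite cE uE hK // hV // in h3; rewrite xE hS in h5; last by num_lra.
    by rewrite -zE (step _ _ _ _ _ h3 h5) codK.
  by num_lra.
move=> wE; split=> //.
have [|s [cs hs sE]] := @seq_code _ _ (fun i => cW (msum cW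
    (fun i => dec cF (fval a i) *: dec cW (fval v i))%R i)) (k + 1).
  by definable.
have fs : fin_seq s (k + 1) (Defs.in_set (V_ V)).
  by apply: (fin_seq_intro cs hs) => i _; apply/(rep_V rep); eexists.
have at_s i : i < k + 1 -> at_ s i (cW (msum cW
    (fun i => dec cF (fval a i) *: dec cW (fval v i))%R i)).
  by move=> lti; apply/(fin_seq_at fs); rewrite sE.
exists s; split=> //.
- have := at_s 0; rewrite msum0 ?(rep_zeroV rep) //; last exact: rep_add_rec.
  by apply; num_lra.
- by rewrite wE; apply: at_s; num_lra.
move=> i lti.
exists (cF (dec cF (fval a i))), (cW (dec cW (fval v i))).
eexists; exists (cW (msum cW (fun i => dec cF (fval a i) *: dec cW (fval v i))%R i)).
eexists; split; split.
- by apply: fin_seq_cod fa _ lti => x /(rep_K rep).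
- by apply: fin_seq_cod fv _ lti => x /(rep_V rep).
- exact/(rep_scale rep).
- by apply: at_s; num_lra.
- exact/(rep_add rep).
have := at_s (i + 1); rewrite msumS //; last exact: rep_add_rec.
by apply; num_lra.
Qed.

Lemma comb_codes (alpha : num -> F) (upsilon : num -> W) (k : num) :
  recfun1 (fun i => cF (alpha i)) -> recfun1 (fun i => cW (upsilon i)) ->
  exists a v, [/\ lin_comb V k a v (cW (comb alpha upsilon k)),
    forall i, i < k -> fval a i = cF (alpha i),
    forall i, i < k -> fval v i = cW (upsilon i),
    fin_seq a k (Defs.in_set (K_ K)) & is_code v /\
    forall z, felt z v <-> exists i, i < k /\ z = pr i (cW (upsilon i))].
Proof.
move=> ha hu; have [a [ca ha' aE]] := seq_code k ha.
have [v [cv hv' vE]] := seq_code k hu.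
have fa : fin_seq a k (Defs.in_set (K_ K)).
  by apply: (fin_seq_intro ca ha') => i _; apply/(rep_K rep); eexists.
exists a, v; split=> //; apply/lin_combE; split=> //.
  by apply: (fin_seq_intro cv hv') => i _; apply/(rep_V rep); eexists.
congr (cW _); apply: eq_msum; first exact: rep_add_rec.
- by definable.
- by definable.
by move=> i lti; rewrite aE // vE // !codK.
Qed.

Definition relation_in (P : num -> Prop) k (alpha : num -> F) (upsilon : num -> W) :=
  [/\ recfun1 (fun i => cF (alpha i)), recfun1 (fun i => cW (upsilon i)) &
      forall i, i < k -> P (cW (upsilon i))].

Lemma lin_depE (P : num -> Prop) :
  lin_dep V P <-> exists k alpha upsilon, [/\ relation_in P k alpha upsilon,
    comb alpha upsilon k = 0%R,
    forall i j, i < k -> j < k -> upsilon i = upsilon j -> i = j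
    & exists i, i < k /\ alpha i <> 0%R].
Proof.
split=> [[k [a [v [/lin_combE[fa fv e] fP inj [i [c [hc nz]]]]]]]|].
  exists k, (fun i => dec cF (fval a i)), (fun i => dec cW (fval v i)); split.
  - split; [by definable|by definable|move=> j ltj].
    have [u uE] := (rep_V rep _).1 (fin_seq_in fv ltj); rewrite uE codK -uE.
    exact: fin_seq_in fP ltj.
  - by apply/esym/(@cod_inj _ _ cW); rewrite -e (rep_zeroV rep).
  - move=> j j' ltj ltj' e'; apply: (inj j j' (fval v j)); apply/(fin_seq_at fv) => //.
    split=> //; have [u uE] := (rep_V rep _).1 (fin_seq_in fv ltj).
    have [u' uE'] := (rep_V rep _).1 (fin_seq_in fv ltj').
    by move: e'; rewrite uE uE' !codK => ->.
  have [lti cE] := (fin_seq_at fa _ _).1 hc; exists i; split=> // e'.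
  apply: nz; have [b bE] := (rep_K rep _).1 (fin_seq_in fa lti).
  by rewrite cE (rep_zeroK rep) -e' bE codK.
move=> [k [al [up [[ha hu hP] e inj [i [lti nz]]]]]].
have [a [v [hc aE vE fa [cv hv]]]] := comb_codes k ha hu.
have fv : fin_seq v k P by apply: (fin_seq_intro cv hv).
exists k, a, v; split=> //; first by rewrite (rep_zeroV rep) -e.
  move=> j j' x /(fin_seq_at fv)[ltj xE] /(fin_seq_at fv)[ltj' xE'].
  apply: inj => //; apply: (@cod_inj _ _ cW).
  by rewrite -!vE // -xE -xE'.
exists i, (cF (al i)); split.
  by apply/(fin_seq_at fa); rewrite aE.
by rewrite (rep_zeroK rep) => /(@cod_inj _ _ cF).
Qed.

Lemma spansE (P : num -> Prop) : (forall x, P x -> elt x (V_ V)) ->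
  spans V P <-> forall w : W, exists k alpha upsilon,
    relation_in P k alpha upsilon /\ comb alpha upsilon k = w.
Proof.
move=> hPV; split=> [h w|h x /(rep_V rep)[w ->]].
  have [|k [a [v [/lin_combE[fa fv e] fP]]]] := h (cW w).
    by apply/(rep_V rep); exists w.
  exists k, (fun i => dec cF (fval a i)), (fun i => dec cW (fval v i)).
  split; last by apply/esym/(@cod_inj _ _ cW).
  split; [by definable|by definable|move=> j ltj].
  have [u uE] := (rep_V rep _).1 (fin_seq_in fv ltj); rewrite uE codK -uE.
  exact: fin_seq_in fP ltj.
have [k [al [up [[ha hu hP] <-]]]] := h w.
have [a [v [hc aE vE fa [cv hv]]]] := comb_codes k ha hu.
by exists k, a, v; split=> //; apply: (fin_seq_intro cv hv).
Qed.

(** Linear dependence of the first [n] entries of [c] in visibly Sigma-1 form: existence of codes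
    with a Delta-1 property. *)
Definition dependent (c n : num) : Prop := exists k a v,
  (forall i, i < k -> exists j, j < n /\ fval v i = fval c j) /\
  ((forall i, i < k -> forall j, j < k -> fval v i = fval v j -> i = j) /\
  (cW (comb (fun i => dec cF (fval a i)) (fun i => dec cW (fval v i)) k) = cW 0%R /\
  exists i, i < k /\ cF (dec cF (fval a i)) <> cF 0%R)).

Definition vectors (c n : num) : Prop :=
  (forall i, i < n -> elt (fval c i) (V_ V)) /\
  (forall i, i < n -> forall j, j < n -> fval c i = fval c j -> i = j).

Lemma dependentE c n : vectors c n ->
  dependent c n <-> lin_dep V (fun x => exists j, j < n /\ x = fval c j).
Proof.
move=> [cV cinj]; rewrite lin_depE; split.
  move=> [k [a [v [h1 [h2 [h3 [i [lti nz]]]]]]]].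
  have vE j : j < k -> cW (dec cW (fval v j)) = fval v j.
    move=> /h1[j' [ltj' ->]]; have [u ->] := (rep_V rep _).1 (cV _ ltj').
    by rewrite codK.
  exists k, (fun i => dec cF (fval a i)), (fun i => dec cW (fval v i)); split.
  - split; [by definable|by definable|move=> j ltj].
    by have [j' [ltj' e]] := h1 j ltj; exists j'; rewrite vE.
  - exact: (@cod_inj _ _ cW).
  - by move=> j j' ltj ltj' e; apply: h2 => //; rewrite -vE // e vE.
  by exists i; split=> // e; apply: nz; rewrite e.
move=> [k [al [up [[ha hu hP] e inj [i [lti nz]]]]]].
have [a [v [hc aE vE fa [cv hv]]]] := comb_codes k ha hu.
exists k, a, v; split; first by move=> j ltj; rewrite vE //; apply: hP.
split.
  move=> j ltj j' ltj'; rewrite !vE // => e'; apply: inj => //.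
  exact: (@cod_inj _ _ cW).
split; first by have /lin_combE[_ _ <-] := hc; rewrite e.
by exists i; split=> //; rewrite aE // codK => /(@cod_inj _ _ cF).
Qed.

Lemma comb_skip alpha upsilon j k :
  recfun1 (fun i => cF (alpha i)) -> recfun1 (fun i => cW (upsilon i)) ->
  j < k + 1 -> comb alpha upsilon (k + 1) =
  (comb (fun i => alpha (skip j i)) (fun i => upsilon (skip j i)) k +
   alpha j *: upsilon j)%R.
Proof.
move=> ha hu ltj; rewrite /comb -(@msum_skip _ _ _ cW rep_add_rec
  (fun i => alpha i *: upsilon i)%R j k) //.
by definable.
Qed.

Lemma recfun1_skip j (h : num -> num) : recfun1 h -> recfun1 (fun i => h (skip j i)).
Proof.
move=> hh; rewrite /skip.
by apply: (recfun_app1 hh (F := fun e => ifp (e 0%N < j) _ _)); definable.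
Qed.

Lemma combZ c alpha upsilon k :
  recfun1 (fun i => cF (alpha i)) -> recfun1 (fun i => cW (upsilon i)) ->
  recfun1 (fun i => cF (c * alpha i)%R) ->
  comb (fun i => c * alpha i)%R upsilon k = (c *: comb alpha upsilon k)%R.
Proof.
move=> ha hu hca; rewrite /comb (@msum_morph _ _ _ _ cW cW (fun x => c *: x)%R).
- apply: eq_msum; [exact: rep_add_rec|by definable|by definable|].
  by move=> i _; rewrite scalerA.
- exact: rep_add_rec.
- exact: rep_add_rec.
- by definable.
- by definable.
- by definable.
- exact: scaler0.
exact: scalerDr.
Qed.

Hypothesis mulF : rec_op2 cF cF cF (@GRing.mul F).

(** In a relation among the extended vectors the coefficient of [w] must vanish, since dividing by
    it would put [w] in the span. Deleting [w] by [skip] leaves a relation among the old vectors. *)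
Lemma extend_independent c n w : vectors c n -> ~ dependent c n ->
  (forall k alpha upsilon,
    relation_in (fun x => exists j, j < n /\ x = fval c j) k alpha upsilon ->
    comb alpha upsilon k <> w) ->
  exists d, vectors d (n + 1) /\ ~ dependent d (n + 1).
Proof.
move=> hc ndep nspan; set B := fun x : num => _ in nspan.
have wB : ~ B (cW w).
  move=> hw; apply: (nspan 1 (fun=> 1%R) (fun=> w)).
    by split; [by definable|by definable|move=> i _].
  have hr : recfun1 (fun i : num => cW (1 *: w)%R) by definable.
  rewrite /comb -[1](nadd0n 1) msumS // ?msum0 // ?add0r ?scale1r //.
  - exact: rep_add_rec.
  exact: rep_add_rec.
pose h i := ifp (i < n) (fval c i) (cW w).
have [|d [_ _ dE]] := @seq_code _ _ h (n + 1); first by rewrite /h; definable.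
have dlt i : i < n -> fval d i = fval c i.
  by move=> lti; rewrite dE; [rewrite /h ifpT|num_lra].
have dn : fval d n = cW w.
  by rewrite dE; [rewrite /h ifpF //; apply: nlt_irr|num_lra].
have dP x : (exists j, j < n + 1 /\ x = fval d j) -> B x \/ x = cW w.
  move=> [j [/ltS_cases[ltj|->] ->]]; last by right.
  by left; exists j; rewrite dlt.
have hd : vectors d (n + 1).
  have [cV cinj] := hc; split=> [i /ltS_cases[lti|->]|].
  - by rewrite dlt //; apply: cV.
  - by rewrite dn; apply/(rep_V rep); exists w.
  move=> i /ltS_cases[lti|->] j /ltS_cases[ltj|->] //.
  - by rewrite !dlt //; apply: cinj.
  - by rewrite (dlt i lti) dn => e; case: wB; exists i.
  by rewrite (dlt j ltj) dn => e; case: wB; exists j.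
exists d; split=> // /(dependentE hd)/lin_depE[k [al [up [[ha hu hP] e inj nz]]]].
have [[j [ltj upj]]|hno] := EM (exists j, j < k /\ up j = w); last first.
  apply/ndep/(dependentE hc)/lin_depE; exists k, al, up; split=> //.
  split=> // i lti; case: (dP _ (hP i lti)) => // /(@cod_inj _ _ cW) e'.
  by case: hno; exists i.
have [k0|[k1 kE]] := num_case k; first by rewrite k0 in ltj; case: (nlt0F ltj).
subst k; have hsa := recfun1_skip j ha; have hsu := recfun1_skip j hu.
have hBs i : i < k1 -> B (cW (up (skip j i))).
  move=> lti; have lts : skip j i < k1 + 1 by exact: skip_lt.
  case: (dP _ (hP _ lts)) => // /(@cod_inj _ _ cW) e'.
  case: (@skip_neq _ _ j i); apply: inj => //; by rewrite e' upj.
move: e; rewrite (comb_skip ha hu ltj) upj => e.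
have [aj0|aj] := eqVneq (al j) 0%R.
  apply/ndep/(dependentE hc)/lin_depE.
  exists k1, (fun i => al (skip j i)), (fun i => up (skip j i)); split=> //.
  - by move: e; rewrite aj0 scale0r addr0.
  - move=> i i' lti lti' e'; apply: (@skip_inj _ _ j); apply: inj => //; exact: skip_lt.
  have [i [lti nzi]] := nz; have ne : i <> j by move=> e'; rewrite e' aj0 in nzi.
  by have [i' [lti' e']] := skip_surj ltj lti ne; exists i'; rewrite e'.
apply: (nspan k1 (fun i => - (al j)^-1 * al (skip j i))%R (fun i => up (skip j i))).
  by split=> //; definable.
rewrite combZ //; last by definable.
rewrite (_ : comb _ _ _ = - (al j *: w))%R; last by apply/eqP; rewrite -addr_eq0 e.
by rewrite scaleNr scalerN opprK scalerA mulVf // scale1r.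
Qed.

End Bridge.

(** * Bases from Sigma-2 induction *)

Lemma is_fun2 {M : L2structure} {hM : RCA0 M} (F A B C : num M -> Prop) :
  is_fun F (cartesian A B) C -> forall x : {a | A a}, forall y : {b | B b},
  exists z : {c | C c}, forall w, F (pr (pr (sval x) (sval y)) w) <-> w = sval z.
Proof.
move=> [h1 h2] [a Aa] [b Bb] /=.
have [|c [hc uc]] := h2 (pr a b); first by exists a, b.
have [a' [b' [_ Cc /pr_inj[_ e]]]] := h1 _ hc; rewrite -e in Cc.
by exists (exist _ c Cc) => w /=; split=> [/uc|->].
Qed.

Lemma is_fun1 {M : L2structure} {hM : RCA0 M} (F A B : num M -> Prop) :
  is_fun F A B -> forall x : {a | A a},
  exists y : {b | B b}, forall w, F (pr (sval x) w) <-> w = sval y.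
Proof.
move=> [h1 h2] [a Aa] /=; have [c [hc uc]] := h2 a Aa.
have [a' [b' [_ Cc /pr_inj[_ e]]]] := h1 _ hc; rewrite -e in Cc.
by exists (exist _ c Cc) => w /=; split=> [/uc|->].
Qed.

Lemma sval_inj (T : Type) (P : T -> Prop) : injective (@sval T P).
Proof.
move=> [x px] [y py] /= e; subst y; congr exist; exact: Prop_irrelevance.
Qed.

Lemma sval_coding_rec (M : L2structure) (hM : RCA0 M) (X : sets M) :
  drel1 (fun x => exists a : {x | elt x X}, x = sval a).
Proof.
apply: (@d1_ext _ (fun e => elt (e 0%N) X)); first by definable.
by move=> e; split=> [h|[[x hx] ->]//]; exists (exist (fun x => elt x _) _ h).
Qed.

(** * Fields and vector spaces of the model as external structures *)

Section Scalars.
Context {M : L2structure}.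
Variables (hM : RCA0 M) (K : field M).

(** The argument [h] carries the axioms into the type: the field operations are built from them, and
    their instances can thus be inferred from the type alone. *)
Definition scalar (h : RCA0 M) : Type := {x : num M | elt x (K_ K)}.
Local Notation S := (scalar hM).

HB.instance Definition _ := gen_eqMixin S.
HB.instance Definition _ := gen_choiceMixin S.

Let op2 (F : sets M) (h : is_fun (Defs.in_set F)
    (cartesian (Defs.in_set (K_ K)) (Defs.in_set (K_ K))) (Defs.in_set (K_ K)))
    (x y : S) : S := projT1 (cid (is_fun2 h x y)).

Definition addS : S -> S -> S := op2 (addK_fun K).
Definition mulS : S -> S -> S := op2 (mulK_fun K).
Definition oppS (x : S) : S := projT1 (cid (is_fun1 (oppK_fun K) x)).
Definition zeroS : S := exist (fun x => elt x (K_ K)) _ (zeroK_in K).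
Definition oneS : S := exist (fun x => elt x (K_ K)) _ (oneK_in K).

Lemma addSE (x y : S) w : fapp2 (addK K) (sval x) (sval y) w <-> w = sval (addS x y).
Proof. by rewrite /addS /op2; case: cid => z /= hz; apply: hz. Qed.
Lemma mulSE (x y : S) w : fapp2 (mulK K) (sval x) (sval y) w <-> w = sval (mulS x y).
Proof. by rewrite /mulS /op2; case: cid => z /= hz; apply: hz. Qed.
Lemma oppSE (x : S) w : fapp (oppK K) (sval x) w <-> w = sval (oppS x).
Proof. by rewrite /oppS; case: cid => z /= hz; apply: hz. Qed.

Lemma addS_eq (x y z : S) : fapp2 (addK K) (sval x) (sval y) (sval z) -> addS x y = z.
Proof. by move=> /addSE h; apply: sval_inj. Qed.
Lemma mulS_eq (x y z : S) : fapp2 (mulK K) (sval x) (sval y) (sval z) -> mulS x y = z.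
Proof. by move=> /mulSE h; apply: sval_inj. Qed.

Lemma addSA : associative addS.
Proof.
by move=> x y z; apply: addS_eq;
  apply: (@addKA _ K (sval x) (sval y) (sval z) (sval (addS x y))); apply/addSE.
Qed.
Lemma addSC : commutative addS.
Proof. by move=> x y; apply/addS_eq/addKC/addSE. Qed.
Lemma add0S : left_id zeroS addS.
Proof. by move=> x; apply/addS_eq/add0K; case: x. Qed.
Lemma addNS : left_inverse zeroS oppS addS.
Proof. by move=> x; apply/addS_eq/addNK/oppSE. Qed.

HB.instance Definition _ := GRing.isZmodule.Build S addSA addSC add0S addNS.

Lemma mulSA : associative mulS.
Proof.
by move=> x y z; apply: mulS_eq;
  apply: (@mulKA _ K (sval x) (sval y) (sval z) (sval (mulS x y))); apply/mulSE.
Qed.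
Lemma mulSC : commutative mulS.
Proof. by move=> x y; apply/mulS_eq/mulKC/mulSE. Qed.
Lemma mul1S : left_id oneS mulS.
Proof. by move=> x; apply/mulS_eq/mul1K; case: x. Qed.
Lemma mulSDl : left_distributive mulS addS.
Proof.
move=> x y z; rewrite !(mulSC _ z); apply: mulS_eq.
by apply: (@mulKDr _ K (sval z) (sval x) (sval y) _ (sval (mulS z x))
  (sval (mulS z y))); first [apply/addSE|apply/mulSE].
Qed.
Lemma oneS_neq0 : oneS != zeroS.
Proof. by apply/eqP => -[]; apply: oneK_neq0. Qed.

HB.instance Definition _ := GRing.Zmodule_isComNzRing.Build S
  mulSA mulSC mul1S mulSDl oneS_neq0.

Lemma invS_ex (x : S) : exists y : S, (x != 0%R -> y * x = 1)%R /\ (x = 0%R -> y = 0%R).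
Proof.
have [->|nz] := eqVneq x 0%R; first by exists 0%R; split.
have [||b hb] := @mulVK _ K (sval x); first by case: x {nz}.
  by move=> e; case/eqP: nz; apply: sval_inj.
have hbK : elt b (K_ K).
  have [h1 _] := mulK_fun K; have [p [c [[a [b' [ha _ pE]]] _ e]]] := h1 _ hb.
  by have [e' _] := pr_inj e; rewrite -e' in pE; have [-> _] := pr_inj pE.
exists (exist (fun x => elt x (K_ K)) b hbK); split=> [_|e]; last by rewrite e eqxx in nz.
exact: (@mulS_eq (exist (fun x => elt x (K_ K)) b hbK) x oneS).
Qed.

Definition invS (x : S) : S := projT1 (cid (invS_ex x)).
Lemma mulVS x : x != 0%R -> (invS x * x = 1)%R.
Proof. by rewrite /invS; case: cid => y [/= h _]. Qed.
Lemma invS0 : (invS 0 = 0)%R.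
Proof. by rewrite /invS; case: cid => y [/= _ ->]. Qed.
HB.instance Definition _ := GRing.ComNzRing_isField.Build S mulVS invS0.

Definition scalar_coding : @coding M S :=
  Coding (0%R : S) (@sval_inj _ _) (@sval_coding_rec M hM (K_ K)).

Lemma scalar_mul_rec :
  rec_op2 scalar_coding scalar_coding scalar_coding (@GRing.mul S).
Proof.
apply: (@recfun_graph _ (fun z e => elt (pr (pr
  (scalar_coding (dec scalar_coding (e 0%N)))
  (scalar_coding (dec scalar_coding (e 1%N)))) z) (mulK K))).
  by definable.
by move=> e y; apply: mulSE.
Qed.

Variable V : vspace K.

Definition vec (h : RCA0 M) : Type := {x : num M | elt x (V_ V)}.
Local Notation W := (vec hM).

HB.instance Definition _ := gen_eqMixin W.
HB.instance Definition _ := gen_choiceMixin W.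

Definition addW (x y : W) : W := projT1 (cid (is_fun2 (addV_fun V) x y)).
Definition scaleW (a : S) (x : W) : W := projT1 (cid (is_fun2 (scaleV_fun V) a x)).
Definition zeroW : W := exist (fun x => elt x (V_ V)) _ (zeroV_in V).

Lemma addWE (x y : W) w : fapp2 (addV V) (sval x) (sval y) w <-> w = sval (addW x y).
Proof. by rewrite /addW; case: cid => z /= hz; apply: hz. Qed.
Lemma scaleWE (a : S) (x : W) w :
  fapp2 (scaleV V) (sval a) (sval x) w <-> w = sval (scaleW a x).
Proof. by rewrite /scaleW; case: cid => z /= hz; apply: hz. Qed.

Lemma addW_eq (x y z : W) : fapp2 (addV V) (sval x) (sval y) (sval z) -> addW x y = z.
Proof. by move=> /addWE h; apply: sval_inj. Qed.
Lemma scaleW_eq a (x z : W) :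
  fapp2 (scaleV V) (sval a) (sval x) (sval z) -> scaleW a x = z.
Proof. by move=> /scaleWE h; apply: sval_inj. Qed.

Lemma addWA : associative addW.
Proof.
by move=> x y z; apply: addW_eq;
  apply: (@addVA _ _ V (sval x) (sval y) (sval z) (sval (addW x y))); apply/addWE.
Qed.
Lemma addWC : commutative addW.
Proof. by move=> x y; apply/addW_eq/addVC/addWE. Qed.
Lemma add0W : left_id zeroW addW.
Proof. by move=> x; apply/addW_eq/add0V; case: x. Qed.

Lemma oppW_ex (x : W) : exists y, addW y x = zeroW.
Proof.
have [|w hw] := @addNV _ _ V (sval x); first by case: x.
have hwV : elt w (V_ V).
  have [h1 _] := addV_fun V; have [p [c [[a [b' [ha _ pE]]] _ e]]] := h1 _ hw.
  by have [e' _] := pr_inj e; rewrite -e' in pE; have [-> _] := pr_inj pE.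
by exists (exist (fun x => elt x (V_ V)) w hwV); apply: addW_eq.
Qed.
Definition oppW (x : W) : W := projT1 (cid (oppW_ex x)).
Lemma addNW : left_inverse zeroW oppW addW.
Proof. by move=> x; rewrite /oppW; case: cid. Qed.

HB.instance Definition _ := GRing.isZmodule.Build W addWA addWC add0W addNW.

Lemma scaleWA (a b : S) (v : W) : scaleW a (scaleW b v) = scaleW (a * b)%R v.
Proof.
apply: scaleW_eq; apply: (@scaleVA _ _ V (sval a) (sval b) (sval v)
  (sval (a * b)%R)); first [apply/mulSE|apply/scaleWE]; by [].
Qed.
Lemma scale1W : left_id (1%R : S) scaleW.
Proof. by move=> x; apply/scaleW_eq/scale1V; case: x. Qed.
Lemma scaleWDr : right_distributive scaleW +%R.
Proof.
move=> a x y; apply: scaleW_eq; apply: (@scaleVDr _ _ V (sval a) (sval x) (sval y)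
  _ (sval (scaleW a x)) (sval (scaleW a y))); first [apply/addWE|apply/scaleWE]; by [].
Qed.
Lemma scaleWDl (v : W) : {morph (fun a : S => scaleW a v) : a b / (a + b)%R}.
Proof.
move=> a b; apply: scaleW_eq; apply: (@scaleVDl _ _ V (sval a) (sval b) (sval v)
  _ (sval (scaleW a v)) (sval (scaleW b v)));
  first [apply/addWE|apply/scaleWE|apply/addSE]; by [].
Qed.

HB.instance Definition _ := GRing.Zmodule_isLmodule.Build S W
  scaleWA scale1W scaleWDr scaleWDl.

Definition vec_coding : @coding M W :=
  Coding (0%R : W) (@sval_inj _ _) (@sval_coding_rec M hM (V_ V)).

Lemma vec_represents : represents V scalar_coding vec_coding.
Proof.
split=> //.
- by move=> x; split=> [h|[[a ha] ->]//]; exists (exist (fun x => elt x _) _ h).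
- by move=> x; split=> [h|[[a ha] ->]//]; exists (exist (fun x => elt x _) _ h).
- by move=> u v z; apply: addWE.
by move=> a u z; apply: scaleWE.
Qed.

Lemma basis_of_ISigma2 : ISigma M 2 ->
  (exists n : num M, forall X : num M,
    is_code X -> (forall x, felt x X -> elt x (V_ V)) -> fin_card X n ->
    lin_dep V (fun x => felt x X)) ->
  exists B : sets M, is_basis V B.
Proof.
move=> hI [n0 hn0]; apply: contrapT => nbasis.
have rep := vec_represents.
have aW := rep_add_rec rep; have sW := rep_scale_rec rep.
have [c [hc]] : exists c, vectors V c n0 /\ ~ dependent scalar_coding vec_coding c n0.
  move: n0 {hn0}; apply: (s2_induct hI).
  (* The statement is the negation of this implication, which is Sigma-1 since being vectors is
     decidable and dependence is Sigma-1. *)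
  - exists (fun e => vectors V (e 0%N) (e 1%N) ->
      dependent scalar_coding vec_coding (e 0%N) (e 1%N)); split.
      by rewrite /vectors /dependent /comb; definable.
    move=> e; split=> [[c [h1 h2]]|[c /not_implyP]]; first by exists c => /(_ h1).
    by exists c.
  - exists 0; split; first by split=> i /nlt0F.
    by move=> [k [a [v [h [_ [_ [i [lti _]]]]]]]]; have [j [/nlt0F]] := h i lti.
  move=> n [c [hc ndep]].
  have [hB1 hB2] : drel1 (fun x => exists j, j < n /\ x = fval c j) by definable.
  have [B hB] := d1_comprehension (P := fun x => exists j, j < n /\ x = fval c j)
    hB1 hB2.
  have eB : Defs.in_set B = (fun x => exists j, j < n /\ x = fval c j).
    by apply: funext => x; apply: propext; apply: hB.
  have BV x : Defs.in_set B x -> elt x (V_ V).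
    by rewrite eB => -[j [ltj ->]]; apply: hc.1.
  have [hspan|/existsNP[w hw]] := EM (forall w, exists k alpha upsilon,
      relation_in scalar_coding vec_coding (Defs.in_set B) k alpha upsilon /\
      comb vec_coding alpha upsilon k = w).
    case: nbasis; exists B; split=> //; last exact/(spansE rep).
    by rewrite eB => /(dependentE rep hc).
  apply: (extend_independent rep scalar_mul_rec hc ndep (w := w)) => k al up h e.
  by apply: hw; exists k, al, up; rewrite eB.
case; apply/(dependentE rep hc).
have [|X [cX hX]] := @image_code _ _ (fval c) n0; first by definable.
have -> : (fun x => exists j, j < n0 /\ x = fval c j) = (fun x => felt x X).
  by apply: funext => x; apply: propext; rewrite hX.
apply: hn0 => //.
  by move=> x /hX[j [ltj ->]]; apply: hc.1.
apply: (fin_card_intro _ _ hX); first by definable.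
by move=> i j hi hj; apply: hc.2.
Qed.

End Scalars.

(** * Codes of rational numbers *)

Section RatCoding.
Context {M : L2structure} {hM : RCA0 M}.
Local Notation num := (num M).
Local Notation env := (nat -> num).
Local Notation Q := (@MRat M).
Implicit Types (x y : Q) (a b c d h k n : num).

Definition trip a b d : num := pr a (pr b d).

Lemma trip_inj a b d a' b' d' : trip a b d = trip a' b' d' ->
  [/\ a = a', b = b' & d = d'].
Proof. by move=> /pr_inj[-> /pr_inj[-> ->]]. Qed.

Lemma trip_lt a b d : [/\ a < trip a b d + 1, b < trip a b d + 1
  & d < trip a b d + 1].
Proof.
have h1 : a < trip a b d + 1 by exact: pr_gel.
have h2 : pr b d < trip a b d + 1 by exact: pr_ger.
have h3 : b < pr b d + 1 by exact: pr_gel.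
have h4 : d < pr b d + 1 by exact: pr_ger.
by split=> //; num_lra.
Qed.

Definition same_rat a b d a' b' d' : Prop :=
  a * (d' + 1) + b' * (d + 1) = a' * (d + 1) + b * (d' + 1).

Lemma same_ratE a b d a' b' d' :
  same_rat a b d a' b' d' <-> mkQ (a, b, d) = mkQ (a', b', d').
Proof. by rewrite mkQ_eq. Qed.

Lemma codeQ_ex x : exists c, (exists a b d, c = trip a b d /\ x = mkQ (a, b, d)) /\
  forall c', c' < c -> forall a b d, c' = trip a b d -> x <> mkQ (a, b, d).
Proof.
rewrite -(reprQK x); case: (reprQ x) => [[a b] d] {x}.
have [||c [hc cmin]] := @least _ _ (fun c => exists a', a' < c + 1 /\ exists b',
  b' < c + 1 /\ exists d', d' < c + 1 /\ (c = trip a' b' d' /\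
  same_rat a b d a' b' d')) (trip a b d).
- by rewrite /same_rat /trip; definable.
- by have [h1 h2 h3] := trip_lt a b d;
    exists a; split=> //; exists b; split=> //; exists d; split.
exists c; split.
  have [a' [_ [b' [_ [d' [_ [e /same_ratE h]]]]]]] := hc.
  by exists a', b', d'.
move=> c' /cmin h a' b' d' e /same_ratE h'; apply: h.
have [h1 h2 h3] := trip_lt a' b' d'; rewrite e.
by exists a'; split=> //; exists b'; split=> //; exists d'; split.
Qed.

(** The least code among the triples representing [x], so that equal rationals have equal codes. *)
Definition codeQ x : num := projT1 (cid (codeQ_ex x)).

Lemma codeQP x : exists a b d, codeQ x = trip a b d /\ x = mkQ (a, b, d).
Proof. by rewrite /codeQ; case: cid => c []. Qed.

Lemma codeQ_inj : injective codeQ.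
Proof.
move=> x y; have [a [b [d [-> ->]]]] := codeQP x.
by have [a' [b' [d' [-> ->]]]] := codeQP y => /trip_inj[-> -> ->].
Qed.

Lemma codeQ_rec : drel1 (fun c => exists x, c = codeQ x).
Proof.
apply: (@d1_ext _ (fun e => exists a, a < e 0%N + 1 /\ exists b, b < e 0%N + 1 /\
  exists d, d < e 0%N + 1 /\ (e 0%N = pr a (pr b d) /\ forall c, c < e 0%N ->
  forall a', a' < c + 1 -> forall b', b' < c + 1 -> forall d', d' < c + 1 ->
  c = pr a' (pr b' d') -> ~ same_rat a b d a' b' d'))).
  by rewrite /same_rat; definable.
move=> e; split.
  move=> [a [_ [b [_ [d [_ [eE hmin]]]]]]]; exists (mkQ (a, b, d)).
  rewrite /codeQ; case: cid => c /= [[a' [b' [d' [cE /same_ratE h]]]] cmin].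
  have [lt|//|lt] := nlt_total (e 0%N) c; first by case: (cmin _ lt a b d).
  have [h1 h2 h3] := trip_lt a' b' d'.
  by case: (hmin c lt a' _ b' _ d' _ cE h); rewrite cE.
move=> [x ->]; rewrite /codeQ; case: cid => c /= [[a [b [d [cE xE]]]] cmin].
have [h1 h2 h3] := trip_lt a b d.
exists a; split; first by rewrite cE.
exists b; split; first by rewrite cE.
exists d; split; first by rewrite cE.
split=> // c' lt a' _ b' _ d' _ e' /same_ratE h.
by apply: (cmin c' lt a' b' d' e'); rewrite xE.
Qed.

Definition cQ : @coding M Q := Coding (0%R : Q) codeQ_inj codeQ_rec.

(** It suffices to define all triples representing the value: the decidable range of [codeQ] singles
    out the least one. *)
Lemma recfun_cQ (s : env -> Q) (R : num -> num -> num -> env -> Prop) :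
  Sigma1 (fun e => R (e 0%N) (e 1%N) (e 2%N) (fun i : nat => e i.+3)) ->
  (forall e a b d, R a b d e <-> mkQ (a, b, d) = s e) ->
  recfun (fun e => cQ (s e)).
Proof.
move=> hR hs; apply: (@recfun_graph _ (fun z e => (exists x, z = codeQ x) /\
  exists d b a, z = trip a b d /\ R a b d e)).
  apply: s1_and; first by apply: d1_s1; exact: codeQ_rec.
  apply: s1_ex; apply: s1_ex; apply: s1_ex; apply: s1_and.
    by apply: d1_s1; rewrite /trip; definable.
  apply: (s1_subst hR (s := fun e => scons (e 0%N) (scons (e 1%N) (scons (e 2%N)
    (fun i => e i.+4))))).
  by case=> [|[|[|i]]]; apply: tm_var.
move=> e y; split=> [[[x ->] [d [b [a [xE /hs h]]]]]|->].
  have [a' [b' [d' [xE' ->]]]] := codeQP x; move: xE.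
  by rewrite -h xE' => /trip_inj[-> -> ->].
split; first by exists (s e).
have [a [b [d [xE h]]]] := codeQP (s e).
by exists d, b, a; split=> //; apply/hs.
Qed.

Let code_dec c a b d : cQ (dec cQ c) = trip a b d -> dec cQ c = mkQ (a, b, d).
Proof.
have [a' [b' [d' [xE h]]]] := codeQP (dec cQ c).
by rewrite [cQ _]xE => /trip_inj[<- <- <-].
Qed.

Lemma addQ_rec : rec_op2 cQ cQ cQ (@GRing.add Q).
Proof.
apply: (@recfun_cQ _ (fun a b d e => exists a1 b1 d1 a2 b2 d2,
  cQ (dec cQ (e 0%N)) = trip a1 b1 d1 /\ (cQ (dec cQ (e 1%N)) = trip a2 b2 d2 /\
  same_rat a b d (a1 * (d2 + 1) + a2 * (d1 + 1)) (b1 * (d2 + 1) + b2 * (d1 + 1))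
    (d1 * d2 + d1 + d2)))).
  by rewrite /same_rat /trip; definable.
move=> e a b d; split.
  move=> [a1 [b1 [d1 [a2 [b2 [d2 [/code_dec -> [/code_dec -> /same_ratE ->]]]]]]]].
  by apply: esym; apply: mkQ_add.
have [a1 [b1 [d1 [e1 h1]]]] := codeQP (dec cQ (e 0%N)).
have [a2 [b2 [d2 [e2 h2]]]] := codeQP (dec cQ (e 1%N)).
move=> h; exists a1, b1, d1, a2, b2, d2; split=> //; split=> //; apply/same_ratE.
by rewrite h h1 h2; apply: mkQ_add.
Qed.

Lemma mulQ_rec : rec_op2 cQ cQ cQ (@GRing.mul Q).
Proof.
apply: (@recfun_cQ _ (fun a b d e => exists a1 b1 d1 a2 b2 d2,
  cQ (dec cQ (e 0%N)) = trip a1 b1 d1 /\ (cQ (dec cQ (e 1%N)) = trip a2 b2 d2 /\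
  same_rat a b d (a1 * a2 + b1 * b2) (a1 * b2 + b1 * a2) (d1 * d2 + d1 + d2)))).
  by rewrite /same_rat /trip; definable.
move=> e a b d; split.
  move=> [a1 [b1 [d1 [a2 [b2 [d2 [/code_dec -> [/code_dec -> /same_ratE ->]]]]]]]].
  by apply: esym; apply: mkQ_mul.
have [a1 [b1 [d1 [e1 h1]]]] := codeQP (dec cQ (e 0%N)).
have [a2 [b2 [d2 [e2 h2]]]] := codeQP (dec cQ (e 1%N)).
move=> h; exists a1, b1, d1, a2, b2, d2; split=> //; split=> //; apply/same_ratE.
by rewrite h h1 h2; apply: mkQ_mul.
Qed.

Lemma oppQ_rec : rec_op1 cQ cQ (@GRing.opp Q).
Proof.
apply: (@recfun_cQ _ (fun a b d e => exists a1 b1 d1,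
  cQ (dec cQ (e 0%N)) = trip a1 b1 d1 /\ same_rat a b d b1 a1 d1)).
  by rewrite /same_rat /trip; definable.
move=> e a b d; split.
  move=> [a1 [b1 [d1 [/code_dec -> /same_ratE ->]]]].
  by apply: esym; apply: mkQ_opp.
have [a1 [b1 [d1 [e1 h1]]]] := codeQP (dec cQ (e 0%N)).
move=> h; exists a1, b1, d1; split=> //; apply/same_ratE.
by rewrite h h1; apply: mkQ_opp.
Qed.

Lemma inQ_rec : recfun1 (fun n => cQ (inQ n)).
Proof.
apply: (@recfun_cQ _ (fun a b d e => same_rat a b d (e 0%N) 0 0)).
  by rewrite /same_rat; definable.
by move=> e a b d; rewrite same_ratE.
Qed.
#[local] Hint Resolve addQ_rec mulQ_rec oppQ_rec : definable.

Lemma invQ_rec : rec_op1 cQ cQ (@GRing.inv Q).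
Proof.
apply: (@recfun_graph _ (fun z e => (exists x, z = cQ x) /\
  ((cQ (dec cQ (e 0%N)) = cQ 0%R /\ z = cQ 0%R) \/
   (cQ (dec cQ (e 0%N)) <> cQ 0%R /\ cQ (dec cQ z * dec cQ (e 0%N))%R = cQ 1%R)))).
  apply: s1_and; first by apply: d1_s1; exact: codeQ_rec.
  by definable.
move=> e y; set x := dec cQ _; split.
  move=> [[z ->] [[/(@cod_inj _ _ cQ) -> /(@cod_inj _ _ cQ) ->]|]].
    by rewrite invr0.
  rewrite codK => -[nz /(@cod_inj _ _ cQ) h]; congr (cQ _).
  have x0 : x != 0%R by apply/eqP => x0; apply: nz; rewrite x0.
  by apply: (mulIf x0); rewrite h mulVf.
move=> ->; split; first by eexists.
have [->|x0] := eqVneq x 0%R; first by left; rewrite invr0.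
right; rewrite codK mulVf //; split=> // /(@cod_inj _ _ cQ) h.
by rewrite h eqxx in x0.
Qed.

Lemma mkQ_ge0 a b d : (0 <= mkQ (a, b, d))%R <-> ~ a < b.
Proof.
have dp : (0 < inQ d + 1)%R by rewrite ltr_wpDl ?inQ_ge0 ?ltr01.
by rewrite mkQE pmulr_lge0 ?invr_gt0 // subr_ge0 nlt_inQ.
Qed.

Lemma s1_leQ (s t : env -> Q) : recfun (fun e => cQ (s e)) ->
  recfun (fun e => cQ (t e)) -> Sigma1 (fun e => (s e <= t e)%R).
Proof.
move=> hs ht; have hst : recfun (fun e => cQ (t e - s e)%R) by definable.
apply: (@s1_ext _ (fun e => exists a b d,
  cQ (t e - s e)%R = trip a b d /\ ~ a < b)).
  apply: s1_ex; apply: s1_ex; apply: s1_ex; apply: d1_s1; apply: d1_and.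
    apply: d1_eq; first exact: (recfun_tl (recfun_tl (recfun_tl hst))).
    by rewrite /trip; definable.
  by definable.
move=> e; have [a [b [d [xE h]]]] := codeQP (t e - s e)%R.
rewrite -subr_ge0 h mkQ_ge0 -h; split=> [[a' [b' [d' [e' h']]]]|h'].
  by move: e'; rewrite [cQ _]xE => /trip_inj[-> -> _].
by exists a, b, d.
Qed.

Lemma msum_bound (u : num -> Q) n (B : Q) : recfun1 (fun i => cQ (u i)) ->
  (forall i, i < n -> (`|u i| <= B)%R) -> (`|msum cQ u n| <= inQ n * B)%R.
Proof.
move=> hu hB.
have hs : recfun1 (fun k => cQ (msum cQ u k)).
  by apply: recfun1_msum => //; exact: addQ_rec.
have hi := inQ_rec.
have h : forall k, k < n + 1 ->
    (- (inQ k * B) <= msum cQ u k)%R /\ (msum cQ u k <= inQ k * B)%R.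
  s1_induction.
  - apply: s1_imp; first by definable.
    by apply: s1_and; apply: s1_leQ; definable.
  - by rewrite msum0 ?inQ0 ?mul0r ?oppr0 //; exact: addQ_rec.
  move=> k IHk ltk; have ltk' : k < n by num_lra.
  have [|h1 h2] := IHk; first by num_lra.
  rewrite msumS //; last exact: addQ_rec.
  have := hB k ltk'; rewrite ler_norml inQD inQ1 mulrDl mul1r => /andP[h3 h4].
  by split; lra.
have [|h1 h2] := h n; first by num_lra.
by rewrite ler_norml h1 h2.
Qed.

(** One number bounds both the size and some denominator. Hence [y] is at most [h] in size and,
    unless it is zero, at least [1 / h]. *)
Definition height h (y : Q) : Prop := (`|y| <= inQ h)%R /\
  exists D p q, [/\ 0 < D, ~ h < D & (y * inQ D = inQ p - inQ q)%R].

Lemma height_le h h' y : ~ h' < h -> height h y -> height h' y.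
Proof.
move=> /nlt_inQ hh [h1 [D [p [q [D0 hD e]]]]]; split; first exact: le_trans h1 hh.
by exists D, p, q; split=> //; num_lra.
Qed.

Lemma height_mul h h' x y : height h x -> height h' y -> height (h * h') (x * y)%R.
Proof.
move=> [h1 [D [p [q [D0 hD e]]]]] [h1' [D' [p' [q' [D0' hD' e']]]]]; split.
  by rewrite normrM inQM ler_pM.
exists (D * D'), (p * p' + q * q'), (p * q' + q * p'); split.
- by num_nra.
- by num_nra.
by rewrite inQM mulrACA e e' !inQD !inQM; ring.
Qed.

(** The product bounds the common denominator, the sum of heights bounds the size; their total
    bounds both. *)
Lemma height_add h h' x y : height h x -> height h' y ->
  height (h * h' + h + h') (x + y)%R.
Proof.
move=> [h1 [D [p [q [D0 hD e]]]]] [h1' [D' [p' [q' [D0' hD' e']]]]]; split.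
  apply: le_trans (ler_normD _ _) _; rewrite !inQD inQM.
  have g : (0 <= inQ h)%R by exact: inQ_ge0.
  have g' : (0 <= inQ h')%R by exact: inQ_ge0.
  by have := mulr_ge0 g g'; lra.
exists (D * D'), (p * D' + p' * D), (q * D' + q' * D); split.
- by num_nra.
- by num_nra.
rewrite inQM mulrDl mulrA e (mulrC (inQ D)) mulrA e' !inQD !inQM; ring.
Qed.

Lemma height_opp h x : height h x -> height h (- x)%R.
Proof.
move=> [h1 [D [p [q [D0 hD e]]]]]; split; first by rewrite normrN.
by exists D, q, p; split=> //; rewrite mulNr e opprB.
Qed.

(** The components of a triple are at most its code, and the denominator of the triple is [d + 1].
    Numbers that are not codes decode to 0. *)
Lemma height_dec c : height (c + 1) (dec cQ c).
Proof.
have [[x ->]|h] := EM (exists x, c = cQ x); last first.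
  have -> : dec cQ c = 0%R by rewrite /dec; case: pselect.
  split; first by rewrite normr0 inQ_ge0.
  by exists 1, 0, 0; split; [num_lra|num_lra|rewrite mul0r subrr].
rewrite codK; have [a [b [d [xE h]]]] := codeQP x; rewrite [cQ x]xE.
have [h1 h2 h3] := trip_lt a b d.
have dp : (0 < inQ d + 1)%R by rewrite ltr_wpDl ?inQ_ge0 ?ltr01.
have xd : (x * (inQ d + 1) = inQ a - inQ b)%R by rewrite h mkQE divfK // gt_eqF.
split; last first.
  by exists (d + 1), a, b; split; [num_lra|num_lra|rewrite inQD inQ1].
have le1 : (`|x| <= `|inQ a - inQ b|)%R.
  by rewrite -xd normrM (gtr0_norm dp) ler_peMr // lerDr inQ_ge0.
apply: le_trans le1 _; move/lt_inQ1: h1; move/lt_inQ1: h2; rewrite !inQD !inQ1.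
have ga : (0 <= inQ a)%R by exact: inQ_ge0.
have gb : (0 <= inQ b)%R by exact: inQ_ge0.
move=> g1 g2; rewrite ler_norml.
by apply/andP; split; lra.
Qed.

(** Multiplied by its denominator, [y] becomes a nonzero integer. *)
Lemma height_lower h y : height h y -> y != 0%R -> (1 <= `|y| * inQ h)%R.
Proof.
move=> [h1 [D [p [q [D0 /nlt_inQ hD e]]]]] y0.
have le1 : (1 <= `|y * inQ D|)%R.
  rewrite e; have [/lt_inQ1 lt|pq|/lt_inQ1 lt] := nlt_total p q.
  - by rewrite ler_normr; apply/orP; right; lra.
  - move/eqP: e; rewrite pq subrr mulf_eq0 (negPf y0) /=.
    by move/lt_inQ: D0 => /gt_eqF ->.
  by rewrite ler_normr; apply/orP; left; lra.
apply: le_trans le1 _; rewrite normrM ler_wpM2l // ger0_norm ?inQ_ge0 //.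
Qed.

End RatCoding.

#[export] Hint Resolve addQ_rec mulQ_rec oppQ_rec invQ_rec inQ_rec : definable.

(** * Relations killing vectors at finite stages *)

Section SumExtra.
Context {M : L2structure} {hM : RCA0 M}.
Local Notation num := (num M).
Variables (A : zmodType) (C : @coding M A).
Hypothesis addC : rec_op2 C C C (@GRing.add A).

Lemma msum_remove (u : num -> A) j n : recfun1 (fun i => C (u i)) -> j < n ->
  msum C u n = (msum C (fun i => ifp (i = j) 0%R (u i)) n + u j)%R.
Proof.
move=> hu; have hu' : recfun1 (fun i => C (ifp (i = j) 0%R (u i))) by definable.
have h1 : recfun1 (fun n => C (msum C u n)) by exact: recfun1_msum.
have h2 : recfun1 (fun n => C (msum C (fun i => ifp (i = j) 0%R (u i)) n)).
  exact: recfun1_msum.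
move: n; d1_induction.
- apply: d1_imp; first by definable.
  by apply: (d1_cod_eq (C := C)); definable.
- by move=> /nlt0F.
move=> n IHn /ltS_cases[ltj|e].
  rewrite !msumS // IHn // ifpF; first by rewrite addrAC.
  by move=> e; rewrite e in ltj; case: (nlt_irr ltj).
subst j; rewrite !msumS // ifpT // addr0; congr (_ + _)%R.
apply: eq_msum => // i lti; rewrite ifpF // => e.
by rewrite e in lti; case: (nlt_irr lti).
Qed.

(* Induction on the number of [s < b] for which a witness exists: there is
   a greatest such number. *)
Lemma strong_collection (theta : num -> num -> Prop) b : drel2 theta ->
  exists T, forall s, s < b -> (exists t, theta s t) -> exists t, t < T /\ theta s t.
Proof.
move=> hth.
pose q m := exists c, (forall i, i < m -> fval c i < b /\ exists t, theta (fval c i) t) /\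
  forall i, i < m -> forall j, j < m -> fval c i = fval c j -> i = j.
have [m [[c [h1 h2]] nq]] : exists m, q m /\ ~ q (m + 1).
  apply: contrapT => h.
  have qall : forall m, q m.
    s1_induction; first by rewrite /q; definable.
      by exists 0; split=> i /nlt0F.
    by move=> m hm; apply: contrapT => h'; apply: h; exists m.
  have [c [h1 h2]] := qall (b + 1).
  have [|i /h1[]//|i [j [ltij ltj e]]] := pigeonhole (h := fval c) (k := b).
    by definable.
  have eij : i = j by apply: h2 => //; num_lra.
  by rewrite eij in ltij; case: (nlt_irr ltij).
have [T hT] : exists T, forall i, i < m -> exists t, t < T /\ theta (fval c i) t.
  suff h : forall n, exists T, forall i, i < n -> i < m ->
      exists t, t < T /\ theta (fval c i) t.
    by have [T hT] := h m; exists T => i lti; apply: hT.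
  s1_induction; first by definable.
    by exists 0 => i /nlt0F.
  move=> n [T hT]; have [ltn|nltn] := EM (n < m); last first.
    by exists T => i /ltS_cases[/hT//|-> /nltn].
  have [_ [t ht]] := h1 n ltn; exists (T + t + 1) => i /ltS_cases[lti|->] ltm.
    by have [t' [lt' ht']] := hT i lti ltm; exists t'; split=> //; num_lra.
  by exists t; split=> //; num_lra.
exists T => s lts hs; have [[i [lti ->]]|hno] := EM (exists i, i < m /\ s = fval c i).
  exact: hT.
case: nq; pose h i := ifp (i < m) (fval c i) s.
have [|d [_ _ dE]] := @seq_code _ _ h (m + 1); first by rewrite /h; definable.
have dlt i : i < m -> fval d i = fval c i.
  by move=> lti; rewrite dE; [rewrite /h ifpT|num_lra].
have dm : fval d m = s by rewrite dE; [rewrite /h ifpF //; apply: nlt_irr|num_lra].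
exists d; split=> [i /ltS_cases[lti|->]|i /ltS_cases[lti|->] j /ltS_cases[ltj|->]] //.
- by rewrite dlt //; apply: h1.
- by rewrite dm.
- by rewrite !dlt //; apply: h2.
- by rewrite (dlt i lti) dm => e; case: hno; exists i.
by rewrite (dlt j ltj) dm => e; case: hno; exists j.
Qed.

End SumExtra.

Section Kill.
Context {M : L2structure} {hM : RCA0 M}.
Local Notation num := (num M).
Local Notation env := (nat -> num).
Local Notation Q := (@MRat M).
Variable g : num -> num.
Hypothesis hg : recfun1 g.
Implicit Types (s t T b c h x : num) (u v : num -> Q).

(* [t] kills [s]. *)
Definition nxt s t : Prop :=
  s < t /\ (g t = g s /\ forall r, r < t -> s < r -> g r <> g s).

Lemma d1_nxt : drel2 nxt.
Proof. by rewrite /nxt; definable. Qed.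
#[local] Hint Resolve d1_nxt : definable.

Lemma nxt_uniq s t t' : nxt s t -> nxt s t' -> t = t'.
Proof.
move=> [h1 [h2 h3]] [h1' [h2' h3']].
by have [lt|//|lt] := nlt_total t t'; [case: (h3' t)|case: (h3 t')].
Qed.

Lemma nxt_inj s s' t : nxt s t -> nxt s' t -> s = s'.
Proof.
move=> [h1 [h2 h3]] [h1' [h2' h3']].
have [lt|//|lt] := nlt_total s s'.
  by case: (h3 s') => //; rewrite -h2'.
by case: (h3' s) => //; rewrite -h2.
Qed.

Lemma nxt_ex s : (exists t, s < t /\ g t = g s) -> exists t, nxt s t.
Proof.
move=> [t ht]; have [||m [[m1 m2] mmin]] := @least _ _ (fun t => s < t /\ g t = g s) t.
- by definable.
- by [].
by exists m; split=> //; split=> // r ltr ltsr e; apply: (mmin r).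
Qed.

(** The index 0 is exempt: its vector is the target of all identifications. *)
Definition dead s : Prop := s <> 0 /\ exists t, nxt s t.

Definition next_time T s : num := search (nxt s) T.

Lemma next_timeE s t T : nxt s t -> t < T -> next_time T s = t.
Proof.
move=> hst ltT; apply: searchE => // [|t' hst']; first by definable.
exact: nxt_uniq hst' hst.
Qed.

(** The cubic factor accounts for three quantities bounded by the stage in [killed_early]: the
    number of terms, the size of the coefficients, and the denominator of the last killed
    coefficient. *)
Definition growth t : num :=
  prec (fun i y => (i + 1 + 1) * (i + 1 + 1) * (i + 1 + 1) * y) 1 t.

Let growth_step : recfun2 (fun i y : num => (i + 1 + 1) * (i + 1 + 1) * (i + 1 + 1) * y).
Proof. by definable. Qed.

Lemma growth_rec : recfun1 growth.
Proof. by rewrite /growth; definable. Qed.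
#[local] Hint Resolve growth_rec : definable.

Lemma growthS t : growth (t + 1) = (t + 1 + 1) * (t + 1 + 1) * (t + 1 + 1) * growth t.
Proof. by rewrite /growth precS. Qed.

Lemma nmul_gt0 (x y : num) : 0 < x -> 0 < y -> 0 < x * y.
Proof. by move=> h1 h2; num_nra. Qed.

Lemma cube_gt0 t : 0 < (t + 1 + 1) * (t + 1 + 1) * (t + 1 + 1).
Proof. by apply: nmul_gt0; [apply: nmul_gt0|]; num_lra. Qed.

Lemma growth_gt0 t : 0 < growth t.
Proof.
have hgr := growth_rec; move: t; d1_induction; first by definable.
  by rewrite /growth prec0 //; num_lra.
by move=> t IH; rewrite growthS; apply: nmul_gt0 => //; apply: cube_gt0.
Qed.

Lemma growth_mono t t' : t < t' + 1 -> growth t < growth t' + 1.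
Proof.
have hgr := growth_rec; move: t'; d1_induction; first by definable.
  by move=> /ltS_cases[/nlt0F//|->]; num_lra.
move=> t' IH /ltS_cases[/IH{}IH|->]; last by num_lra.
have p : 0 < growth t' by exact: growth_gt0.
rewrite growthS; set X := growth t' in IH p *.
have := cube_gt0 t'; move: (_ * _ * _) => Y Y0.
have e2 : ~ Y * X < X by num_nra.
by num_lra.
Qed.

(** The coefficient with which index [s] contributes to coordinate 0, as known at stage [T]: 0 as
    long as no kill has been seen. Unlike for the limit [cl], its recursiveness is immediate. *)
Definition cf T s : Q := ifp (s = 0) 1%R
  (ifp (exists t, t < T /\ nxt s t) (inQ (growth (next_time T s))) 0%R).

Lemma cf_rec : recfun2 (fun T s => cQ (cf T s)).
Proof.
have hi : recfun1 (fun n => cQ (@inQ M n)) by exact: inQ_rec.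
by rewrite /cf /next_time /search; definable.
Qed.
#[local] Hint Resolve cf_rec : definable.

Lemma cf0 T : cf T 0 = 1%R. Proof. by rewrite /cf ifpT. Qed.

Lemma cf_nxt T s t : s <> 0 -> nxt s t -> t < T -> cf T s = inQ (growth t).
Proof.
move=> s0 hst ltT; rewrite /cf ifpF // ifpT; last by exists t.
by rewrite (next_timeE hst ltT).
Qed.

Lemma cf_none T s : s <> 0 -> ~ (exists t, nxt s t) -> cf T s = 0%R.
Proof. by move=> s0 h; rewrite /cf ifpF // ifpF // => -[t [_ ht]]; apply: h; exists t. Qed.

(* The limit of [cf T s] as [T] grows. *)
Definition cl s : Q :=
  if pselect (exists t, nxt s t) is left h then cf (projT1 (cid h) + 1) s else cf 0 s.

Lemma cf_cl T s : (forall t, nxt s t -> t < T) -> cf T s = cl s.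
Proof.
move=> hT; have [->|s0] := EM (s = 0).
  by rewrite /cl; case: pselect => *; rewrite !cf0.
rewrite /cl; case: pselect => [h|h]; last by rewrite !cf_none.
case: cid => t /= ht; rewrite (cf_nxt s0 ht (hT t ht)) (cf_nxt s0 ht) //.
by num_lra.
Qed.

Lemma cl0 : cl 0 = 1%R.
Proof. by rewrite /cl; case: pselect => *; rewrite cf0. Qed.

Lemma cl_nxt s t : s <> 0 -> nxt s t -> cl s = inQ (growth t).
Proof.
move=> s0 ht; rewrite -(@cf_cl (t + 1)); last first.
  by move=> t' /(nxt_uniq ht) <-; num_lra.
by apply: cf_nxt => //; num_lra.
Qed.

Lemma cl_none s : s <> 0 -> ~ (exists t, nxt s t) -> cl s = 0%R.
Proof. by move=> s0 h; rewrite /cl; case: pselect => // h'; rewrite cf_none. Qed.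

(** Not every [s < b] is killed, and which ones are need not be decidable; strong collection still
    provides a stage after all kills below [b]. *)
Lemma kill_bound b : exists T, forall s, s < b -> forall t, nxt s t -> t < T.
Proof.
have [T hT] := strong_collection b d1_nxt; exists T => s lts t ht.
have [|t' [ltt' ht']] := hT s lts; first by exists t.
by rewrite (nxt_uniq ht ht').
Qed.

Definition supp u b : Prop := forall s, ~ s < b -> u s = 0%R.
Definition fin u : Prop := recfun1 (fun s => cQ (u s)) /\ exists b, supp u b.

(** On the support of [u] the limit coincides with [cf T] for one suitable stage [T]; elsewhere the
    product is 0. *)
Lemma cl_rec u : fin u -> recfun1 (fun s => cQ (cl s * u s)%R).
Proof.
move=> [hu [b hb]]; have [T hT] := kill_bound b.
have -> : (fun s => cQ (cl s * u s)%R) = (fun s => cQ (cf T s * u s)%R).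
  apply: funext => s; congr (cQ _); have [lts|/hb ->] := EM (s < b).
    by rewrite cf_cl // => t; apply: hT.
  by rewrite !mulr0.
by definable.
Qed.

Definition lam u : Q := if pselect (exists b, supp u b) is left h
  then msum cQ (fun s => cl s * u s)%R (projT1 (cid h)) else 0%R.

Lemma lamE u b : fin u -> supp u b -> lam u = msum cQ (fun s => cl s * u s)%R b.
Proof.
move=> fu hb; have hcl := cl_rec fu.
rewrite /lam; case: pselect => [h|[]]; last by exists b.
case: cid => b' /= hb'; have aQ : rec_op2 cQ cQ cQ (@GRing.add Q) by exact: addQ_rec.
transitivity (msum cQ (fun s => cl s * u s)%R (b + b')).
  apply/esym/msum_ext0 => //; last by num_lra.
  by move=> s /hb' ->; rewrite mulr0.
apply: msum_ext0 => //; last by num_lra.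
by move=> s /hb ->; rewrite mulr0.
Qed.

Lemma fin_lin a u v : fin u -> fin v -> fin (fun s => a * u s + v s)%R.
Proof.
move=> [hu [b hb]] [hv [b' hb']]; split; first by definable.
exists (b + b') => s h; rewrite hb; last by num_lra.
by rewrite hb'; [rewrite mulr0 addr0|num_lra].
Qed.

Lemma lam_lin a u v : fin u -> fin v ->
  lam (fun s => a * u s + v s)%R = (a * lam u + lam v)%R.
Proof.
move=> fu fv; have fuv := fin_lin a fu fv.
have [hu [b hb]] := fu; have [hv [b' hb']] := fv.
have hb1 : supp u (b + b') by move=> s h; apply: hb; num_lra.
have hb2 : supp v (b + b') by move=> s h; apply: hb'; num_lra.
have hb3 : supp (fun s => a * u s + v s)%R (b + b').
  by move=> s h; rewrite hb1 // hb2 // mulr0 addr0.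
rewrite (lamE fuv hb3) (lamE fu hb1) (lamE fv hb2).
have h1 := cl_rec fuv; have h2 := cl_rec fu; have h3 := cl_rec fv.
have aQ : rec_op2 cQ cQ cQ (@GRing.add Q) by exact: addQ_rec.
have h4 : recfun1 (fun s => cQ (a * (cl s * u s))%R) by definable.
rewrite (@msum_morph _ _ _ _ cQ cQ (fun y : Q => a * y)%R) //; last first.
- exact: mulrDr.
- exact: mulr0.
- by definable.
rewrite -msumD //; apply: eq_msum => //; first by definable.
by move=> s _; rewrite mulrDr mulrCA.
Qed.

(* The vector [u] after all identifications: a killed [s] contributes its value
   times [cl s] to the coordinate 0. *)
Definition limv u : num -> Q :=
  fun s => ifp (s = 0) (lam u) (ifp (dead s) 0%R (u s)).

Lemma limv_lin a u v : fin u -> fin v ->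
  limv (fun s => a * u s + v s)%R = (fun s => a * limv u s + limv v s)%R.
Proof.
move=> fu fv; apply: funext => s; rewrite /limv.
have [s0|s0] := EM (s = 0); rewrite ?(ifpT _ _ s0) ?(ifpF _ _ s0); first exact: lam_lin.
have [ds|ds] := EM (dead s); rewrite ?(ifpT _ _ ds) ?(ifpF _ _ ds) //.
by rewrite mulr0 addr0.
Qed.

Lemma limv_alive u s : s <> 0 -> ~ (exists t, nxt s t) -> limv u s = u s.
Proof. by move=> s0 h; rewrite /limv ifpF // ifpF // => -[_ /h]. Qed.

Lemma limv0 u : limv u 0 = lam u. Proof. by rewrite /limv ifpT. Qed.

Definition removed u s i : Q := ifp (i = s) 0%R (cl i * u i)%R.

(* If an element of the support of [u] were killed after stage [b + h], the term
   of the last killed one would dominate the sum [limv u 0]. *)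
Lemma killed_early u b h : fin u -> supp u b -> (forall s, height h (u s)) ->
  (forall s, limv u s = 0%R) -> forall s, s < b -> u s <> 0%R ->
  s = 0 \/ exists t, t < b + h + 1 /\ nxt s t.
Proof.
move=> fu hb hh pu0 s1 lts1 us1; apply: contrapT => /not_orP[s10 hs1].
have [T hT] := kill_bound b.
have [t1 ht1] : exists t, nxt s1 t.
  by apply: contrapT => h'; apply: us1; rewrite -(pu0 s1) limv_alive.
have [hu _] := fu.
(* The latest kill within the support; writing the nonvanishing of [u s] on codes keeps the
   predicate decidable. *)
have [|||t [[s [lts [s0 [us hst]]]] tmax]] := @greatest _ _ (fun t =>
  exists s, s < b /\ (s <> 0 /\ (cQ (u s) <> cQ 0%R /\ nxt s t))) t1 T.
- by definable.
- by exists s1; split=> //; split=> //; split=> // /(@cod_inj _ _ cQ).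
- by move=> t [s [lts [_ [_ hst]]]]; apply: hT hst.
have lett : ~ t < b + h + 1.
  have lt1 : t1 < t + 1.
    apply: tmax; exists s1; split=> //; split=> //; split=> // /(@cod_inj _ _ cQ).
    exact: us1.
  move=> ltt; apply: hs1; exists t1; split=> //; num_lra.
have [t0|[m tE]] := num_case t; first by exfalso; num_lra.
have aQ : rec_op2 cQ cQ cQ (@GRing.add Q) by exact: addQ_rec.
have hv := cl_rec fu.
set v' := removed u s.
have hv' : recfun1 (fun i => cQ (v' i)) by rewrite /v' /removed; definable.
have sum0 : (msum cQ v' b + cl s * u s = 0)%R.
  rewrite -(@msum_remove _ _ _ cQ aQ (fun i => cl i * u i)%R) //.
  by rewrite -lamE // -limv0 pu0.
have gm : (1 <= inQ (growth m))%R.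
  have /lt_inQ1 : 0 < growth m by exact: growth_gt0.
  by rewrite inQ0 add0r.
have h0 : (0 <= inQ h)%R by exact: inQ_ge0.
have ge0 : (0 <= inQ (growth m) * inQ h)%R by rewrite mulr_ge0 // inQ_ge0.
have bnd : (`|msum cQ v' b| <= inQ b * (inQ (growth m) * inQ h))%R.
  apply: msum_bound => // i lti; rewrite /v' /removed.
  have [->|ns] := EM (i = s); first by rewrite ifpT // normr0.
  rewrite ifpF //; have [->|ui] := eqVneq (u i) 0%R; first by rewrite mulr0 normr0.
  have [hui _] := hh i; rewrite normrM ler_pM //.
  have [->|i0] := EM (i = 0); first by rewrite cl0 normr1.
  have [[t' ht']|hn] := EM (exists t', nxt i t'); last first.
    by rewrite cl_none // normr0 inQ_ge0.
  rewrite (cl_nxt i0 ht') ger0_norm ?inQ_ge0 //; apply/nlt_inQ.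
  have ltt' : t' < t + 1.
    apply: tmax; exists i; split=> //; split=> //; split=> // /(@cod_inj _ _ cQ) e.
    by rewrite e eqxx in ui.
  (* Different indices are killed at different times, so the other kills in the support happen by
     time [m]. *)
  have ne : t' <> t by move=> e; apply: ns; apply: (@nxt_inj i s t) => //; rewrite -e.
  have lem : t' < m + 1 by case: (ltS_cases ltt') => //; rewrite tE.
  by have := growth_mono lem => ?; num_lra.
have us0 : u s != 0%R by apply/eqP => e; apply: us; rewrite e.
have low := height_lower (hh s) us0.
have upper : (inQ (growth t) * `|u s| <= inQ b * (inQ (growth m) * inQ h))%R.
  have -> : (inQ (growth t) * `|u s| = `|msum cQ v' b|)%R.
    rewrite -[X in (X * _)%R]ger0_norm ?inQ_ge0 // -normrM -(cl_nxt s0 hst).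
    by rewrite -normrN; congr (`|_|)%R; apply/eqP; rewrite eq_sym -addr_eq0 sum0.
  exact: bnd.
(* One factor [h] bounds the coefficients, the other comes from the lower bound [1 / h] for
   [|u s|]. *)
have final : (inQ (growth t) <= inQ b * (inQ (growth m) * inQ h) * inQ h)%R.
  apply: le_trans (ler_wpM2r h0 upper); rewrite -mulrA.
  by apply: ler_peMr low; apply: inQ_ge0.
move: final; rewrite tE growthS !inQM !inQD !inQ1.
rewrite tE in lett; move/nlt_inQ: lett; rewrite !inQD !inQ1 => lett.
have m0 : (0 <= inQ m)%R by exact: inQ_ge0.
have b0 : (0 <= inQ b)%R by exact: inQ_ge0.
move: (inQ m) (inQ b) (inQ h) (inQ (growth m)) m0 b0 h0 gm lett
  => m' b' h' G m0 b0 h0 gm lett final.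
(* From [b + h <= m]: the left side is at most [m^3], and [(m + 2)^2 * m] leaves a positive gap
   below the growth factor [(m + 2)^3]. *)
have hbb : (b' * (h' * h') <= (m' + 1 + 1) * ((m' + 1 + 1) * m'))%R.
  by rewrite ler_pM ?ler_pM ?mulr_ge0 //; lra.
have : ((m' + 1 + 1) * ((m' + 1 + 1) * 2) * G <= 0)%R.
  have -> : ((m' + 1 + 1) * ((m' + 1 + 1) * 2) * G =
    (m' + 1 + 1) * (m' + 1 + 1) * (m' + 1 + 1) * G
    - ((m' + 1 + 1) * ((m' + 1 + 1) * m')) * G)%R by ring.
  rewrite subr_le0; apply: le_trans final _.
  have -> : (b' * (G * h') * h' = b' * (h' * h') * G)%R by ring.
  by rewrite ler_wpM2r //; lra.
apply/negP; rewrite -ltNge !mulr_gt0 //; lra.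
Qed.

(** Decides equality in the limit: by [killed_early] it can be checked at stage [b + h + 1], where
    the approximations [cf] already agree with [cl] on the support. *)
Lemma zero_test u b h : fin u -> supp u b -> (forall s, height h (u s)) ->
  (forall s, limv u s = 0%R) <->
  (forall s, s < b -> cQ (u s) <> cQ 0%R -> s = 0 \/ exists t, t < b + h + 1 /\ nxt s t) /\
  cQ (msum cQ (fun s => cf (b + h + 1)%L2 s * u s)%R b) = cQ 0%R.
Proof.
move=> fu hb hh; have aQ : rec_op2 cQ cQ cQ (@GRing.add Q) by exact: addQ_rec.
have [hu _] := fu; have hcl := cl_rec fu.
have sumE : (forall s, s < b -> u s <> 0%R ->
    s = 0 \/ exists t, t < b + h + 1 /\ nxt s t) ->
    msum cQ (fun s => cf (b + h + 1)%L2 s * u s)%R b = lam u.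
  move=> hs; rewrite (lamE fu hb); apply: eq_msum => //; first by definable.
  move=> s lts; have [->|us] := EM (u s = 0%R); first by rewrite !mulr0.
  have [->|[t [ltt ht]]] := hs s lts us; first by rewrite cf0 cl0.
  by rewrite cf_cl // => t' /(nxt_uniq ht) <-.
split=> [pu0|[h1 h2]].
  have early := killed_early fu hb hh pu0.
  split=> [s lts us|]; first by apply: early => // e; apply: us; rewrite e.
  by rewrite sumE // -limv0 pu0.
have early s : s < b -> u s <> 0%R -> s = 0 \/ exists t, t < b + h + 1 /\ nxt s t.
  by move=> lts us; apply: h1 => // /(@cod_inj _ _ cQ).
move=> s; have [->|s0] := EM (s = 0).
  by rewrite limv0 -sumE //; apply: (@cod_inj _ _ cQ).
rewrite /limv ifpF //; have [ds|ds] := EM (dead s); first by rewrite ifpT.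
rewrite ifpF //; apply: contrapT => us.
have [/(early s)|/hb//] := EM (s < b); case=> // -[t [_ ht]].
by apply: ds; split=> //; exists t.
Qed.

Definition wv c s : Q := dec cQ (fval c s).

Lemma wv_rec : recfun2 (fun c s => cQ (wv c s)).
Proof. by rewrite /wv; definable. Qed.
#[local] Hint Resolve wv_rec : definable.

(** The triple of zeros has code 0. Thus the default value 0 of [fval] decodes to a zero coordinate,
    and every number codes a vector of finite support. *)
Lemma dec0 : dec cQ 0 = 0%R :> Q.
Proof.
have e : cQ (0%R : Q) = 0.
  apply: contrapT => n0; have : 0 < cQ (0%R : Q) by exact: num_gt0.
  rewrite /= /codeQ; case: cid => c /= [_ hmin] /hmin h.
  apply: (h 0 0 0) => //; rewrite /trip /pr; num_lra.
by rewrite -e codK.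
Qed.

Lemma wv_out c s : fval c s = 0 -> wv c s = 0%R.
Proof. by rewrite /wv => ->; apply: dec0. Qed.

Lemma wv_supp c : supp (wv c) c.
Proof. by move=> s h; apply: wv_out; apply: contrapT => /fval_dom. Qed.

Lemma wv_fin c : fin (wv c).
Proof. by split; [definable|exists c; apply: wv_supp]. Qed.

(** The code bounds heights as well as the support, which makes the stage in [zero_test] computable
    from the codes. *)
Lemma wv_height c s : height (c + 1) (wv c s).
Proof.
have hd : height (fval c s + 1) (wv c s) by exact: height_dec.
apply: height_le hd; have [h|h] := EM (fval c s = 0); first by rewrite h; num_lra.
have c0 : c <> 0.
  have lt : s < c by exact: fval_dom.
  by move=> c0; rewrite c0 in lt; case: (nlt0F lt).
by have lt : fval c s < c; [exact: fval_lt|num_lra].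
Qed.

Lemma wv_code u : fin u -> exists c, wv c = u.
Proof.
move=> [hu [b hb]]; have [c [_ hc cE]] := seq_code b hu.
exists c; apply: funext => s; have [lts|nlts] := EM (s < b).
  by rewrite /wv cE // codK.
rewrite hb // wv_out // fval_out // => z /hc[i [lti /pr_inj[e _]]].
by rewrite e in nlts.
Qed.

Definition defect x c1 c2 c3 s : Q :=
  (dec cQ x * wv c1 s + (- (1 : Q) * wv c3 s + wv c2 s))%R.

(** One relation serves three purposes: equality of vectors with scalar 0, addition with scalar 1,
    and scaling with a zero vector as second summand. *)
Definition lin_rel x c1 c2 c3 : Prop :=
  forall s, (dec cQ x * limv (wv c1) s + limv (wv c2) s = limv (wv c3) s)%R.

Lemma d1_lin_rel : drel4 lin_rel.
Proof.
pose k (x c1 c2 c3 : num) := x + c1 + c2 + c3 + 1.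
(* The height that [height_mul] and [height_add] give for [defect] when [k] bounds the heights of
   the scalar and of the three vectors. *)
pose h3 (k : num) := k * k * (1 * k * k + 1 * k + k) + k * k + (1 * k * k + 1 * k + k).
apply: (@d1_ext _ (fun e =>
  let u := defect (e 0%N) (e 1%N) (e 2%N) (e 3%N) in
  let b := k (e 0%N) (e 1%N) (e 2%N) (e 3%N) in let h := h3 b in
  (forall s, s < b -> cQ (u s) <> cQ 0%R -> s = 0 \/ exists t, t < b + h + 1 /\ nxt s t)
  /\ cQ (msum cQ (fun s => cf (b + h + 1)%L2 s * u s)%R b) = cQ 0%R)).
  by rewrite /defect /k /h3; cbv zeta; definable.
move=> e; cbv zeta; set x := e 0%N; set c1 := e 1%N; set c2 := e 2%N; set c3 := e 3%N.
have fu1 : fin (fun s => - (1 : Q) * wv c3 s + wv c2 s)%R by apply: fin_lin; apply: wv_fin.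
have fu : fin (defect x c1 c2 c3) by apply: fin_lin => //; apply: wv_fin.
have hb : supp (defect x c1 c2 c3) (k x c1 c2 c3).
  by rewrite /k => s hs; rewrite /defect !wv_supp ?mulr0 ?addr0 //; num_lra.
have hh s : height (h3 (k x c1 c2 c3)) (defect x c1 c2 c3 s).
  have kx : height (k x c1 c2 c3) (dec cQ x).
    by apply: height_le (height_dec x); rewrite /k; num_lra.
  have k1 : height (k x c1 c2 c3) (wv c1 s).
    by apply: height_le (wv_height c1 s); rewrite /k; num_lra.
  have k2 : height (k x c1 c2 c3) (wv c2 s).
    by apply: height_le (wv_height c2 s); rewrite /k; num_lra.
  have k3 : height (1 * k x c1 c2 c3) (- (1 : Q) * wv c3 s)%R.
    rewrite mulN1r nmul1n; apply: height_opp.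
    by apply: height_le (wv_height c3 s); rewrite /k; num_lra.
  exact: height_add (height_mul kx k1) (height_add k3 k2).
rewrite -(zero_test fu hb hh) /defect limv_lin ?limv_lin //; try exact: wv_fin.
split=> h s; have := h s.
  by rewrite mulN1r => /eqP; rewrite [X in (_ + X)%R]addrC addrA subr_eq0 => /eqP.
by rewrite /lin_rel mulN1r => <-; rewrite addrCA [X in (_ + X)%R]addrC; lra.
Qed.

End Kill.

(** * Structures from codings; Gaussian elimination *)

Section FromCodings.
Context {M : L2structure} {hM : RCA0 M}.
Local Notation num := (num M).

Lemma image_set (T : Type) (C : @coding M T) :
  exists X : sets M, forall x, elt x X <-> exists a, x = C a.
Proof. have [h1 h2] := cod_rec C; exact: (d1_comprehension h1 h2). Qed.

Lemma op2_set (T U Z : Type) (C : @coding M T) (D : @coding M U) (E : @coding M Z)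
    (op : T -> U -> Z) : rec_op2 C D E op -> exists X : sets M,
  forall p, elt p X <-> exists x y, p = pr (pr (C x) (D y)) (E (op x y)).
Proof.
move=> hop; have hC := cod_rec C; have hD := cod_rec D.
pose P (p : num) := exists a, a < p + 1 /\ exists b, b < p + 1 /\ exists c, c < p + 1 /\
  (p = pr (pr a b) c /\ ((exists x, a = C x) /\ ((exists y, b = D y) /\
   c = E (op (dec C a) (dec D b))))).
have [h1 h2] : drel1 P by rewrite /P; definable.
have [X hX] := d1_comprehension h1 h2; exists X => p; rewrite hX; split.
  move=> [a [_ [b [_ [c [_ [-> [[x ->] [[y ->] ->]]]]]]]]].
  by exists x, y; rewrite !codK.
move=> [x [y ->]]; set c := E _.
have l1 : pr (C x) (D y) < pr (pr (C x) (D y)) c + 1 by exact: pr_gel.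
have l2 : c < pr (pr (C x) (D y)) c + 1 by exact: pr_ger.
have l3 : C x < pr (C x) (D y) + 1 by exact: pr_gel.
have l4 : D y < pr (C x) (D y) + 1 by exact: pr_ger.
exists (C x); split; first by num_lra.
exists (D y); split; first by num_lra.
exists c; split=> //; split=> //; split; first by exists x.
by split; [exists y|rewrite !codK].
Qed.

Lemma op1_set (T U : Type) (C : @coding M T) (D : @coding M U)
    (op : T -> U) : rec_op1 C D op -> exists X : sets M,
  forall p, elt p X <-> exists x, p = pr (C x) (D (op x)).
Proof.
move=> hop; have hC := cod_rec C.
pose P (p : num) := exists a, a < p + 1 /\ exists c, c < p + 1 /\
  (p = pr a c /\ ((exists x, a = C x) /\ c = D (op (dec C a)))).
have [h1 h2] : drel1 P by rewrite /P; definable.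
have [X hX] := d1_comprehension h1 h2; exists X => p; rewrite hX; split.
  by move=> [a [_ [c [_ [-> [[x ->] ->]]]]]]; exists x; rewrite !codK.
move=> [x ->]; exists (C x); split; first exact: pr_gel.
exists (D (op x)); split; first exact: pr_ger.
by split=> //; split; [exists x|rewrite !codK].
Qed.

Lemma op2_is_fun (T U Z : Type) (C : @coding M T) (D : @coding M U) (E : @coding M Z)
    (op : T -> U -> Z) (X SC SD SE : sets M) :
  (forall p, elt p X <-> exists x y, p = pr (pr (C x) (D y)) (E (op x y))) ->
  (forall x, elt x SC <-> exists a, x = C a) ->
  (forall x, elt x SD <-> exists a, x = D a) ->
  (forall x, elt x SE <-> exists a, x = E a) ->
  is_fun (Defs.in_set X) (cartesian (Defs.in_set SC) (Defs.in_set SD)) (Defs.in_set SE).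
Proof.
move=> hX hC hD hE; split=> [p /hX[x [y ->]]|p].
  exists (pr (C x) (D y)), (E (op x y)); split=> //.
    exists (C x), (D y); split=> //; [by apply/hC; exists x|by apply/hD; exists y].
  by apply/hE; eexists.
move=> [a [b [/hC[x ->] /hD[y ->] ->]]].
exists (E (op x y)); split; first by apply/hX; exists x, y.
move=> z /hX[x' [y' e]]; have [e1 ->] := pr_inj e; have [ex ey] := pr_inj e1.
by rewrite (cod_inj ex) (cod_inj ey).
Qed.

Variables (F : fieldType) (cF : @coding M F).
Hypotheses (addF : rec_op2 cF cF cF (@GRing.add F))
  (mulF : rec_op2 cF cF cF (@GRing.mul F)) (oppF : rec_op1 cF cF (@GRing.opp F)).

Record field_rep (K : field M) : Prop := FieldRep {
  frep_K : forall x, elt x (K_ K) <-> exists a, x = cF a;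
  frep_add : forall a b c, fapp2 (addK K) a b c <->
    exists x y, [/\ a = cF x, b = cF y & c = cF (x + y)%R];
  frep_mul : forall a b c, fapp2 (mulK K) a b c <->
    exists x y, [/\ a = cF x, b = cF y & c = cF (x * y)%R];
  frep_0 : zeroK K = cF 0%R;
  frep_1 : oneK K = cF 1%R }.

Lemma fapp2P (T U Z : Type) (C : @coding M T) (D : @coding M U) (E : @coding M Z)
    (op : T -> U -> Z) (X : sets M) :
  (forall p, elt p X <-> exists x y, p = pr (pr (C x) (D y)) (E (op x y))) ->
  forall a b c, fapp2 X a b c <->
    exists x y, [/\ a = C x, b = D y & c = E (op x y)].
Proof.
move=> hX a b c; rewrite /fapp2 hX; split=> [[x [y e]]|[x [y [-> -> ->]]]].
  by have [e1 ->] := pr_inj e; have [-> ->] := pr_inj e1; exists x, y.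
by exists x, y.
Qed.

Ltac unpack E := repeat match goal with
  | H : fapp2 _ _ _ _ |- _ => case/E: H => ? [? []] *
  end;
  repeat match goal with
  | H : cod ?C ?x = cod ?C ?y |- _ => apply (@cod_inj _ _ C) in H
  | H : ?x = ?y |- _ => first [subst x|subst y|clear H]
  end.

Lemma field_of_coding : exists K : field M, field_rep K.
Proof.
have [S hS] := image_set cF; have [A hA] := op2_set addF.
have [Mu hMu] := op2_set mulF; have [O hO] := op1_set oppF.
have A2 := fapp2P hA; have M2 := fapp2P hMu.
have O2 a b : fapp O a b <-> exists x, a = cF x /\ b = cF (- x)%R.
  rewrite /fapp hO; split=> [[x e]|[x [-> ->]]]; last by exists x.
  by have [-> ->] := pr_inj e; exists x.
have fO : is_fun (Defs.in_set O) (Defs.in_set S) (Defs.in_set S).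
  split=> [p /hO[x ->]|a /hS[x ->]].
    by exists (cF x), (cF (- x)%R); split=> //; apply/hS; eexists.
  exists (cF (- x)%R); split; first by apply/hO; exists x.
  by move=> z /hO[y e]; have [/(@cod_inj _ _ cF) -> ->] := pr_inj e.
unshelve eexists.
  apply: (@Field M S A Mu O (cF 0%R) (cF 1%R)).
  - by apply/hS; exists 0%R.
  - by apply/hS; exists 1%R.
  - exact: (op2_is_fun hA hS hS hS).
  - exact: (op2_is_fun hMu hS hS hS).
  - exact: fO.
  - move=> a b c ab bc abc h1 h2 h3; unpack A2.
    by apply/A2; do 2 eexists; split=> //; rewrite addrA.
  - by move=> a b c h; unpack A2; apply/A2; do 2 eexists; split=> //; rewrite addrC.
  - move=> a /hS[x ->]; apply/A2; do 2 eexists; split=> //; by rewrite add0r.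
  - by move=> a b /O2[x [-> ->]]; apply/A2; do 2 eexists; split=> //; rewrite addNr.
  - move=> a b c ab bc abc h1 h2 h3; unpack M2.
    by apply/M2; do 2 eexists; split=> //; rewrite mulrA.
  - by move=> a b c h; unpack M2; apply/M2; do 2 eexists; split=> //; rewrite mulrC.
  - by move=> a /hS[x ->]; apply/M2; do 2 eexists; split=> //; rewrite mul1r.
  - move=> a /hS[x ->] nz; exists (cF (x^-1)%R); apply/M2; do 2 eexists; split=> //.
    by rewrite mulVf //; apply/eqP => x0; apply: nz; rewrite x0.
  - move=> a b c b_c ab ac s h1 h2 h3 h4; unpack A2; unpack M2.
    by apply/M2; do 2 eexists; split=> //; rewrite mulrDr.
  - by move=> /(@cod_inj _ _ cF)/eqP; rewrite oner_eq0.
by split.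
Qed.

Variables (W : lmodType F) (cW : @coding M W).
Hypotheses (addW : rec_op2 cW cW cW (@GRing.add W))
  (scaleW : rec_op2 cF cW cW (@GRing.scale F W)).

Lemma vspace_of_coding (K : field M) : field_rep K ->
  exists V : vspace K, represents V cF cW.
Proof.
move=> rK; have [S hS] := image_set cW; have [A hA] := op2_set addW.
have [Sc hSc] := op2_set scaleW.
have A2 := fapp2P hA; have S2 := fapp2P hSc.
have KA := frep_add rK; have KM := frep_mul rK.
unshelve eexists.
  apply: (@VSpace M K S A Sc (cW 0%R)).
  - by apply/hS; exists 0%R.
  - exact: (op2_is_fun hA hS hS hS).
  - exact: (op2_is_fun hSc (frep_K rK) hS hS).
  - move=> a b c ab bc abc h1 h2 h3; unpack A2.
    by apply/A2; do 2 eexists; split=> //; rewrite addrA.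
  - by move=> a b c h; unpack A2; apply/A2; do 2 eexists; split=> //; rewrite addrC.
  - by move=> a /hS[x ->]; apply/A2; do 2 eexists; split=> //; rewrite add0r.
  - move=> a /hS[x ->]; exists (cW (- x)%R).
    by apply/A2; do 2 eexists; split=> //; rewrite addNr.
  - move=> a b v ab bv abv /KM[x [y [-> -> ->]]] h2 h3; unpack S2.
    by apply/S2; do 2 eexists; split=> //; rewrite scalerA.
  - move=> a /hS[x ->]; rewrite (frep_1 rK).
    by apply/S2; do 2 eexists; split=> //; rewrite scale1r.
  - move=> a u v uv au av s h1 h2 h3 h4; unpack A2; unpack S2.
    by apply/S2; do 2 eexists; split=> //; rewrite scalerDr.
  - move=> a b v ab av bv s /KA[x [y [-> -> ->]]] h2 h3 h4; unpack A2; unpack S2.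
    by apply/S2; do 2 eexists; split=> //; rewrite scalerDl.
split=> //=; first exact: (frep_K rK).
- move=> u v z; rewrite A2; split=>
    [[x [y [/(@cod_inj _ _ cW) -> /(@cod_inj _ _ cW) -> ->]]]//|->].
  by exists u, v.
- move=> a u z; rewrite S2; split=>
    [[x [y [/(@cod_inj _ _ cF) -> /(@cod_inj _ _ cW) -> ->]]]//|->].
  by exists a, u.
exact: (frep_0 rK).
Qed.

End FromCodings.

(** * Gaussian elimination in the model *)

Section Elimination.
Context {M : L2structure} {hM : RCA0 M}.
Local Notation num := (num M).
Local Notation env := (nat -> num).

Definition pr1 (z : num) : num :=
  search (fun i => exists j, j < z + 1 /\ z = pr i j) (z + 1).
Definition pr2 (z : num) : num :=
  search (fun j => exists i, i < z + 1 /\ z = pr i j) (z + 1).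

Lemma pr1E i j : pr1 (pr i j) = i.
Proof.
apply: searchE; first by definable.
- by exists j; split=> //; exact: pr_ger.
- exact: pr_gel.
by move=> i' [j' [_ e]]; have [] := pr_inj e.
Qed.

Lemma pr2E i j : pr2 (pr i j) = j.
Proof.
apply: searchE; first by definable.
- by exists i; split=> //; exact: pr_gel.
- exact: pr_ger.
by move=> j' [i' [_ e]]; have [] := pr_inj e.
Qed.

Lemma pr1_rec : recfun1 pr1. Proof. by rewrite /pr1 /search; definable. Qed.
Lemma pr2_rec : recfun1 pr2. Proof. by rewrite /pr2 /search; definable. Qed.

Lemma matrix_code (h : num -> num -> num) m : recfun2 h ->
  exists c, forall i, i < m -> forall j, j < m -> fval c (pr i j) = h i j.
Proof.
move=> hh; have h1 := pr1_rec; have h2 := pr2_rec.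
have [|c [_ _ cE]] := @seq_code _ _ (fun z => h (pr1 z) (pr2 z)) (pr m m + 1).
  by definable.
exists c => i lti j ltj; rewrite cE ?pr1E ?pr2E //.
have h3 : ~ pr m m < pr i j by apply: pr_mono; num_lra.
by num_lra.
Qed.

Variables (F : fieldType) (cF : @coding M F).
Hypotheses (addF : rec_op2 cF cF cF (@GRing.add F))
  (mulF : rec_op2 cF cF cF (@GRing.mul F)) (oppF : rec_op1 cF cF (@GRing.opp F)).

Lemma msum_lin k (u v : num -> F) n : recfun1 (fun i => cF (u i)) ->
  recfun1 (fun i => cF (v i)) ->
  msum cF (fun i => u i + k * v i)%R n = (msum cF u n + k * msum cF v n)%R.
Proof.
move=> hu hv.
have hs : recfun1 (fun n => cF (msum cF v n)) by exact: recfun1_msum.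
rewrite msumD //; last by definable.
congr (_ + _)%R; apply/esym/(@msum_morph _ _ _ _ cF cF (fun x => k * x)%R) => //.
- by definable.
- by definable.
- exact: mulr0.
exact: mulrDr.
Qed.

Variables (A : num -> num -> F) (m : num).
Hypothesis hA : recfun2 (fun i l => cF (A i l)).

Definition entry (tau p i : num) : F := dec cF (fval tau (pr p i)).
Definition row_val (tau p l : num) : F := msum cF (fun i => entry tau p i * A i l)%R (m + 1).
Definition pivot_free (q j p : num) : Prop := forall l, l < j -> fval q l <> p.

(* After [j] steps of Gaussian elimination: the rows [p] that have not been used
   as pivots are combinations of the rows of [A] that vanish on the first [j]
   columns, and their coefficients at the unused positions are those of the
   identity matrix. *)
Definition reduced (j tau q : num) : Prop :=
  forall p, p < m + 1 -> pivot_free q j p ->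
    cF (entry tau p p) = cF 1%R /\
    ((forall p', p' < m + 1 -> pivot_free q j p' -> p' <> p ->
        cF (entry tau p p') = cF 0%R) /\
     forall l, l < j -> cF (row_val tau p l) = cF 0%R).

Lemma eliminate j : j < m + 1 -> exists tau q, reduced j tau q.
Proof.
move: j; s1_induction.
- apply: s1_imp; first by definable.
  by rewrite /reduced /pivot_free /row_val /entry; definable.
- have [|tau tauE] := @matrix_code (fun p i => cF (ifp (p = i) 1%R 0%R)) (m + 1).
    by definable.
  move=> _; exists tau, 0 => p ltp _; rewrite /entry tauE // ifpT // codK; split=> //.
  split=> [p' ltp' _ ne|l /nlt0F//]; rewrite tauE // ifpF ?codK //.
  by move=> e; apply: ne.
move=> j IH ltj; have [|tau [q hq]] := IH; first by num_lra.
have ltjm : j < m by num_lra.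
have ext (p0 : num) : exists q', (forall l, l < j -> fval q' l = fval q l) /\ fval q' j = p0.
  have [|q' [_ _ qE]] := @seq_code _ _ (fun l => ifp (l < j) (fval q l) p0) (j + 1).
    by definable.
  exists q'; split=> [l ltl|]; first by rewrite qE; [rewrite ifpT|num_lra].
  by rewrite qE; [rewrite ifpF //; apply: nlt_irr|num_lra].
have hrow : recfun2 (fun p l => cF (row_val tau p l)).
  by rewrite /row_val /entry; definable.
have hent : recfun2 (fun p i => cF (entry tau p i)) by rewrite /entry; definable.
have [[p0 [ltp0 [free0 nz]]]|none] := EM (exists p, p < m + 1 /\
    (pivot_free q j p /\ row_val tau p j <> 0%R)); last first.
  (* Column [j] has no pivot. The entry 0 is a dummy: at worst it removes row 0 from the rows still
     to be treated. *)
  have [q' [q'E q'j]] := ext 0; exists tau, q' => p ltp free.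
  have sub p' : pivot_free q' (j + 1) p' -> pivot_free q j p'.
    by move=> h l ltl; rewrite -q'E //; apply: h; num_lra.
  have [h1 [h2 h3]] := hq p ltp (sub p free); split=> //; split.
    by move=> p' ltp' /sub; apply: h2.
  move=> l /ltS_cases[ltl|->]; first exact: h3.
  congr (cF _); apply: contrapT => nz; apply: none; exists p; split=> //.
  by split=> //; apply: sub.
have [q' [q'E q'j]] := ext p0.
pose k p : F := (- (row_val tau p j * (row_val tau p0 j)^-1))%R.
have hk : recfun1 (fun p => cF (k p)) by rewrite /k; definable.
have [|tau' tauE] := @matrix_code (fun p i =>
    cF (entry tau p i + k p * entry tau p0 i)%R) (m + 1).
  by definable.
have entE p i : p < m + 1 -> i < m + 1 ->
    entry tau' p i = (entry tau p i + k p * entry tau p0 i)%R.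
  by move=> ltp lti; rewrite {1}/entry tauE // codK.
have [h01 [h02 h03]] := hq p0 ltp0 free0.
have sub p' : pivot_free q' (j + 1) p' -> pivot_free q j p' /\ p' <> p0.
  move=> h; split=> [l ltl|e]; first by rewrite -q'E //; apply: h; num_lra.
  by apply: (h j); [num_lra|rewrite q'j e].
have rowE p l : p < m + 1 ->
    row_val tau' p l = (row_val tau p l + k p * row_val tau p0 l)%R.
  move=> ltp; rewrite /row_val -msum_lin; try by definable.
  apply: eq_msum => //; try by rewrite /entry; definable.
  by move=> i lti; rewrite entE // mulrDl mulrA.
exists tau', q' => p ltp /sub[free ne].
have [h1 [h2 h3]] := hq p ltp free.
have z0 : entry tau p0 p = 0%R by apply: (@cod_inj _ _ cF); apply: h02.
split; first by rewrite entE // z0 mulr0 addr0.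
split=> [p' ltp' /sub[free' ne'] nep|l /ltS_cases[ltl|->]].
- have z1 : entry tau p0 p' = 0%R by apply: (@cod_inj _ _ cF); apply: h02.
  by rewrite entE // z1 mulr0 addr0; apply: h2.
- have z1 : row_val tau p0 l = 0%R by apply: (@cod_inj _ _ cF); apply: h03.
  by rewrite rowE // z1 mulr0 addr0; apply: h3.
congr (cF _); rewrite rowE // /k mulNr divfK ?subrr //; exact/eqP.
Qed.

(** In [m] steps at most [m] of the [m + 1] rows become pivots. A remaining row has coefficient 1 at
    its own position, so its relation is nontrivial. *)
Lemma row_relation : exists t : num -> F, [/\ recfun1 (fun i => cF (t i)),
  exists p, p < m + 1 /\ t p <> 0%R &
  forall l, l < m -> msum cF (fun i => t i * A i l)%R (m + 1) = 0%R].
Proof.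
have [|tau [q hq]] := @eliminate m; first by num_lra.
have [p [ltp free]] : exists p, p < m + 1 /\ pivot_free q m p.
  apply: contrapT => none.
  have hp p : p < m + 1 -> index_in q m p < m /\ fval q (index_in q m p) = p.
    move=> ltp; have [[l [ltl e]]|h] := EM (exists l, l < m /\ p = fval q l).
      exact: index_inP ltl e.
    by case: none; exists p; split=> // l ltl e; apply: h; exists l.
  apply: (@no_injection _ _ (index_in q m) (m + 1) m).
  - exact: recfun_index_in.
  - by num_lra.
  - by move=> i /hp[].
  by move=> i j lti ltj e; rewrite -(hp i lti).2 -(hp j ltj).2 e.
have [h1 [_ h3]] := hq p ltp free.
exists (fun i => entry tau p i); split.
- by rewrite /entry; definable.
- exists p; split=> // e; move/(@cod_inj _ _ cF): h1; rewrite e => /esym/eqP.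
  by rewrite oner_eq0.
by move=> l /h3/(@cod_inj _ _ cF).
Qed.

End Elimination.

(** * Sigma-2 induction from bases *)

Section Space.
Context {M : L2structure} {hM : RCA0 M}.
Local Notation num := (num M).
Local Notation Q := (@MRat M).
Variable (g : num -> num) (hg : recfun1 g).

(** The quotient by the identifications, realised as the space of limit functions, where equality is
    pointwise. The argument [h] makes the algebraic instances inferable from the type. *)
Definition mv (h : recfun1 g) : Type := {phi : num -> Q | exists c, phi = limv g (wv c)}.
Local Notation W := (mv hg).
Implicit Types (x y z : W) (a : Q) (c d s : num).

HB.instance Definition _ := gen_eqMixin W.
HB.instance Definition _ := gen_choiceMixin W.

Lemma lin_ex a x y : exists c, (fun s => a * sval x s + sval y s)%R = limv g (wv c).
Proof.
have [c ->] := proj2_sig x; have [d ->] := proj2_sig y.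
have [e he] := wv_code (fin_lin a (wv_fin c) (wv_fin d)).
by exists e; rewrite he limv_lin //; exact: wv_fin.
Qed.

Definition linW a x y : W :=
  exist (fun phi : num -> Q => exists c, phi = limv g (wv c)) _ (lin_ex a x y).

Lemma zero_ex : exists c, (fun _ => 0%R) = limv g (wv c) :> (num -> Q).
Proof.
pose x0 : W := exist (fun phi : num -> Q => exists c, phi = limv g (wv c)) _
  (ex_intro (fun c => limv g (wv 0) = limv g (wv c)) 0 erefl).
have [c hc] := lin_ex (-1)%R x0 x0; exists c; rewrite -hc.
by apply: funext => s; rewrite mulN1r addNr.
Qed.

Definition zeroMV : W := exist (fun phi : num -> Q => exists c, phi = limv g (wv c)) _ zero_ex.
Definition addMV x y : W := linW 1%R x y.
Definition oppMV x : W := linW (-1)%R x zeroMV.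
Definition scaleMV a x : W := linW a x zeroMV.

Lemma mv_eq x y : (forall s, sval x s = sval y s) -> x = y.
Proof. by move=> h; apply: sval_inj; apply: funext. Qed.

Lemma addMVA : associative addMV.
Proof. by move=> x y z; apply: mv_eq => s /=; ring. Qed.
Lemma addMVC : commutative addMV.
Proof. by move=> x y; apply: mv_eq => s /=; ring. Qed.
Lemma add0MV : left_id zeroMV addMV.
Proof. by move=> x; apply: mv_eq => s /=; ring. Qed.
Lemma addNMV : left_inverse zeroMV oppMV addMV.
Proof. by move=> x; apply: mv_eq => s /=; ring. Qed.

HB.instance Definition _ := GRing.isZmodule.Build W addMVA addMVC add0MV addNMV.

Lemma scaleMVA a (b : Q) x : scaleMV a (scaleMV b x) = scaleMV (a * b)%R x.
Proof. by apply: mv_eq => s /=; ring. Qed.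
Lemma scale1MV : left_id (1%R : Q) scaleMV.
Proof. by move=> x; apply: mv_eq => s /=; ring. Qed.
Lemma scaleMVDr : right_distributive scaleMV +%R.
Proof. by move=> a x y; apply: mv_eq => s /=; ring. Qed.
Lemma scaleMVDl x : {morph (fun a : Q => scaleMV a x) : a b / (a + b)%R}.
Proof. by move=> a b; apply: mv_eq => s /=; ring. Qed.

HB.instance Definition _ := GRing.Zmodule_isLmodule.Build Q W
  scaleMVA scale1MV scaleMVDr scaleMVDl.

Lemma sval0 s : sval (0%R : W) s = 0%R. Proof. by []. Qed.
Lemma svalD x y s : sval (x + y)%R s = (sval x s + sval y s)%R.
Proof. by rewrite /= mul1r. Qed.
Lemma svalZ a x s : sval (a *: x)%R s = (a * sval x s)%R.
Proof. by rewrite /= addr0. Qed.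

Lemma lin_relE (q c1 c2 c3 : num) : lin_rel g q c1 c2 c3 <->
  (fun s => dec cQ q * limv g (wv c1) s + limv g (wv c2) s)%R = limv g (wv c3).
Proof.
by split=> [h|h s]; [apply: funext|exact: (f_equal (fun f => f s) h)].
Qed.

Lemma lin_rel_eq c d : lin_rel g (cQ 0%R) 0 c d <-> limv g (wv c) = limv g (wv d).
Proof.
rewrite lin_relE codK (_ : (fun s => _) = limv g (wv c)) //.
by apply: funext => s; rewrite mul0r add0r.
Qed.

(** Equality of limits is decidable, as [lin_rel] with scalar 0, so a least code can be chosen. *)
Lemma codeMV_ex x : exists c, limv g (wv c) = sval x /\
  forall c', c' < c -> limv g (wv c') <> sval x.
Proof.
have [c0 ->] := proj2_sig x.
have hl : drel4 (lin_rel g) by exact: d1_lin_rel.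
have [||c [/lin_rel_eq hc cmin]] := @least _ _ (fun c => lin_rel g (cQ 0%R) 0 c0 c) c0.
- by definable.
- exact/lin_rel_eq.
exists c; split=> // c' ltc h; apply: (cmin c' ltc); exact/lin_rel_eq.
Qed.

Definition codeMV x : num := projT1 (cid (codeMV_ex x)).

Lemma limv_codeMV x : limv g (wv (codeMV x)) = sval x.
Proof. by rewrite /codeMV; case: cid => c []. Qed.

Definition minimal_code c : Prop :=
  forall c', c' < c -> ~ lin_rel g (cQ 0%R) 0 c' c.

Lemma d1_minimal_code : drel1 minimal_code.
Proof. have hl : drel4 (lin_rel g) by exact: d1_lin_rel.
by rewrite /minimal_code; definable. Qed.

Lemma codeMVP x c : c = codeMV x <-> minimal_code c /\ limv g (wv c) = sval x.
Proof.
rewrite /codeMV; case: cid => d /= [hd dmin]; split.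
  by move=> ->; split=> // c' ltc /lin_rel_eq h; apply: (dmin c' ltc); rewrite h.
move=> [cmin hc]; have [lt|//|lt] := nlt_total c d; first by case: (dmin c lt).
by case: (cmin d lt); apply/lin_rel_eq; rewrite hd hc.
Qed.

Lemma codeMV_inj : injective codeMV.
Proof. by move=> x y e; apply: sval_inj; rewrite -!limv_codeMV e. Qed.

Lemma codeMV_rec : drel1 (fun c => exists x, c = codeMV x).
Proof.
apply: (d1_ext d1_minimal_code) => e; split=> [h|[x /codeMVP[]//]].
exists (exist (fun phi : num -> Q => exists c, phi = limv g (wv c)) _
  (ex_intro (fun c => limv g (wv (e 0%N)) = limv g (wv c)) (e 0%N) erefl)).
exact/codeMVP.
Qed.

Definition cW : @coding M W := Coding (0%R : W) codeMV_inj codeMV_rec.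

Lemma addMV_rec : rec_op2 cW cW cW (@GRing.add W).
Proof.
have hl : drel4 (lin_rel g) by exact: d1_lin_rel.
have hm := d1_minimal_code.
apply: (@recfun_graph _ (fun d e => minimal_code d /\
  lin_rel g (cQ 1%R) (cW (dec cW (e 0%N))) (cW (dec cW (e 1%N))) d)).
  by definable.
move=> e d; rewrite [d = _]codeMVP lin_relE codK !limv_codeMV.
by split=> -[h1 h2]; split.
Qed.

Lemma scaleMV_rec : rec_op2 cQ cW cW (@GRing.scale Q W).
Proof.
have hl : drel4 (lin_rel g) by exact: d1_lin_rel.
have hm := d1_minimal_code.
apply: (@recfun_graph _ (fun d e => minimal_code d /\
  lin_rel g (e 0%N) (cW (dec cW (e 1%N))) (cW 0%R) d)).
  by definable.
move=> e d; rewrite [d = _]codeMVP lin_relE !limv_codeMV.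
by split=> -[h1 h2]; split.
Qed.

(* The value at [s] of the vector coded by [c < b], with [T] bounding the times at
   which the numbers below [b] are killed. *)
Definition value_below (T b s c : num) : Q :=
  ifp (s = 0) (msum cQ (fun s => cf g T s * wv c s)%R b)
  (ifp (dead g s) 0%R (wv c s)).

(** Evaluation at 0 involves the kill times of the whole support, which no single stage bounds for
    all vectors. Here the codes of the partial sums are bounded, and below that bound one stage [T]
    suffices, so evaluation is recursive where needed. *)
Lemma sum_ev (u : num -> W) (w : num -> Q) n s :
  recfun1 (fun i => cW (u i)) -> recfun1 (fun i => cQ (w i)) ->
  (forall i, i < n -> sval (u i) s = w i) -> sval (msum cW u n) s = msum cQ w n.
Proof.
move=> hu hw uw; have aW := addMV_rec.
have hs : recfun1 (fun i => cW (msum cW u i)) by exact: recfun1_msum.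
have [b hb] := bounded_range (n + 1) hs.
have [T hT] := kill_bound hg b.
have hcf : recfun2 (fun T s => cQ (cf g T s)) by exact: cf_rec.
have hwv : recfun2 (fun c s => cQ (wv c s)) by exact: wv_rec.
set E := value_below T b s.
have hE : recfun1 (fun c => cQ (E c)) by rewrite /E /value_below; definable.
have EE c : c < b -> E c = limv g (wv c) s.
  move=> ltc; rewrite /E /value_below /limv; have [s0|s0] := EM (s = 0); last by rewrite !(ifpF _ _ s0).
  rewrite !(ifpT _ _ s0) (@lamE _ _ g hg _ b) //.
  - apply: eq_msum; [exact: addQ_rec|by definable|exact: (cl_rec hg (wv_fin c))|].
    by move=> i lti; rewrite cf_cl // => t; apply: hT.
  - exact: wv_fin.
  by move=> i nlti; apply: wv_supp; num_lra.
have ES i : i < n + 1 -> E (cW (msum cW u i)) = sval (msum cW u i) s.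
  by move=> lti; rewrite EE ?[cW _]/= ?limv_codeMV //; apply: hb.
rewrite -ES; last by num_lra.
apply: (@msum_unique _ _ _ cQ _ w (fun i => E (cW (msum cW u i))) n) => //.
- exact: addQ_rec.
- by definable.
- by rewrite ES ?msum0 //; num_lra.
- move=> i lti; rewrite !ES; try by num_lra.
  by rewrite msumS // svalD uw.
by num_lra.
Qed.

Variable N : num.
Hypothesis gN : forall s, g s < N.

Definition live T b l s : Prop :=
  s < b /\ (s <> 0 /\ (g s = l /\ ~ exists t, t < T /\ nxt g s t)).

(* Coordinate [l < N] of the vector coded by [c] is its value at the last hit of
   block [l] below [b]; coordinate [N] is its value at 0. *)
Definition coord T b c l : Q := ifp (l = N)
  (msum cQ (fun s => cf g T s * wv c s)%R b)
  (ifp (exists s, s < b /\ live T b l s) (wv c (search (live T b l) b)) 0%R).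

Lemma coord_rec T b : recfun2 (fun c l => cQ (coord T b c l)).
Proof.
have hn : drel2 (nxt g) by exact: d1_nxt.
have hcf : recfun2 (fun T s => cQ (cf g T s)) by exact: cf_rec.
have hwv : recfun2 (fun c s => cQ (wv c s)) by exact: wv_rec.
by rewrite /coord /search /live; definable.
Qed.

Lemma coord_N T b c : (forall s, s < b -> forall t, nxt g s t -> t < T) -> c < b ->
  coord T b c N = limv g (wv c) 0.
Proof.
move=> hT ltc; rewrite /coord ifpT // limv0 (@lamE _ _ g hg _ b).
- have hcf : recfun2 (fun T s => cQ (cf g T s)) by exact: cf_rec.
  have hwv : recfun2 (fun c s => cQ (wv c s)) by exact: wv_rec.
  apply: eq_msum; [exact: addQ_rec|by definable|exact: (cl_rec hg (wv_fin c))|].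
  by move=> i lti; rewrite cf_cl // => t; apply: hT.
- exact: wv_fin.
by move=> i nlti; apply: wv_supp; num_lra.
Qed.

Lemma coord_live T b c s : (forall s, s < b -> forall t, nxt g s t -> t < T) ->
  s < b -> s <> 0 -> ~ (exists t, nxt g s t) -> coord T b c (g s) = limv g (wv c) s.
Proof.
move=> hT lts s0 alive; rewrite /coord ifpF; last first.
  by move=> e; have := gN s; rewrite e; apply: nlt_irr.
have hs : live T b (g s) s by split=> //; split=> //; split=> // -[t [_ ht]]; apply: alive; exists t.
have hn : drel2 (nxt g) by exact: d1_nxt.
rewrite ifpT; last by exists s.
rewrite (@searchE _ _ _ s) // ?limv_alive //; first by rewrite /live; definable.
(* Two live indices of one block are impossible: the later one hits the block again, so the earlier
   one has been killed. *)
have nolater s1 s2 : s2 < b -> g s1 = g s2 -> live T b (g s2) s1 -> ~ s1 < s2.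
  move=> lts2 e [lts1 [_ [_ h]]] lt12.
  have [|t ht] := @nxt_ex _ _ g hg s1; first by exists s2.
  by apply: h; exists t; split=> //; apply: hT ht.
move=> s' hs'; have [lts' [_ [e' _]]] := hs'.
have [lt|//|lt] := nlt_total s' s; first by case: (nolater s' s).
by case: (nolater s s') => //; rewrite e'.
Qed.

Variables (K : field M) (V : vspace K).
Hypothesis rep : represents V cQ cW.

(** The vectors have [N + 1] relevant coordinates, one for each block and one for index 0, so
    elimination yields a relation among any [N + 2] of them. *)
Lemma dim_bound (X : num) : (forall c, felt c X -> elt c (V_ V)) ->
  fin_card X (N + 1 + 1) -> lin_dep V (fun c => felt c X).
Proof.
move=> XV /fin_card_enum[q [qinj qX]].
have inX i : i < N + 1 + 1 -> felt (fval q i) X by move=> lti; apply/qX; exists i.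
have qE i : i < N + 1 + 1 -> cW (dec cW (fval q i)) = fval q i.
  by move=> /inX/XV/(rep_V rep)[u ->]; rewrite codK.
have [|b hb] := @bounded_range _ _ (fval q) (N + 1 + 1); first by definable.
have [T hT] := kill_bound hg b.
have hco := coord_rec T b.
have hco' : recfun2 (fun i l => cQ (coord T b (fval q i) l)) by definable.
have [t [ht [p [ltp tp]] hsum]] := row_relation addQ_rec mulQ_rec oppQ_rec
  (A := fun i l => coord T b (fval q i) l) (N + 1) hco'.
have sW := scaleMV_rec.
apply/(lin_depE rep); exists (N + 1 + 1), t, (fun i => dec cW (fval q i)); split.
- split=> //; first by definable.
  by move=> i lti; rewrite qE //; apply: inX.
- apply: mv_eq => s; rewrite sval0 /comb.
  have val i : i < N + 1 + 1 ->
      sval (t i *: dec cW (fval q i))%R s = (t i * limv g (wv (fval q i)) s)%R.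
    by move=> lti; rewrite svalZ -(limv_codeMV (dec cW (fval q i))) [codeMV _]qE.
  have rel l : l < N + 1 -> (forall i, i < N + 1 + 1 ->
      coord T b (fval q i) l = limv g (wv (fval q i)) s) ->
      sval (msum cW (fun i => t i *: dec cW (fval q i))%R (N + 1 + 1)) s = 0%R.
    move=> ltl hc; rewrite -(hsum l ltl); apply: sum_ev; [by definable|by definable|].
    by move=> i lti; rewrite val // hc.
  have zero : (forall i, i < N + 1 + 1 -> limv g (wv (fval q i)) s = 0%R) ->
      sval (msum cW (fun i => t i *: dec cW (fval q i))%R (N + 1 + 1)) s = 0%R.
    move=> hz; rewrite (@sum_ev _ (fun=> 0%R)); [|by definable|by definable|].
      by rewrite msum_eq0 //; [exact: addQ_rec|by definable].
    by move=> i lti; rewrite val // hz // mulr0.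
  (* Index 0 is coordinate [N]; a last hit below [b] is the coordinate of its block; at killed
     indices and at last hits beyond [b] all the vectors vanish. *)
  have [s0|s0] := EM (s = 0).
    apply: (rel N) => [|i lti]; first by num_lra.
    by rewrite s0; apply: coord_N => //; apply: hb.
  have [hx|alive] := EM (exists t, nxt g s t).
    by apply: zero => i lti; rewrite /limv (ifpF _ _ s0) ifpT.
  have [lts|nlts] := EM (s < b).
    apply: (rel (g s)) => [|i lti]; last exact: coord_live.
    by have lt := gN s; num_lra.
  apply: zero => i lti; rewrite limv_alive // wv_supp // => lt.
  by have lt' := hb i lti; apply: nlts; num_lra.
- move=> i j lti ltj e; apply: qinj => //; by rewrite -qE // e qE.
by exists p.
Qed.

(** An unbounded [B] would allow iterating the search for the next larger element; [N + 2] steps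
    give a finite subset too large to be independent. *)
Lemma basis_bounded B : is_basis V B -> exists b, forall c, elt c B -> c < b.
Proof.
move=> [BV Bindep _]; apply: contrapT => none.
have unb (y : num) : exists c, elt c B /\ y < c.
  apply: contrapT => h; apply: none; exists (y + 1) => c hc.
  by apply: contrapT => nlt; apply: h; exists c; split=> //; num_lra.
have nx_ex (y : num) : exists c, (elt c B /\ y < c) /\ forall d, d < c -> ~ (elt d B /\ y < d).
  have [c hc] := unb y.
  by apply: (@least _ _ (fun c => elt c B /\ y < c) c _ hc); definable.
pose nx (y : num) : num := projT1 (cid (nx_ex y)).
have nxP (y : num) : (elt (nx y) B /\ y < nx y) /\
    forall d, d < nx y -> ~ (elt d B /\ y < d).
  by rewrite /nx; case: cid.
have nx_rec : recfun1 nx.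
  apply: (@recfun_graph _ (fun c e => (elt c B /\ e 0%N < c) /\
    forall d, d < c -> ~ (elt d B /\ e 0%N < d))); first by definable.
  move=> e c; have [h1 h2] := nxP (e 0%N); split=> [[h3 h4]|->]; last by split.
  have [lt|//|lt] := nlt_total c (nx (e 0%N)); first by case: (h2 c lt).
  by case: (h4 _ lt).
have hstep : recfun2 (fun _ y : num => nx y) by definable.
pose R (i : num) : num := prec (fun _ y : num => nx y) (nx 0) i.
have hR : recfun1 R by apply: recfun1_prec.
have R0 : R 0 = nx 0 by rewrite /R prec0.
have RS i : R (i + 1) = nx (R i) by rewrite /R precS.
have RB i : elt (R i) B.
  by have [->|[j ->]] := num_case i; rewrite ?R0 ?RS; apply: (nxP _).1.1.
have mono i : forall j, i < j -> R i < R j.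
  d1_induction; [by definable|by move=> /nlt0F|move=> j IH].
  have lt : R j < R (j + 1) by rewrite RS; apply: (nxP _).1.2.
  by move=> /ltS_cases[/IH ltij|->] //; num_lra.
have [X [cX hX]] := image_code (N + 1 + 1) hR.
have XB c : felt c X -> elt c B by move=> /hX[i [_ ->]]; apply: RB.
have : lin_dep V (fun c => felt c X).
  apply: dim_bound => [c /XB|]; first exact: BV.
  apply: (fin_card_intro hR _ hX) => i j _ _ e.
  have [lt|//|lt] := nlt_total i j; have := mono _ _ lt; rewrite e.
    by move=> /nlt_irr.
  by move=> /nlt_irr.
move=> /(lin_depE rep)[k [al [up [[h1 h2 h3] h4 h5 h6]]]]; apply: Bindep.
by apply/(lin_depE rep); exists k, al, up; split=> //; split=> // i /h3/XB.
Qed.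

(** Evaluation at a last hit [s] other than 0 is linear and equals 1 on the unit vector at [s], so
    it is nonzero on some basis vector. The code of that vector exceeds [s], being a bound on its
    support, and lies below the bound of the basis. *)
Lemma last_hits_of_basis B : is_basis V B ->
  exists b, forall s, (forall t, s < t -> g t <> g s) -> s < b.
Proof.
move=> hB; have [b hb] := basis_bounded hB; have [BV _ /(spansE rep BV) Bspan] := hB.
(* The index 0 is treated apart: its coordinate collects contributions of killed indices and does
   not show that 0 lies in the support. *)
exists (b + 1) => s last; have [->|s0] := EM (s = 0); first by num_lra.
have alive : ~ exists t, nxt g s t by move=> [t [lt [e _]]]; apply: (last t).
have [c hc] : exists c, wv c = (fun i => ifp (i = s) 1%R 0%R) :> (num -> Q).
  apply: wv_code; split; first by definable.
  by exists (s + 1) => i nlt; rewrite ifpF // => e; apply: nlt; rewrite e; num_lra.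
have [k [al [up [[hal hup upB] e]]]] :=
  Bspan (exist (fun phi : num -> Q => exists c, phi = limv g (wv c)) _
    (ex_intro (fun d => limv g (wv c) = limv g (wv d)) c erefl)).
have e1 : sval (comb cW al up k) s = 1%R.
  by rewrite e /= limv_alive // hc ifpT.
have [i [lti nz]] : exists i, i < k /\ sval (up i) s <> 0%R.
  apply: contrapT => none; have sW := scaleMV_rec; move: e1.
  rewrite /comb (@sum_ev _ (fun=> 0%R)); [|by definable|by definable|].
    rewrite msum_eq0; [|exact: addQ_rec|by definable|by []].
    by move=> /esym/eqP; rewrite oner_eq0.
  move=> i lti; rewrite svalZ; have [->|nz] := EM (sval (up i) s = 0%R).
    by rewrite mulr0.
  by case: none; exists i.
have ltb : cW (up i) < b by apply/hb/upB.
have lts : s < cW (up i).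
  apply: contrapT => nlt; apply: nz.
  by rewrite -limv_codeMV limv_alive // wv_supp.
by num_lra.
Qed.

End Space.

Lemma last_hits_of_bases (M : L2structure) (hM : RCA0 M) :
  (forall (K : field M) (V : vspace K),
     (exists n : num M, forall X : num M,
        is_code X -> (forall x, felt x X -> elt x (V_ V)) -> fin_card X n ->
        lin_dep V (fun x => felt x X)) ->
     exists B : sets M, is_basis V B) -> @last_hits_bounded M.
Proof.
move=> H N g hg gN.
have [K rK] := field_of_coding addQ_rec mulQ_rec oppQ_rec.
have [V rep] := vspace_of_coding (addMV_rec hg) (scaleMV_rec hg) rK.
have [|B hB] := H K V; last exact: (last_hits_of_basis gN rep hB).
by exists (N + 1 + 1) => X _; apply: (dim_bound gN rep).
Qed.

Theorem theorem4p1 (M : L2structure) (hM : RCA0 M) :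
  [<->
       ISigma M 2;
       forall (K : field M) (V : vspace K),
         (exists n : num M, forall X : num M,
            is_code X -> (forall x, felt x X -> elt x (V_ V)) -> fin_card X n ->
            lin_dep V (fun x => felt x X)) ->
         exists B : sets M, is_basis V B;
       forall f : sets M, finset_fun f ->
         (exists n : num M, forall X : num M,
            is_code X -> fin_card_ge X n -> exists t, fapp f t X) ->
         exists X : num M,
           [/\ is_code X,
               forall t, ~ fapp f t X
             & forall Y : num M,
                 is_code Y -> fin_card_lt X Y -> exists t, fapp f t Y];
       forall f : sets M, finset_fun f ->
         (exists n : num M, forall X : num M,
            is_code X -> fin_card_ge X n -> exists t, fapp f t X) ->
         exists X : num M,
           [/\ is_code X,
               forall t, ~ fapp f t X
             & forall Y : num M,
                 is_code Y -> fproper X Y -> exists t, fapp f t Y]].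
Proof.
tfae.
- by move=> hI K V; apply: basis_of_ISigma2.
- by move=> /last_hits_of_bases/ISigma2_of_last_hits; apply: enumeration_of_ISigma2.
- move=> H f hf hn; have [X [cX hX Xmax]] := H f hf hn.
  exists X; split=> // Y cY XY; apply: Xmax => //.
  have [k ck] := fin_card_ex X; have [l cl] := fin_card_ex Y.
  by exists k, l; split=> //; apply: fin_card_proper ck cl XY.
by move=> H; apply/ISigma2_of_last_hits/last_hits_of_enumeration.
Qed.
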